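(* For integers $n^+,n^-\ge1$, let $\mathcal L^0_{n^+,n^-}\le\mathcal L_{n^+,n^-}$ be the maximum number of hyperbolic limit cycles bifurcating from the origin of a system $$\dot z=F^+(z)\ \text{ when } \operatorname{Im}(z)>0,\qquad \dot z=F^-(z)\ \text{ when }\operatorname{Im}(z)<0,$$ with $F^\pm$ complex polynomials of $z$ of degree $n^\pm$. Then, for $n^++n^-\le4$, $$\mathcal L^0_{1,1}\ge1,\qquad \mathcal L^0_{1,2}\ge3,\qquad \mathcal L^0_{2,1}\ge3,\qquad \mathcal L^0_{1,3}\ge5,\qquad \mathcal L^0_{3,1}\ge5,\qquad \mathcal L^0_{2,2}\ge4 .$$
   Context: $z=x+iy$. A piecewise polynomial holomorphic system (PWHS) is a system of the displayed form; orbits on the discontinuity line $\operatorname{Im} z=0$ are defined by the Filippov convention (so sliding segments are allowed). A limit cycle is an isolated periodic orbit. $\mathcal L_{n^+,n^-}\in\mathbb N\cup\{\infty\}$ denotes the maximum number of limit cycles that a PWHS with $\deg F^\pm=n^\pm$ can have. Limit cycles bifurcate from the origin if they appear, in arbitrarily small neighbourhoods of the origin, for arbitrarily small perturbations, within the class of PWHS with $\deg F^\pm=n^\pm$, of a system for which the origin is a monodromic equilibrium point ($F^\pm(0)=0$). The perturbations are allowed to have $F^\pm(0)\neq0$, i.e. to create a sliding segment. *)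

(* Defs.v *)
From HB Require Import structures.
From mathcomp Require Import all_boot all_order all_algebra.
From mathcomp Require Import all_classical all_reals all_analysis.
From mathcomp Require Import complex.

Set Implicit Arguments.
Unset Strict Implicit.
Unset Printing Implicit Defensive.

Import Order.TTheory GRing.Theory Num.Theory.
Import numFieldNormedType.Exports.

Local Open Scope classical_set_scope.
Local Open Scope ring_scope.
Local Open Scope complex_scope.

Local Notation Re := complex.Re.
Local Notation Im := complex.Im.

(** z' = Fup(z) where Im z > 0 and z' = Fdn(z) where Im z < 0. *)
Record pwhs (R : realType) := Pwhs { Fup : {poly R[i]}; Fdn : {poly R[i]} }.

Definition has_degrees (R : realType) (np nm : nat) (S : pwhs R) : Prop :=
  size (Fup S) = np.+1 /\ size (Fdn S) = nm.+1.

(** Filippov's set-valued field: off the real line it is the given field, on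
    the real line it is the segment joining the two fields. *)
Definition filippov_field (R : realType) (S : pwhs R) (z : R[i]) : set R[i] :=
  if 0 < Im z then [set (Fup S).[z]]
  else if Im z < 0 then [set (Fdn S).[z]]
  else [set w | exists2 l : R, 0 <= l <= 1 &
                  w = l%:C * (Fup S).[z] + (1 - l)%:C * (Fdn S).[z]].

(** Absolutely continuous solutions on [a, b] of the differential inclusion
    z' \in filippov_field S z.  Absolute continuity is expressed by exhibiting
    [g] as an indefinite Lebesgue integral of its derivative [u]. *)
Definition filippov_solution (R : realType) (S : pwhs R) (a b : R)
    (g : R -> R[i]) : Prop :=
  exists u : R -> R[i],
    [/\ (@lebesgue_measure R).-integrable `[a, b] (fun s => (Re (u s))%:E),
        (@lebesgue_measure R).-integrable `[a, b] (fun s => (Im (u s))%:E),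
        {ae @lebesgue_measure R, forall s,
           s \in `[a, b] -> filippov_field S (g s) (u s)} &
        forall t, t \in `[a, b] ->
          g t = g a +
            ((\int[lebesgue_measure]_(s in `[a, t]) Re (u s)) +i*
             (\int[lebesgue_measure]_(s in `[a, t]) Im (u s)))].

(** Injectivity on [0, T[ makes T the minimal period and the orbit a simple
    closed curve.  It is imposed explicitly because solutions of the inclusion
    may branch on escaping segments. *)
Definition periodic_solution (R : realType) (S : pwhs R) (T : R)
    (g : R -> R[i]) : Prop :=
  [/\ 0 < T, filippov_solution S 0 T g, g T = g 0 &
      forall s t, s \in `[0, T[ -> t \in `[0, T[ -> g s = g t -> s = t].

Definition periodic_orbit (R : realType) (S : pwhs R) (G : set R[i]) : Prop :=
  exists (T : R) (g : R -> R[i]),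
    periodic_solution S T g /\ G = g @` `[0, T]%classic.

(** Periodic orbits are compact, so uniform tubes [e] are a basis of
    neighbourhoods of [G]. *)
Definition limit_cycle (R : realType) (S : pwhs R) (G : set R[i]) : Prop :=
  periodic_orbit S G /\
  exists2 e : R, 0 < e &
    forall H : set R[i], periodic_orbit S H ->
      (forall z, H z -> exists2 w, G w & `|z - w| < e%:C) -> H = G.

Definition crossing_point (R : realType) (S : pwhs R) (z : R[i]) : Prop :=
  0 < Im (Fup S).[z] * Im (Fdn S).[z].

(** The line through [p] with direction [v] is parallel to no admissible
    velocity at [p]. *)
Definition transversal_to_flow (R : realType) (S : pwhs R) (p v : R[i]) : Prop :=
  forall w, filippov_field S p w -> Im (conjc v * w) != 0.

(** [P] is, near 0, the return map on the section s |-> p + s v, with return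
    time [tau].  As [T] is the period of the orbit of [p], continuity of [tau]
    selects the first return. *)
Definition return_map (R : realType) (S : pwhs R) (T : R) (p v : R[i])
    (P tau : R -> R) : Prop :=
  [/\ P 0 = 0, tau 0 = T, {for 0, continuous tau} &
      \forall s \near (0 : R), 0 < tau s /\
        exists g : R -> R[i],
          [/\ filippov_solution S 0 (tau s) g,
              g 0 = p + s%:C * v &
              g (tau s) = p + (P s)%:C * v]].

(** Requiring the orbit to meet the real line at crossing points only makes
    solutions unique around it, so the return map is determined by the section;
    its derivative [mu] at the fixed point does not depend on the section. *)
Definition hyperbolic_limit_cycle (R : realType) (S : pwhs R)
    (G : set R[i]) : Prop :=
  limit_cycle S G /\
  exists (T : R) (g : R -> R[i]) (v : R[i]) (P tau : R -> R) (mu : R),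
    [/\ periodic_solution S T g /\ G = g @` `[0, T]%classic,
        forall z, G z -> Im z = 0 -> crossing_point S z,
        transversal_to_flow S (g 0) v,
        return_map S T (g 0) v P tau &
        is_derive (0 : R) (1 : R) P mu /\ `|mu| != 1].

Definition half_plane (R : realType) (up : bool) (z : R[i]) : Prop :=
  if up then 0 < Im z else Im z < 0.

(** The origin is an equilibrium and, in arbitrarily small neighbourhoods [e],
    the orbits starting on the positive real axis close to 0 go round it: they
    traverse one half plane down to the negative real axis, then the other half
    plane back to the positive real axis. *)
Definition monodromic_origin (R : realType) (S : pwhs R) : Prop :=
  [/\ (Fup S).[0] = 0, (Fdn S).[0] = 0 &
      exists up : bool, forall e : R, 0 < e -> exists2 d : R, 0 < d &
        forall x : R, 0 < x < d ->
          exists (g : R -> R[i]) (t1 t2 : R),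
            [/\ 0 < t1 < t2, filippov_solution S 0 t2 g,
                [/\ g 0 = x%:C,
                    (exists2 y : R, y < 0 & g t1 = y%:C) &
                    (exists2 y : R, 0 < y & g t2 = y%:C)],
                (forall t, t \in `]0, t1[ -> half_plane up (g t)) /\
                (forall t, t \in `]t1, t2[ -> half_plane (~~ up) (g t)) &
                forall t, t \in `[0, t2] -> `|g t| < e%:C]].

Definition at_least (R : realType) (k : nat) (Q : set R[i] -> Prop) : Prop :=
  exists G : 'I_k -> set R[i], injective G /\ forall i, Q (G i).

Definition close_to (R : realType) (d : R) (S S' : pwhs R) : Prop :=
  forall j : nat, `|(Fup S')`_j - (Fup S)`_j| < d%:C /\
                  `|(Fdn S')`_j - (Fdn S)`_j| < d%:C.

Definition bifurcating (R : realType) (np nm k : nat) (S : pwhs R) : Prop :=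
  forall e d : R, 0 < e -> 0 < d -> exists S' : pwhs R,
    [/\ has_degrees np nm S', close_to d S S' &
        at_least k (fun G => hyperbolic_limit_cycle S' G /\
                             forall z, G z -> `|z| < e%:C)].

(** [cL] counts all limit cycles of a system with the given degrees; [cL0]
    counts the hyperbolic ones bifurcating from a monodromic origin.  Both are
    suprema in \bar R of sets of naturals, +oo when unbounded. *)
Definition cL (R : realType) (np nm : nat) : \bar R :=
  ereal_sup [set (k%:R)%:E | k in [set k : nat |
    exists S : pwhs R, has_degrees np nm S /\ at_least k (limit_cycle S)]].

Definition cL0 (R : realType) (np nm : nat) : \bar R :=
  ereal_sup [set (k%:R)%:E | k in [set k : nat |
    exists S : pwhs R, [/\ has_degrees np nm S, monodromic_origin S &
                           bifurcating np nm k S]]].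

(* Main.v *)
Require Import Defs.
From mathcomp Require Import all_boot all_order all_algebra.
From mathcomp Require Import all_classical all_reals all_analysis.
From mathcomp Require Import measurable_realfun complex ring lra.

(* In the upper half plane the field is [lam u (1 + a u + b u^2)], where [1 / lam = s - i] and
   [u = z - t] with [t] real; the lower field, seen after [z -> - z], has the same form with
   [t = 0].  Let [P] be the holomorphic function, vanishing at 0, such that [log u + P u] is a
   primitive of [1 / (u (1 + a u + b u^2))].  Along a solution [(s - i) (log u + P u)] moves with
   unit real speed, so the upper half plane carries an arc from [x > 0] to [y < 0] exactly when
   its imaginary part matches: [ln |y| - Im ((s - i) P y) = ln x - Im ((s - i) P x) + s pi].

   Hence small closed orbits are the zeros of a real function of one variable, the closing
   defect, which is affine in [s].  If it changes sign [k] times, a small change of [s] makes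
   one zero in each interval simple, and a simple zero is a hyperbolic limit cycle.  The orbit
   is isolated among all Filippov solutions because it crosses the real line transversally and
   the flow rotates around [t], resp. 0.

   Finally [a], [b], [s], [t] are taken to be functions of a small [e] such that the defect at
   [e xi], divided by a power of [e], tends to [G xi], where [xi G xi] is a polynomial.  The shift [t],
   which opens a sliding segment, gives its constant term, [s] the next one, and the Taylor
   coefficients of [P] the others; they can be adjusted so that the roots are [1, ..., k].
   The change of variable [z -> - z] exchanges the two degrees. *)

Set Implicit Arguments.
Unset Strict Implicit.
Unset Printing Implicit Defensive.

Import Order.TTheory GRing.Theory Num.Theory.
Import numFieldNormedType.Exports.

Local Open Scope classical_set_scope.
Local Open Scope ring_scope.
Local Open Scope complex_scope.

Local Notation Re := complex.Re.
Local Notation Im := complex.Im.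
Local Notation normc := Normc.normc.

(** * Complex modulus, derivatives and curves *)

(** The linear parts are taken with [s] close to 1 above and [s' = -1] below. Over a full turn they
    compensate, but the lower half turn contracts by [k = exp (- pi)]. With [s = s' = 0] the two
    ends of an arc would be symmetric to first order, and the even Taylor terms, which enter with a
    factor [1 - k^j], would be lost; [k <> 1] keeps every degree available.

    The expansion in [e] controls the values of the defect but not its derivatives, so the zeros are
    not known to be simple just because the roots of the limit polynomial are. Simplicity comes from
    moving [s] to a common regular value of the function [closing_parameter], which solves the
    affine equation of closing for [s].

    A limit cycle has to be isolated among all solutions of the inclusion, which need not be unique
    on the real line. All that is extracted from such a solution is that bounds on the admissible
    velocities bound its increments. This already forces it to cross where both fields point to the
    same side, and to be a classical solution off the real line. *)

Section ComplexModulus.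
Variable R : realType.
Implicit Types (z w : R[i]) (x : R).

Lemma Re_add z w : Re (z + w) = Re z + Re w. Proof. by case: z w => [? ?] [? ?]. Qed.
Lemma Im_add z w : Im (z + w) = Im z + Im w. Proof. by case: z w => [? ?] [? ?]. Qed.
Lemma Re_opp z : Re (- z) = - Re z. Proof. by case: z. Qed.
Lemma Im_opp z : Im (- z) = - Im z. Proof. by case: z. Qed.
Lemma Re_mul z w : Re (z * w) = Re z * Re w - Im z * Im w.
Proof. by case: z w => [? ?] [? ?]. Qed.
Lemma Im_mul z w : Im (z * w) = Re z * Im w + Im z * Re w.
Proof. by case: z w => [? ?] [? ?]. Qed.
Lemma Re_inv z : Re z^-1 = Re z / (Re z ^+ 2 + Im z ^+ 2). Proof. by case: z. Qed.
Lemma Im_inv z : Im z^-1 = - Im z / (Re z ^+ 2 + Im z ^+ 2).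
Proof. by case: z => a b /=; rewrite mulNr. Qed.
Lemma Re_one : Re (1 : R[i]) = 1. Proof. by []. Qed.
Lemma Im_one : Im (1 : R[i]) = 0. Proof. by []. Qed.

Definition ReImE := (Re_add, Im_add, Re_opp, Im_opp, Re_mul, Im_mul, Re_one, Im_one).

Lemma complexP z w : Re z = Re w -> Im z = Im w -> z = w.
Proof. by case: z w => [? ?] [? ?] /= -> ->. Qed.

Lemma normc_ge0 z : 0 <= normc z.
Proof. by case: z => a b; exact: sqrtr_ge0. Qed.
Lemma normcE2 z : `|z| = (normc z)%:C.
Proof. by rewrite normc_def; case: z. Qed.
Lemma sqr_normcE z : normc z ^+ 2 = Re z ^+ 2 + Im z ^+ 2.
Proof. by case: z => a b /=; rewrite sqr_sqrtr// addr_ge0 ?sqr_ge0. Qed.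
Lemma normcN z : normc (- z) = normc z.
Proof. exact: complex.normcN. Qed.
Lemma normcM z w : normc (z * w) = normc z * normc w.
Proof. exact: Normc.normcM. Qed.
Lemma normcV z : normc z^-1 = (normc z)^-1.
Proof. exact: Normc.normcV. Qed.
Lemma normcX z n : normc (z ^+ n) = normc z ^+ n.
Proof. by elim: n => [|n IH]; rewrite ?expr0 ?Normc.normc1// !exprS normcM IH. Qed.
Lemma normc_real x : normc x%:C = `|x|.
Proof. by rewrite /= expr0n addr0 sqrtr_sqr. Qed.
Lemma ler_normcD z w : normc (z + w) <= normc z + normc w.
Proof. exact: complex.le_normcD. Qed.
Lemma ler_normcB z w : normc (z - w) <= normc z + normc w.
Proof. by rewrite (le_trans (ler_normcD _ _))// normcN. Qed.
Lemma normc_distC z w : normc (z - w) = normc (w - z).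
Proof. by rewrite -normcN opprB. Qed.
Lemma normc_le_dist z w : normc z <= normc w + normc (z - w).
Proof. by have := ler_normcD w (z - w); rewrite addrC subrK. Qed.
Lemma normc_distD u z w : normc (z - w) <= normc (z - u) + normc (u - w).
Proof. by have := ler_normcD (z - u) (u - w); rewrite addrA subrK. Qed.
Lemma normc0 : normc (0 : R[i]) = 0. Proof. exact: Normc.normc0. Qed.
Lemma normc1 : normc (1 : R[i]) = 1. Proof. exact: Normc.normc1. Qed.
Lemma normc_eq0 z : (normc z == 0) = (z == 0).
Proof. by apply/eqP/eqP => [/Normc.eq0_normc//|->]; rewrite normc0. Qed.
Lemma normc_gt0 z : (0 < normc z) = (z != 0).
Proof. by rewrite lt_def normc_ge0 andbT normc_eq0. Qed.
Lemma Re_le_normc z : `|Re z| <= normc z.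
Proof.
by rewrite -(@ler_pXn2r _ 2) ?nnegrE ?normc_ge0// sqr_normcE real_normK ?num_real// lerDl sqr_ge0.
Qed.
Lemma Im_le_normc z : `|Im z| <= normc z.
Proof.
by rewrite -(@ler_pXn2r _ 2) ?nnegrE ?normc_ge0// sqr_normcE real_normK ?num_real// lerDr sqr_ge0.
Qed.
Lemma normc_le_ReIm z : normc z <= `|Re z| + `|Im z|.
Proof.
rewrite -(@ler_pXn2r _ 2) ?nnegrE ?normc_ge0 ?addr_ge0//.
rewrite sqr_normcE -(real_normK (num_real (Re z))) -(real_normK (num_real (Im z))).
have := normr_ge0 (Re z); have := normr_ge0 (Im z); nra.
Qed.
End ComplexModulus.

(** * Complex differentiability, with explicit remainders *)

Section ComplexDerivative.
Variable R : realType.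
Local Notation C := R[i].
Implicit Types (f g : C -> C) (z w d : C).

Definition ccont f z := forall e : R, 0 < e ->
  exists2 k : R, 0 < k & forall w, normc (w - z) < k -> normc (f w - f z) < e.

(** The bound is multiplied by [normc (w - z)] instead of dividing by it: the point [w = z] is no
    exception, and remainders compose by products. *)
Definition cderiv f z d := forall e : R, 0 < e ->
  exists2 k : R, 0 < k & forall w, normc (w - z) < k ->
    normc (f w - f z - d * (w - z)) <= e * normc (w - z).

Lemma cderiv_local f g z d (r : R) : 0 < r ->
  (forall w, normc (w - z) < r -> f w = g w) -> cderiv f z d -> cderiv g z d.
Proof.
move=> r0 fg df e e0; have [k k0 kf] := df e e0.
exists (Num.min k r) => [|w]; first by rewrite lt_min k0.
rewrite lt_min => /andP[wk wr]; rewrite -!fg//; first exact: kf.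
by rewrite subrr normc0.
Qed.

Lemma cderiv_lip f z d : cderiv f z d -> exists2 k : R, 0 < k &
  forall w, normc (w - z) < k -> normc (f w - f z) <= (normc d + 1) * normc (w - z).
Proof.
move=> /(_ 1 ltr01)[k k0 kf]; exists k => // w /kf kw.
rewrite (le_trans (normc_le_dist _ (d * (w - z))))// normcM mulrDl lerD//.
Qed.

Lemma cderiv_cont f z d : cderiv f z d -> ccont f z.
Proof.
move=> /cderiv_lip[k k0 kf] e e0.
have d0 : 0 < normc d + 1 by rewrite ltr_wpDl ?normc_ge0.
exists (Num.min k (e / (normc d + 1))) => [|w].
  by rewrite lt_min k0 divr_gt0.
rewrite lt_min => /andP[/kf wk]; rewrite ltr_pdivlMr// mulrC.
exact: le_lt_trans.
Qed.

Lemma cderiv_cst (c z : C) : cderiv (fun=> c) z 0.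
Proof.
by move=> e e0; exists 1 => // w _; rewrite mul0r !subrr normc0 mulr_ge0 ?normc_ge0// ltW.
Qed.

Lemma cderiv_id z : cderiv id z 1.
Proof.
by move=> e e0; exists 1 => // w _; rewrite mul1r !subrr normc0 mulr_ge0 ?normc_ge0// ltW.
Qed.

Lemma cderivD f g z d d' : cderiv f z d -> cderiv g z d' ->
  cderiv (fun w => f w + g w) z (d + d').
Proof.
move=> df dg e e0; have e20 : 0 < e / 2 by rewrite divr_gt0.
have [k k0 kf] := df _ e20; have [l l0 lg] := dg _ e20.
exists (Num.min k l) => [|w]; first by rewrite lt_min k0.
rewrite lt_min => /andP[/kf wk /lg wl].
have -> : f w + g w - (f z + g z) - (d + d') * (w - z) =
  (f w - f z - d * (w - z)) + (g w - g z - d' * (w - z)) by ring.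
by rewrite (le_trans (ler_normcD _ _))// [e]splitr mulrDl lerD.
Qed.

Lemma cderiv_comp f g z d d' : cderiv f z d -> cderiv g (f z) d' ->
  cderiv (fun w => g (f w)) z (d' * d).
Proof.
move=> df dg e e0; have [k0 k00 fl] := cderiv_lip df.
have N1 : 0 < normc d + 1 by rewrite ltr_wpDl ?normc_ge0.
have N2 : 0 < normc d' + 1 by rewrite ltr_wpDl ?normc_ge0.
have e1 : 0 < e / 2 / (normc d + 1) by rewrite !divr_gt0.
have e2 : 0 < e / 2 / (normc d' + 1) by rewrite !divr_gt0.
have [l l0 lg] := dg _ e1; have [k k0' kf] := df _ e2.
have [m m0 mf] := cderiv_cont df l0.
exists (Num.min k (Num.min k0 m)) => [|w]; first by rewrite !lt_min k00 k0'.
rewrite !lt_min => /and3P[/kf wk /fl wk0 /mf/lg wm].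
have -> : g (f w) - g (f z) - d' * d * (w - z) =
  (g (f w) - g (f z) - d' * (f w - f z)) + d' * (f w - f z - d * (w - z)) by ring.
rewrite (le_trans (ler_normcD _ _))// [e]splitr mulrDl lerD//.
  apply: le_trans wm _.
  by rewrite (le_trans (ler_wpM2l (ltW e1) wk0))// mulrA mulfVK// gt_eqF.
rewrite normcM (le_trans (ler_wpM2l (normc_ge0 _) wk))//.
rewrite mulrA ler_wpM2r ?normc_ge0// mulrA ler_pdivrMr// mulrC.
by rewrite ler_wpM2l ?divr_ge0 ?lerDl// ltW.
Qed.

Lemma cderivM f g z d d' : cderiv f z d -> cderiv g z d' ->
  cderiv (fun w => f w * g w) z (d * g z + f z * d').
Proof.
move=> df dg e e0; have [l l0 gl] := cderiv_lip dg.
set A := normc d * (normc d' + 1) + normc (g z) + normc (f z) + 2.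
have nn := @normc_ge0 R.
have A0 : 0 < A.
  by rewrite /A; have := mulr_ge0 (nn d) (addr_ge0 (nn d') ler01);
     have := nn (g z); have := nn (f z); lra.
have eA : 0 < e / A by rewrite divr_gt0.
have e1 : 0 < Num.min 1 (e / A) by rewrite lt_min ltr01.
have [k k0 kf] := df _ e1; have [k' k0' kg] := dg _ e1.
have [m m0 mg] := cderiv_cont dg e1.
exists (Num.min (Num.min k k') (Num.min l (Num.min m (e / A)))) => [|w].
  by rewrite !lt_min k0 k0' l0 m0.
rewrite !lt_min => /and4P[/andP[/kf wf /kg wg] /gl wl /mg wm we].
have -> : f w * g w - f z * g z - (d * g z + f z * d') * (w - z) =
  (f w - f z - d * (w - z)) * (g z + (g w - g z)) + d * (w - z) * (g w - g z) +
  f z * (g w - g z - d' * (w - z)) by ring.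
set N := normc (w - z) in wf wg wl we *.
have N0 : 0 <= N by exact: nn.
have me : Num.min 1 (e / A) <= e / A by rewrite ge_min lexx orbT.
have m1 : Num.min 1 (e / A) <= 1 by rewrite ge_min lexx.
have T1 : normc (f w - f z - d * (w - z)) * normc (g z + (g w - g z)) <=
    e / A * N * (normc (g z) + 1).
  apply: ler_pM => //; first by apply: le_trans wf _; rewrite ler_wpM2r.
  by rewrite (le_trans (ler_normcD _ _))// lerD// (le_trans (ltW wm)).
have T2 : normc (d * (w - z)) * normc (g w - g z) <= e / A * N * (normc d * (normc d' + 1)).
  have -> : e / A * N * (normc d * (normc d' + 1)) = normc d * (e / A) * ((normc d' + 1) * N) by ring.
  apply: ler_pM => //; rewrite normcM ler_wpM2l//; exact: ltW.
have T3 : normc (f z) * normc (g w - g z - d' * (w - z)) <= e / A * N * normc (f z).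
  rewrite mulrC ler_wpM2r//; apply: le_trans wg _; rewrite ler_wpM2r//.
have -> : e * N = e / A * N * A by field; rewrite gt_eqF.
rewrite (le_trans (ler_normcD _ _))// (le_trans (lerD (ler_normcD _ _) (lexx _)))// !normcM.
rewrite normcM in T2; have := lerD (lerD T1 T2) T3; move=> T; apply: le_trans T _.
have h0 : 0 <= e / A * N by rewrite mulr_ge0// ltW.
rewrite -!mulrDr; apply: ler_wpM2l => //; rewrite /A; lra.
Qed.

(** Derivative of a continuous branch [zeta] of the inverse of [psi]. The expansion of [psi] at
    [zeta t] first bounds [zeta s - zeta t] by a multiple of [s - t]; this bound, put back into the
    expansion, isolates the linear term. It serves both for [clog] and for the arcs. *)
Lemma cderiv_inverse (psi zeta W : C -> C) t d e' (r : R) : 0 < r -> d != 0 ->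
  (forall s, normc (s - t) < r -> psi (zeta s) = W s) ->
  ccont zeta t -> cderiv psi (zeta t) d -> cderiv W t e' -> cderiv zeta t (e' / d).
Proof.
move=> r0 d0 pW cz dpsi dW e e0.
have nd : 0 < normc d by rewrite normc_gt0.
have nn := @normc_ge0 R.
have Ntr : psi (zeta t) = W t by apply: pW; rewrite subrr normc0.
set B := normc e' + 1; have B0 : 0 < B by rewrite /B ltr_wpDl.
(* The first bound absorbs the remainder into [normc d * Z], which gives [normc d * Z <= 2 B N]; the
   second one makes the remainder at most half of the allowed error [e * normc d * N]. *)
set e1 := Num.min (normc d / 2) (e * normc d ^+ 2 / (4 * B)).
have e10 : 0 < e1.
  by rewrite /e1 lt_min !divr_gt0 ?mulr_gt0 ?exprn_gt0.
have e20 : 0 < e * normc d / 2 by rewrite divr_gt0 ?mulr_gt0.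
have [k k0 kpsi] := dpsi _ e10; have [l l0 lz] := cz _ k0.
have [m m0 mW] := dW _ e20; have [q q0 qW] := cderiv_lip dW.
exists (Num.min (Num.min r l) (Num.min m q)) => [|s].
  by rewrite !lt_min r0 l0 m0.
rewrite !lt_min => /andP[/andP[/pW sW /lz/kpsi sp] /andP[/mW sm /qW sq]].
rewrite sW Ntr in sp.
set Z := normc (zeta s - zeta t) in sp.
set N := normc (s - t) in sm sq *.
have h1 : normc d * Z <= 2 * (B * N).
  have : normc (d * (zeta s - zeta t)) <= normc (W s - W t) + e1 * Z.
    rewrite (le_trans (normc_le_dist _ (W s - W t)))// lerD2l normc_distC//.
  have : e1 * Z <= normc d / 2 * Z by rewrite ler_wpM2r ?nn// /e1 ge_min lexx.
  rewrite normcM -/Z; move: sq; rewrite -/B; lra.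
have h2 : normc (d * (zeta s - zeta t) - e' * (s - t)) <= e * normc d * N.
  have -> : d * (zeta s - zeta t) - e' * (s - t) =
    (W s - W t - e' * (s - t)) - (W s - W t - d * (zeta s - zeta t)) by ring.
  rewrite (le_trans (ler_normcB _ _))//.
  have : e1 * Z <= e * normc d ^+ 2 / (4 * B) * Z.
    by rewrite ler_wpM2r ?nn// /e1 ge_min lexx orbT.
  have -> : e * normc d ^+ 2 / (4 * B) * Z = (e * normc d) / (4 * B) * (normc d * Z).
    by field; rewrite gt_eqF.
  have c0 : 0 <= e * normc d / (4 * B) by rewrite ?divr_ge0 ?mulr_ge0 ?ltW.
  move=> /le_trans/(_ (ler_wpM2l c0 h1)).
  have -> : e * normc d / (4 * B) * (2 * (B * N)) = e * normc d / 2 * N.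
    by field; rewrite gt_eqF.
  by move: sm sp; lra.
have -> : zeta s - zeta t - e' / d * (s - t) =
  (d * (zeta s - zeta t) - e' * (s - t)) / d by field.
by rewrite normcM normcV ler_pdivrMr// mulrAC.
Qed.
End ComplexDerivative.

(** * Derivatives and mean values of real functions *)

Section RealCalculus.
Variable R : realType.
Implicit Types f df : R -> R.

Lemma is_derive_epsP f (x d : R) : is_derive x (1 : R) f d <->
  forall e : R, 0 < e -> exists2 k : R, 0 < k &
    forall y, `|y - x| < k -> `|f y - f x - d * (y - x)| <= e * `|y - x|.
Proof.
have cvgE : (h^-1 *: (f (h *: (1 : R) + x) - f x) @[h --> 0^'] --> d) <->
  forall e : R, 0 < e -> exists2 k : R, 0 < k &
    forall y, `|y - x| < k -> `|f y - f x - d * (y - x)| <= e * `|y - x|.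
  split=> [/cvgrPdist_le H e /H [k /= k0 kH]|H].
    exists k => // y yx; have [->|xy] := eqVneq y x.
      by rewrite !subrr mulr0 subrr normr0 mulr0.
    have := kH (y - x); rewrite /= sub0r normrN subr_eq0 => /(_ yx xy).
    rewrite /GRing.scale /= mulr1 subrK.
    have -> : d - (y - x)^-1 * (f y - f x) = - (f y - f x - d * (y - x)) / (y - x).
      by field; rewrite subr_eq0.
    by rewrite normrM normfV normrN ler_pdivrMr ?normr_gt0 ?subr_eq0.
  apply/cvgrPdist_le => e /H[k k0 kH]; exists k => //= h; rewrite /= sub0r normrN => hk h0.
  have := kH (h + x); rewrite addrK => /(_ hk).
  rewrite /GRing.scale /= mulr1.
  have -> : d - h^-1 * (f (h + x) - f x) = - (f (h + x) - f x - d * h) / h.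
    by field.
  by rewrite normrM normfV normrN ler_pdivrMr ?normr_gt0.
rewrite -cvgE; split=> [[dx dE]|H].
  by rewrite -dE; exact: dx.
by split; [apply/cvg_ex; exists d|exact: cvg_lim H].
Qed.

Lemma is_derive_local f g (x d k : R) : 0 < k -> (forall y, `|y - x| < k -> f y = g y) ->
  is_derive x (1 : R) f d -> is_derive x (1 : R) g d.
Proof.
move=> k0 fg /is_derive_epsP df; apply/is_derive_epsP => e /df[l l0 H].
exists (Num.min k l) => [|y]; first by rewrite lt_min k0.
rewrite lt_min => /andP[yk /H]; rewrite !fg//.
by rewrite subrr normr0.
Qed.

Lemma is_derive_continuous f (x d : R) : is_derive x (1 : R) f d -> {for x, continuous f}.
Proof. by move=> [dx _]; apply: differentiable_continuous; exact/derivable1_diffP. Qed.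

Lemma derive_continuous_within f df (a b : R) :
  (forall x, a <= x <= b -> is_derive x (1 : R) f (df x)) -> {within `[a, b], continuous f}.
Proof.
move=> H; apply: continuous_in_subspaceT => x /set_mem /=; rewrite in_itv /= => /H.
exact: is_derive_continuous.
Qed.

Lemma mean_value f df (a b : R) : a < b ->
  (forall x, a <= x <= b -> is_derive x (1 : R) f (df x)) ->
  exists2 c, a < c < b & f b - f a = df c * (b - a).
Proof.
move=> ab H; have [|c] := MVT (df := df) ab _ (derive_continuous_within H).
  by move=> x; rewrite in_itv /= => /andP[/ltW ax /ltW xb]; apply: H; rewrite ax.
by rewrite in_itv /=; exists c.
Qed.

Lemma continuous_epsP f (x : R) : {for x, continuous f} <->
  forall e, 0 < e -> exists2 k, 0 < k & forall y, `|y - x| < k -> `|f y - f x| < e.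
Proof.
split=> [/cvgrPdist_lt H e /H[k /= k0 kH]|H].
  exists k => // y yx; rewrite distrC; apply: kH => /=; by rewrite distrC.
apply/cvgrPdist_lt => e /H[k k0 kH]; exists k => //= y /= yx.
by rewrite distrC; apply: kH; rewrite distrC.
Qed.


Lemma mean_value_le f df (a b M : R) : a <= b ->
  (forall x, a <= x <= b -> is_derive x (1 : R) f (df x)) ->
  (forall x, a <= x <= b -> `|df x| <= M) -> `|f b - f a| <= M * (b - a).
Proof.
rewrite le_eqVlt => /predU1P[->|ab] H dM; first by rewrite !subrr normr0 mulr0.
have [c /andP[ac cb] ->] := mean_value ab H.
rewrite normrM (gtr0_norm (x := b - a)) ?subr_gt0// ler_wpM2r ?subr_ge0 ?(ltW ab)//.
by apply: dM; rewrite (ltW ac) (ltW cb).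
Qed.

Lemma derive_pos_lt f df (a b : R) : a < b ->
  (forall x, a <= x <= b -> is_derive x (1 : R) f (df x)) ->
  (forall x, a < x < b -> 0 < df x) -> f a < f b.
Proof.
move=> ab H dp; have [c cab] := mean_value ab H.
by move/eqP; rewrite subr_eq => /eqP ->; rewrite ltrDr mulr_gt0 ?dp ?subr_gt0.
Qed.
End RealCalculus.

(** * Differentiable curves in the complex plane *)

Section Curves.
Variable R : realType.
Local Notation C := R[i].
Implicit Types (f : C -> C) (g : R -> C) (z w d : C).

(** Componentwise, so that the real mean value theorem and the fundamental theorem of calculus apply
    to each coordinate; [vderiv_epsP] gives the equivalent form with the modulus. *)
Definition vderiv g (t : R) d :=
  is_derive t (1 : R) (fun s => Re (g s)) (Re d) /\
  is_derive t (1 : R) (fun s => Im (g s)) (Im d).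

Lemma vderiv_epsP g t d : vderiv g t d <-> forall e : R, 0 < e -> exists2 k : R, 0 < k &
  forall s, `|s - t| < k -> normc (g s - g t - d * (s - t)%:C) <= e * `|s - t|.
Proof.
split=> [[/is_derive_epsP Hr /is_derive_epsP Hi] e e0|H].
  have e20 : 0 < e / 2 by rewrite divr_gt0.
  have [k k0 kH] := Hr _ e20; have [l l0 lH] := Hi _ e20.
  exists (Num.min k l) => [|s]; first by rewrite lt_min k0.
  rewrite lt_min => /andP[/kH sk /lH sl].
  rewrite (le_trans (normc_le_ReIm _))// [e]splitr mulrDl lerD// !ReImE /=.
  - by apply: le_trans sk; rewrite mulr0 subr0.
  - by apply: le_trans sl; rewrite mulr0 add0r.
split; apply/is_derive_epsP => e /H[k k0 kH]; exists k => // s /kH; apply: le_trans.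
- by apply: le_trans (Re_le_normc _); rewrite !ReImE /= mulr0 subr0.
- by apply: le_trans (Im_le_normc _); rewrite !ReImE /= mulr0 add0r.
Qed.

Lemma Re_conjM z w : Re (z^* * w) = Re z * Re w + Im z * Im w.
Proof. by case: z w => [a b] [c d] /=; ring. Qed.
Lemma Im_conjM z w : Im (z^* * w) = Re z * Im w - Im z * Re w.
Proof. by case: z w => [a b] [c d] /=; ring. Qed.
Lemma normc_conj z : normc z^* = normc z.
Proof. by case: z => a b /=; rewrite sqrrN. Qed.

Lemma vderiv_of_cderiv f (t : R) d : cderiv f t%:C d -> vderiv (fun s => f s%:C) t d.
Proof.
move=> H; apply/vderiv_epsP => e /H[k k0 kH]; exists k => // s.
by rewrite -normc_real rmorphB => /kH.
Qed.

Lemma vderiv_cont g t d : vderiv g t d -> forall e : R, 0 < e ->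
  exists2 k : R, 0 < k & forall s, `|s - t| < k -> normc (g s - g t) < e.
Proof.
move=> [/is_derive_continuous/continuous_epsP Hr /is_derive_continuous/continuous_epsP Hi] e e0.
have e20 : 0 < e / 2 by rewrite divr_gt0.
have [k k0 kH] := Hr _ e20; have [l l0 lH] := Hi _ e20.
exists (Num.min k l) => [|s]; first by rewrite lt_min k0.
rewrite lt_min => /andP[/kH sk /lH sl].
by rewrite (le_lt_trans (normc_le_ReIm _))// [e]splitr ltrD// !ReImE.
Qed.

Lemma vderiv_comp f g (t : R) d d' : vderiv g t d -> cderiv f (g t) d' ->
  vderiv (fun s => f (g s)) t (d' * d).
Proof.
move=> dg df; apply/vderiv_epsP => e e0.
have N1 : 0 < normc d + 1 by rewrite ltr_wpDl ?normc_ge0.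
have N2 : 0 < normc d' + 1 by rewrite ltr_wpDl ?normc_ge0.
have e1 : 0 < e / 2 / (normc d + 1) by rewrite !divr_gt0.
have e2 : 0 < e / 2 / (normc d' + 1) by rewrite !divr_gt0.
have [l l0 lg] := df _ e1; have [k k0' kf] := (vderiv_epsP g t d).1 dg _ e2.
have [k0 k00 kl] := (vderiv_epsP g t d).1 dg _ ltr01.
have fl s : `|s - t| < k0 -> normc (g s - g t) <= (normc d + 1) * `|s - t|.
  move=> /kl; rewrite mulrDl => H.
  by rewrite (le_trans (normc_le_dist _ (d * (s - t)%:C)))// normcM normc_real lerD.
have [m m0 mf] := vderiv_cont dg l0.
exists (Num.min k (Num.min k0 m)) => [|s]; first by rewrite !lt_min k00 k0'.
rewrite !lt_min => /and3P[/kf wk /fl wk0 /mf/lg wm].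
have -> : f (g s) - f (g t) - d' * d * (s - t)%:C =
  (f (g s) - f (g t) - d' * (g s - g t)) + d' * (g s - g t - d * (s - t)%:C) by ring.
rewrite (le_trans (ler_normcD _ _))// [e]splitr mulrDl lerD//.
  apply: le_trans wm _.
  by rewrite (le_trans (ler_wpM2l (ltW e1) wk0))// mulrA mulfVK// gt_eqF.
rewrite normcM (le_trans (ler_wpM2l (normc_ge0 _) wk))//.
rewrite mulrA ler_wpM2r// mulrA ler_pdivrMr// mulrC.
by rewrite ler_wpM2l ?divr_ge0 ?lerDl// ltW.
Qed.

(* Projecting on the direction of [f w - f z] reduces to the real mean value theorem. *)
Lemma cderiv_lipschitz f (df : C -> C) (z w : C) (M : R) :
  (forall s : R, 0 <= s <= 1 -> cderiv f (z + s%:C * (w - z)) (df (z + s%:C * (w - z)))) ->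
  (forall s : R, 0 <= s <= 1 -> normc (df (z + s%:C * (w - z))) <= M) ->
  normc (f w - f z) <= M * normc (w - z).
Proof.
move=> Hd HM; set c := f w - f z.
have [->|c0] := eqVneq c 0.
  rewrite normc0 mulr_ge0 ?normc_ge0// (le_trans (normc_ge0 _) (HM 0 _))//.
  by rewrite lexx ler01.
pose g (s : R) := z + s%:C * (w - z).
pose p (s : R) : R := Re c * Re (f (g s)) + Im c * Im (f (g s)).
have dg (s : R) : vderiv g s (w - z).
  have -> : w - z = 0 + (1 * (w - z) + s%:C * 0) by ring.
  apply: (@vderiv_of_cderiv (fun u => z + u * (w - z))).
  by apply: cderivD (cderiv_cst _ _) (cderivM (cderiv_id _) (cderiv_cst _ _)).
pose q (s : R) : R := Re c * Re (df (g s) * (w - z)) + Im c * Im (df (g s) * (w - z)).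
have dp (s : R) : 0 <= s <= 1 -> is_derive s (1 : R) p (q s).
  move=> s01; have [Hr Hi] := vderiv_comp (dg s) (Hd s s01).
  exact: (is_deriveD (is_deriveZ (Re c) Hr) (is_deriveZ (Im c) Hi)).
have qM (s : R) : 0 <= s <= 1 -> `|q s| <= normc c * M * normc (w - z).
  move=> s01; have -> : q s = Re (c^* * (df (g s) * (w - z))).
    by rewrite Re_conjM.
  rewrite (le_trans (Re_le_normc _))// !normcM mulrA ler_wpM2r ?normc_ge0//.
  apply: ler_pM; rewrite ?normc_ge0 ?HM//.
  by rewrite normc_conj.
have := mean_value_le ler01 dp qM.
have g1 : g 1 = w by rewrite /g mul1r addrC subrK.
have g0 : g 0 = z by rewrite /g mul0r addr0.
have -> : p 1 - p 0 = normc c ^+ 2.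
  by rewrite sqr_normcE /p g1 g0 /c !ReImE; ring.
rewrite subr0 mulr1 ger0_norm ?sqr_ge0// expr2 -mulrA ler_pM2l//.
by rewrite normc_gt0.
Qed.

End Curves.

(** * Logarithmic primitives *)

Section ComplexExpLog.
Variable R : realType.
Local Notation C := R[i].
Implicit Types z w : C.

Definition cexp z : C := (expR (Re z) * cos (Im z)) +i* (expR (Re z) * sin (Im z)).

Lemma cexpD z w : cexp (z + w) = cexp z * cexp w.
Proof.
by apply: complexP; rewrite !ReImE /= !ReImE expRD ?cosD ?sinD; ring.
Qed.

Lemma cexp0 : cexp 0 = 1.
Proof. by apply: complexP; rewrite /= expR0 ?cos0 ?sin0 ?mulr1 ?mulr0. Qed.

Lemma normc_cexp z : normc (cexp z) = expR (Re z).
Proof.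
rewrite /= !exprMn -mulrDr cos2Dsin2 mulr1 sqrtr_sqr ger0_norm// expR_ge0.
Qed.

Lemma cexp_neq0 z : cexp z != 0.
Proof. by rewrite -normc_gt0 normc_cexp expR_gt0. Qed.

Lemma cexpN z : cexp (- z) = (cexp z)^-1.
Proof.
by apply: (mulfI (cexp_neq0 z)); rewrite -cexpD subrr cexp0 mulfV// cexp_neq0.
Qed.

Lemma cderiv_cexp0 : cderiv cexp 0 1.
Proof.
(* The two coordinates of the remainder contribute at most [(1 + 3) e1 N] and [(3 + 2) e1 N], hence
   the 9. *)
move=> e e0; set e1 := Num.min 1 (e / 9).
have e10 : 0 < e1 by rewrite lt_min ltr01 divr_gt0.
have le11 : e1 <= 1 by rewrite ge_min lexx.
have le19 : e1 <= e / 9 by rewrite ge_min lexx orbT.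
clearbody e1.
have [k k0 Hk] := (is_derive_epsP _ _ _).1 (is_derive_expR (0 : R)) _ e10.
have [l l0 Hl] := (is_derive_epsP _ _ _).1 (is_derive_cos (0 : R)) _ e10.
have [m m0 Hm] := (is_derive_epsP _ _ _).1 (is_derive_sin (0 : R)) _ e10.
exists (Num.min (Num.min k l) (Num.min m e1)) => [|w].
  by rewrite !lt_min k0 l0 m0.
rewrite !subr0 cexp0 mul1r !lt_min => /andP[/andP[wk wl] /andP[wm we]].
set N := normc w in wk wl wm we *.
have uN := Re_le_normc w; have vN := Im_le_normc w; rewrite -/N in uN vN.
have := Hk (Re w); have := Hl (Im w); have := Hm (Im w).
rewrite !subr0 expR0 cos0 sin0 mul1r oppr0 mul0r !subr0 mul1r addr0.
move=> /(_ (le_lt_trans vN wm)) Hs /(_ (le_lt_trans vN wl)) Hc /(_ (le_lt_trans uN wk)) He.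
set u := Re w in uN He *; set v := Im w in vN Hs Hc *.
have E1 : `|expR u - 1 - u| <= e1 * N by apply: le_trans He _; rewrite ler_pM2l.
have E2 : `|cos v - 1| <= e1 * N by apply: le_trans Hc _; rewrite ler_pM2l.
have E3 : `|sin v - v| <= e1 * N by apply: le_trans Hs _; rewrite ler_pM2l.
have N0 : 0 <= N by exact: normc_ge0.
have eN : e1 * N <= N by rewrite ler_piMl.
have E4 : `|expR u| <= 3.
  have -> : expR u = (expR u - 1 - u) + u + 1 by ring.
  rewrite (le_trans (ler_normD _ _))// normr1 -lerBrDr.
  by rewrite (le_trans (ler_normD _ _))//; lra.
have E5 : `|expR u - 1| <= 2 * e1.
  have -> : expR u - 1 = (expR u - 1 - u) + u by ring.
  by rewrite (le_trans (ler_normD _ _))//; lra.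
rewrite (le_trans (normc_le_ReIm _))// !ReImE /= -/u -/v.
have -> : expR u * cos v - 1 - u = (expR u - 1 - u) + expR u * (cos v - 1) by ring.
have -> : expR u * sin v - 0 - v = expR u * (sin v - v) + (expR u - 1) * v by ring.
have T1 := ler_normD (expR u - 1 - u) (expR u * (cos v - 1)).
have T2 := ler_normD (expR u * (sin v - v)) ((expR u - 1) * v).
rewrite !normrM in T1 T2.
have T3 := ler_pM (normr_ge0 _) (normr_ge0 _) E4 E2.
have T4 := ler_pM (normr_ge0 _) (normr_ge0 _) E4 E3.
have T5 := ler_pM (normr_ge0 _) (normr_ge0 _) E5 vN.
have T6 : e1 * N <= e / 9 * N by rewrite ler_wpM2r.
lra.
Qed.

Lemma cderiv_cexp z : cderiv cexp z (cexp z).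
Proof.
have sh : cderiv (fun w => w - z) z 1.
  by have := cderivD (cderiv_id z) (cderiv_cst (- z) z); rewrite addr0.
have : cderiv cexp (z - z) 1 by rewrite subrr; exact: cderiv_cexp0.
move=> /(cderiv_comp sh)/(cderivM (cderiv_cst (cexp z) z)).
rewrite mul0r add0r mul1r mulr1; apply: (cderiv_local ltr01) => w _.
by rewrite -cexpD addrC subrK.
Qed.

(** The principal logarithm on [Re z > 0], where [atan (Im z / Re z)] is the argument. It is applied
    only to numbers [1 - u] with [normc u < 1]. *)
Definition clog z : C := ln (normc z) +i* atan (Im z / Re z).

Lemma clogK z : 0 < Re z -> cexp (clog z) = z.
Proof.
move=> z0; have n0 : 0 < normc z by rewrite (lt_le_trans z0)// (le_trans (ler_norm _))// Re_le_normc.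
set q := Im z / Re z.
have c0 : 0 < cos (atan q) by rewrite cos_atan invr_gt0 sqrtr_gt0 ltr_pwDl// sqr_ge0.
have c2 : cos (atan q) ^+ 2 * (1 + q ^+ 2) = 1.
  rewrite cos_atan exprVn sqr_sqrtr ?mulVf//; last by rewrite addr_ge0 ?sqr_ge0.
  by rewrite gt_eqF// ltr_pwDl// sqr_ge0.
have s1 : sin (atan q) = cos (atan q) * q.
  by rewrite -[in X in _ * X](atanK q) /tan mulrC mulfVK ?gt_eqF.
have nc : normc z * cos (atan q) = Re z.
  apply/eqP; rewrite -(@eqrXn2 _ 2) ?mulr_ge0 ?normc_ge0 ?(ltW z0) ?(ltW c0)//.
  rewrite exprMn sqr_normcE.
  have -> : Im z = q * Re z by rewrite /q mulfVK ?gt_eqF.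
  by apply/eqP; rewrite -[RHS]mulr1 -c2; ring.
apply: complexP; rewrite /= lnK ?posrE// -/q.
by rewrite s1 mulrA nc /q mulrC mulfVK ?gt_eqF.
Qed.

Lemma ccont_clog z : 0 < Re z -> ccont clog z.
Proof.
move=> z0 e e0; have n0 : 0 < normc z by rewrite (lt_le_trans z0)// (le_trans (ler_norm _))// Re_le_normc.
have e20 : 0 < e / 2 by rewrite divr_gt0.
have [k k0 Hk] := (continuous_epsP _ _).1 (continuous_ln n0) _ e20.
have [l l0 Hl] := (continuous_epsP _ _).1 (@continuous_atan R (Im z / Re z)) _ e20.
set B := (Re z + `|Im z|) * 2 / Re z ^+ 2.
have B0 : 0 < B by rewrite /B divr_gt0 ?exprn_gt0// mulr_gt0// ltr_pwDl.
exists (Num.min (Num.min k (l / B)) (Re z / 2)) => [|w].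
  by rewrite !lt_min k0 (divr_gt0 l0 B0) divr_gt0.
rewrite !lt_min => /andP[/andP[wk wl] wz].
have Rw := Re_le_normc (w - z); have Iw := Im_le_normc (w - z).
rewrite !ReImE in Rw Iw; set N := normc (w - z) in wk wl wz Rw Iw.
have w0 : Re z / 2 < Re w by move: Rw; rewrite ler_norml; lra.
rewrite (le_lt_trans (normc_le_ReIm _))// !ReImE /= [e]splitr ltrD//.
  apply: Hk; apply: le_lt_trans wk; rewrite ler_norml.
  have := normc_le_dist w z; have := normc_le_dist z w; rewrite (normc_distC z w) -/N; lra.
apply: Hl.
have w00 : 0 < Re w by lra.
have -> : Im w / Re w - Im z / Re z = ((Im w - Im z) * Re z - Im z * (Re w - Re z)) / (Re w * Re z).
  by field; rewrite !gt_eqF.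
rewrite normrM normfV [X in _ / X]gtr0_norm ?mulr_gt0// ltr_pdivrMr ?mulr_gt0//.
have : `|(Im w - Im z) * Re z - Im z * (Re w - Re z)| <= N * (Re z + `|Im z|).
  rewrite (le_trans (ler_normB _ _))// !normrM (gtr0_norm z0) mulrDr lerD//.
    by rewrite ler_pM2r.
  by rewrite mulrC ler_wpM2r.
move/le_lt_trans; apply.
move: wl; rewrite ltr_pdivlMr// => wl.
have -> : N * (Re z + `|Im z|) = N * B * (Re z / 2 * Re z).
  by rewrite /B; field; rewrite gt_eqF.
have NB : 0 <= N * B := mulr_ge0 (normc_ge0 _) (ltW B0).
apply: ltr_pM => //; last by rewrite ltr_pM2r.
by apply: mulr_ge0 (ltW z0); rewrite divr_ge0// ltW.
Qed.

Lemma cderiv_clog z : 0 < Re z -> cderiv clog z z^-1.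
Proof.
move=> z0; rewrite -[z^-1]mul1r.
have zn : z != 0 by apply: contraTneq z0 => ->; rewrite ltxx.
apply: (cderiv_inverse (psi := cexp) (W := id) z0) => //.
- move=> s sz; apply: clogK; have := Re_le_normc (s - z); rewrite !ReImE ler_norml.
  by move: sz; lra.
- exact: ccont_clog.
- by rewrite -{2}(clogK z0); exact: cderiv_cexp.
- exact: cderiv_id.
Qed.

Lemma cderiv_inv z : z != 0 -> cderiv (fun w => w^-1) z (- (z ^- 2)).
Proof.
move=> z0 e e0; have n0 : 0 < normc z by rewrite normc_gt0.
exists (Num.min (normc z / 2) (e * normc z ^+ 3 / 2)) => [|w].
  by rewrite lt_min !divr_gt0 ?mulr_gt0 ?exprn_gt0.
rewrite lt_min => /andP[w1 w2].
have nw : normc z / 2 < normc w.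
  by have := normc_le_dist z w; rewrite normc_distC; lra.
have w0 : w != 0 by rewrite -normc_gt0; lra.
have -> : w^-1 - z^-1 - - z ^- 2 * (w - z) = (w - z) * (w - z) / (w * z ^+ 2).
  by field; rewrite z0 w0.
rewrite normcM normcV [normc (w * _)]normcM normcX [normc ((w - z) * _)]normcM.
rewrite ler_pdivrMr ?mulr_gt0 ?exprn_gt0 ?normc_gt0//.
rewrite mulrAC ler_wpM2r ?normc_ge0// (le_trans (ltW w2))//.
set n := normc z in n0 nw *; set m := normc w in nw *.
have -> : e * n ^+ 3 / 2 = e * (n ^+ 2 * (n / 2)) by ring.
by rewrite (mulrC m) ler_pM2l// ler_wpM2l ?sqr_ge0// ltW.
Qed.

Lemma cderiv_linear (a z : C) : cderiv (fun w => 1 - a * w) z (- a).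
Proof.
have := cderivD (cderiv_cst 1 z) (cderivM (cderiv_cst (- a) z) (cderiv_id z)).
rewrite mul0r !add0r mulr1; apply: (cderiv_local ltr01) => w _; by rewrite mulNr.
Qed.

Lemma cderiv_logfactor (a z : C) : normc (a * z) < 1 ->
  cderiv (fun w => clog (1 - a * w)) z (- a / (1 - a * z)) /\ 1 - a * z != 0.
Proof.
move=> az; have p : 0 < Re (1 - a * z).
  by have := Re_le_normc (a * z); rewrite Re_add Re_opp Re_one ler_norml; lra.
split; last by apply: contraTneq p => ->; rewrite ltxx.
rewrite mulrC.
exact: (cderiv_comp (cderiv_linear a z) (cderiv_clog p)).
Qed.

(* [R] is the primitive of [1 / (z (1 + a z + b z^2)) - 1 / z] vanishing at 0; it is
   obtained from the partial fraction decomposition over the roots of [X^2 + a X + b]. *)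
Lemma exists_log_primitive (a b : C) : exists P : C -> C, P 0 = 0 /\
  forall z, normc (a * z) + normc (b * z ^+ 2) < 1 ->
    cderiv P z (- (a + b * z) / (1 + a * z + b * z ^+ 2)).
Proof.
pose s := sqrtc (a ^+ 2 - 4 * b).
have s2 : s ^+ 2 = a ^+ 2 - 4 * b by exact: sqr_sqrtc.
pose p := (- a + s) / 2; pose q := (- a - s) / 2.
have aE : a = - (p + q) by rewrite /p /q; field.
have bE : b = p * q.
  have -> : p * q = (a ^+ 2 - s ^+ 2) / 4 by rewrite /p /q; field.
  by rewrite s2; field.
(* A root [u] of [X^2 + a X + b] satisfies [(u z)^2 = - (a z (u z) + b z^2)]. If [|u z| >= 1], this
   gives [|u z|^2 <= (|a z| + |b z^2|) |u z|], hence [1 <= |a z| + |b z^2|]. *)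
have small (u z : C) : u ^+ 2 + a * u + b = 0 -> normc (a * z) + normc (b * z ^+ 2) < 1 ->
    normc (u * z) < 1.
  move=> uroot; apply: contraTT; rewrite -!leNgt => uz.
  have uz2 : normc (u * z) ^+ 2 <= (normc (a * z) + normc (b * z ^+ 2)) * normc (u * z).
    have -> : normc (u * z) ^+ 2 = normc (a * z * (u * z) + b * z ^+ 2).
      rewrite -normcX -normcN; congr (normc _).
      by apply/eqP; rewrite -subr_eq0; apply/eqP; rewrite -[RHS](mulr0 (- z ^+ 2)) -uroot; ring.
    rewrite (le_trans (ler_normcD _ _))// mulrDl normcM lerD2l ler_peMr ?normc_ge0//.
  have u0 := lt_le_trans ltr01 uz.
  by rewrite -(ler_pM2r u0) mul1r (le_trans _ uz2)// expr2 ler_peMr// ltW.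
have sp z : normc (a * z) + normc (b * z ^+ 2) < 1 -> normc (p * z) < 1.
  by apply: small; rewrite aE bE; ring.
have sq z : normc (a * z) + normc (b * z ^+ 2) < 1 -> normc (q * z) < 1.
  by apply: small; rewrite aE bE; ring.
have one0 (u : C) : clog (1 - u * 0) = 0.
  by apply: complexP; rewrite mulr0 subr0 /= ?expr1n ?expr0n ?addr0 ?sqrtr1 ?ln1// mul0r atan0.
(* For a double root the partial fractions contain a square, whose primitive is the rational term
   [1 / (1 - p z)]. *)
have [pq|pq] := eqVneq p q.
  exists (fun z => - 1 * clog (1 - p * z) + ((1 - p * z)^-1 + - 1)); split.
    by rewrite one0 !mulr0 subr0 invr1 subrr addr0.
  move=> z zs; have [dl n0] := cderiv_logfactor (sp _ zs).
  have di := cderiv_comp (cderiv_linear p z) (cderiv_inv n0).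
  have := cderivD (cderivM (cderiv_cst (- 1) z) dl) (cderivD di (cderiv_cst (-1) z)).
  have -> : 1 + a * z + b * z ^+ 2 = (1 - p * z) ^+ 2 by rewrite aE bE -pq; ring.
  congr (cderiv _ _); rewrite aE bE -pq; field; exact: n0.
have pq0 : p - q != 0 by rewrite subr_eq0.
exists (fun z => - (p / (p - q)) * clog (1 - p * z) + (q / (p - q)) * clog (1 - q * z)); split.
  by rewrite !one0 !mulr0 addr0.
move=> z zs; have [dp p0] := cderiv_logfactor (sp _ zs).
have [dq q0] := cderiv_logfactor (sq _ zs).
have := cderivD (cderivM (cderiv_cst (- (p / (p - q))) z) dp)
                (cderivM (cderiv_cst (q / (p - q)) z) dq).
have -> : 1 + a * z + b * z ^+ 2 = (1 - p * z) * (1 - q * z) by rewrite aE bE; ring.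
by congr (cderiv _ _); rewrite aE bE; field; rewrite p0 q0 pq0.
Qed.

End ComplexExpLog.

(** * Arcs in a half plane *)

Section GeometricLimits.
Variable R : realType.

Lemma ler_geometric_eq0 (x K : R) : 0 <= x -> (forall n, x <= K * 2^-1 ^+ n) -> x = 0.
Proof.
move=> x0 H; apply/eqP; rewrite eq_le x0 andbT leNgt; apply/negP => xp.
have [n nx] : exists n : nat, K / x < n%:R.
  exists (Num.bound `|K / x|); rewrite (le_lt_trans (ler_norm _))//.
  exact: archi_boundP.
have := H n; rewrite exprVn ler_pdivlMr ?exprn_gt0//; apply/negP; rewrite -ltNge.
move: nx; rewrite ltr_pdivrMr// => /lt_le_trans; apply.
by rewrite mulrC ler_pM2l// -natrX ler_nat ltnW// ltn_expl.
Qed.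

(** Nested intervals: [d n] is the sum of the remaining increments, so [u n - d n] increases,
    [u n + d n] decreases, and the supremum of the former lies in all the intervals. *)
Lemma real_geometric_cvg (u : nat -> R) (c : R) :
  (forall n, `|u n.+1 - u n| <= c * 2^-1 ^+ n) ->
  exists l, forall n, `|u n - l| <= 2 * c * 2^-1 ^+ n.
Proof.
move=> H; pose d n := 2 * c * 2^-1 ^+ n.
have c0 : 0 <= c by have := H 0%N; rewrite expr0 mulr1; apply: le_trans.
have d0 n : 0 <= d n by rewrite !mulr_ge0// exprn_ge0.
have dS n : d n - d n.+1 = c * 2^-1 ^+ n by rewrite /d exprS; field.
have aS n : u n - d n <= u n.+1 - d n.+1.
  by have := H n; rewrite -dS ler_norml; lra.
have bS n : u n.+1 + d n.+1 <= u n + d n.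
  by have := H n; rewrite -dS ler_norml; lra.
have aM n m : (n <= m)%N -> u n - d n <= u m - d m.
  by move=> /subnKC <-; elim: (m - n)%N => [|k IH]; rewrite ?addn0// addnS (le_trans IH).
have bM n m : (n <= m)%N -> u m + d m <= u n + d n.
  by move=> /subnKC <-; elim: (m - n)%N => [|k IH]; rewrite ?addn0// addnS (le_trans _ IH).
have ab n m : u n - d n <= u m + d m.
  have [nm|/ltnW mn] := leqP n m.
    by rewrite (le_trans (aM _ _ nm))// lerD2l; have := d0 m; lra.
  by rewrite (le_trans _ (bM _ _ mn))//; have := d0 n; lra.
pose E := range (fun n => u n - d n).
have E0 : E !=set0 by exists (u 0%N - d 0%N); exists 0%N.
have hE : has_sup E.
  by split=> //; exists (u 0%N + d 0%N) => _ [n _ <-]; exact: ab.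
exists (sup E) => n; rewrite -/(d n) ler_norml.
have h1 : u n - d n <= sup E by apply: (sup_upper_bound hE); exists n.
have h2 : sup E <= u n + d n by apply: ge_sup => // _ [m _ <-]; exact: ab.
lra.
Qed.

Lemma complex_geometric_cvg (u : nat -> R[i]) (c : R) :
  (forall n, normc (u n.+1 - u n) <= c * 2^-1 ^+ n) ->
  exists l, forall n, normc (u n - l) <= 4 * c * 2^-1 ^+ n.
Proof.
move=> H.
have hr n : `|Re (u n.+1) - Re (u n)| <= c * 2^-1 ^+ n.
  by apply: le_trans (H n); rewrite (le_trans _ (Re_le_normc _))// !ReImE.
have hi n : `|Im (u n.+1) - Im (u n)| <= c * 2^-1 ^+ n.
  by apply: le_trans (H n); rewrite (le_trans _ (Im_le_normc _))// !ReImE.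
have [p Hp] := real_geometric_cvg hr; have [q Hq] := real_geometric_cvg hi.
exists (p +i* q) => n; rewrite (le_trans (normc_le_ReIm _))// !ReImE /=.
by have := Hp n; have := Hq n; lra.
Qed.

End GeometricLimits.

(** Only the upper half plane occurs here: an arc of the lower half plane becomes one of this kind
    after [z -> - z]. *)
Definition arc_curve (R : realType) (F : R[i] -> R[i]) (x y T B : R) (z : R -> R[i]) :=
  [/\ 0 < T, z 0 = x%:C /\ z T = y%:C,
      forall t, 0 <= t <= T -> vderiv z t (F (z t)),
      forall t, 0 < t < T -> 0 < Im (z t) &
      forall t, 0 <= t <= T -> normc (z t) <= B].
Definition half_arc (R : realType) F (x y T B : R) := exists z, arc_curve F x y T B z.

Lemma Re_real (R : realType) (x : R) : Re x%:C = x. Proof. by []. Qed.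
Lemma Im_real (R : realType) (x : R) : Im x%:C = 0. Proof. by []. Qed.

(** * Integration of the field of one half plane by its logarithmic primitive *)

Section HalfPlaneArc.
Variable R : realType.
Local Notation C := R[i].
Variables (a b : C) (P : C -> C) (s M A : R).
Hypothesis M1 : 1 <= M.
Hypothesis A0 : 0 <= A.
Hypothesis aM : normc a <= M.
Hypothesis bM : normc b <= M.
Hypothesis sA : `|s| <= A.

Definition log_primitive := P 0 = 0 /\
  forall z, normc (a * z) + normc (b * z ^+ 2) < 1 ->
    cderiv P z (- (a + b * z) / (1 + a * z + b * z ^+ 2)).
Hypothesis HP : log_primitive.

Let r z := - (a + b * z) / (1 + a * z + b * z ^+ 2).
(** On this disc [|a z| + |b z^2| <= 1 / (8 (1 + A))]. The factor [1 + A] is there for the angular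
    speed, proportional to [1 + s Im D + Re D] with [D = a z + b z^2], which has to stay positive
    for all [|s| <= A]. *)
Definition arc_radius : R := (16 * M * (1 + A))^-1.
Let rho := arc_radius.

Let M0 : 0 < M. Proof. exact: lt_le_trans ltr01 M1. Qed.
Let A1 : 0 < 1 + A. Proof. by have := A0; lra. Qed.

Lemma arc_radius_gt0 : 0 < rho.
Proof. by rewrite invr_gt0 !mulr_gt0. Qed.

Let rhoE : rho * (16 * M * (1 + A)) = 1.
Proof. by rewrite /rho /arc_radius mulVf// gt_eqF// !mulr_gt0. Qed.

Let Mrho : M * rho <= 1 / 16.
Proof. by have := rhoE; have := arc_radius_gt0; have := A0; have := M0; nra. Qed.
Let rho16 : rho <= 1 / 16.
Proof. by have := arc_radius_gt0; have := Mrho; have := M1; nra. Qed.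

Lemma arc_small z : normc z <= rho ->
  normc (a * z) + normc (b * z ^+ 2) <= (8 * (1 + A))^-1.
Proof.
move=> zr; have A8 : 0 < 8 * (1 + A) by rewrite mulr_gt0.
rewrite -[_^-1]div1r ler_pdivlMr// !normcM.
have n0 := normc_ge0 z; have na := normc_ge0 a; have nb := normc_ge0 b.
have h1 : normc a * normc z <= M * rho by exact: ler_pM.
have h2 : normc b * (normc z * normc z) <= M * (rho * (1 / 16)).
  apply: ler_pM => //; first exact: mulr_ge0.
  by apply: ler_pM => //; exact: le_trans zr rho16.
have h3 : M * rho * (16 * (1 + A)) = 1 by rewrite -[RHS]rhoE; ring.
apply: le_trans (ler_wpM2r (ltW A8) (lerD h1 h2)) _; nra.
Qed.

Let small8 z : normc z <= rho -> normc (a * z) + normc (b * z ^+ 2) <= 1 / 8.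
Proof.
move=> /arc_small /le_trans; apply; rewrite div1r lef_pV2 ?posrE//; first by have := A0; lra.
by rewrite mulr_gt0.
Qed.

Let denN z : normc z <= rho -> 7 / 8 <= normc (1 + a * z + b * z ^+ 2).
Proof.
move=> /small8 H; have := normc_le_dist 1 (1 + a * z + b * z ^+ 2).
have -> : 1 - (1 + a * z + b * z ^+ 2) = - (a * z + b * z ^+ 2) by ring.
by rewrite normcN normc1; have := ler_normcD (a * z) (b * z ^+ 2); lra.
Qed.

Lemma arc_den_neq0 z : normc z <= rho -> 1 + a * z + b * z ^+ 2 != 0.
Proof. by move=> /denN H; rewrite -normc_gt0; lra. Qed.

Lemma dP z : normc z <= rho -> cderiv P z (r z).
Proof. by move=> /small8 H; apply: HP.2; lra. Qed.

Let rM z : normc z <= rho -> normc (r z) <= 2 * M.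
Proof.
move=> zr; rewrite /r normcM normcV normcN ler_pdivrMr; last by have := denN zr; lra.
have := ler_normcD a (b * z); rewrite normcM.
have : normc b * normc z <= M * (1 / 16).
  by apply: ler_pM; rewrite ?normc_ge0//; exact: le_trans zr rho16.
have := denN zr; have := aM; have := M1; nra.
Qed.

Let segment_ball (z w : C) (d : R) : normc z <= d -> normc w <= d ->
  forall u : R, 0 <= u <= 1 -> normc (z + u%:C * (w - z)) <= d.
Proof.
move=> zd wd u /andP[u0 u1].
have -> : z + u%:C * (w - z) = (1 - u)%:C * z + u%:C * w.
  by rewrite rmorphB /= rmorph1; ring.
rewrite (le_trans (ler_normcD _ _))// !normcM !normc_real.
rewrite (ger0_norm u0) ger0_norm ?subr_ge0//.
have := normc_ge0 z; nra.
Qed.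

Lemma P_lipschitz z w : normc z <= rho -> normc w <= rho ->
  normc (P w - P z) <= 2 * M * normc (w - z).
Proof.
move=> zr wr; apply: (cderiv_lipschitz (df := r)) => u u01.
- by apply: dP; exact: segment_ball.
- by apply: rM; exact: segment_ball.
Qed.

Lemma P_small z : normc z <= rho -> normc (P z) <= 1 / 8.
Proof.
move=> zr; have z0 : normc 0 <= rho by rewrite normc0 ltW// arc_radius_gt0.
have := P_lipschitz z0 zr; rewrite HP.1 !subr0 => /le_trans; apply.
by have := ler_pM (normc_ge0 z) (ltW (lt_le_trans ltr01 M1)) zr (lexx M);
   have := Mrho; lra.
Qed.

Let expN2 (x : R) : `|x| <= 1 / 8 -> expR x <= 8 / 7.
Proof.
move=> /ler_normlP[xl xu]; have := expR_ge1Dx (- x); rewrite expRN => H.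
have := mulfV (lt0r_neq0 (expR_gt0 x)); have := expR_gt0 x.
nra.
Qed.

Let G z := cexp (- P z).

Let dG z : normc z <= rho -> cderiv G z (G z * - r z).
Proof.
move=> zr; have dN : cderiv (fun w => -1 * P w) z (- r z).
  have := cderivM (cderiv_cst (-1) z) (dP zr); rewrite mul0r add0r.
  by rewrite mulN1r.
have := cderiv_comp dN (cderiv_cexp (-1 * P z)).
rewrite !mulN1r; apply: (cderiv_local ltr01) => w _; by rewrite mulN1r.
Qed.

Let GN z : normc z <= rho -> normc (G z) <= 8 / 7.
Proof.
move=> zr; rewrite normc_cexp expN2// (le_trans (Re_le_normc _))// normcN.
exact: P_small.
Qed.

Let G_lipschitz z w : normc z <= rho -> normc w <= rho ->
  normc (G w - G z) <= 3 * M * normc (w - z).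
Proof.
move=> zr wr; apply: (cderiv_lipschitz (df := fun z => G z * - r z)) => u u01.
  by apply: dG; exact: segment_ball.
have ur := segment_ball zr wr u01; rewrite normcM normcN.
have := ler_pM (normc_ge0 _) (normc_ge0 _) (GN ur) (rM ur).
by have := M1; lra.
Qed.

(** The exponential of [log z + P z]. It linearises the field: along a solution it is multiplied by
    [cexp (lam t)]. Inverting it requires no branch of the logarithm. *)
Let psi z := z * cexp (P z).

Let psi_fixed z w : psi z = w <-> z = w * G z.
Proof.
rewrite /psi /G cexpN; split=> [<-|zE].
  by rewrite mulfK// cexp_neq0.
by rewrite {1}zE mulfVK// cexp_neq0.
Qed.

Let contract w z z' : normc w <= rho / 2 -> normc z <= rho -> normc z' <= rho ->
  normc (w * G z' - w * G z) <= 2^-1 * normc (z' - z).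
Proof.
move=> wr zr zr'; rewrite -mulrBr normcM.
apply: le_trans (ler_pM (normc_ge0 _) (normc_ge0 _) wr (G_lipschitz zr zr')) _.
rewrite mulrA ler_wpM2r ?normc_ge0//; have := Mrho; lra.
Qed.

Let stay w z : normc w <= rho / 2 -> normc z <= rho -> normc (w * G z) <= 2 * normc w.
Proof.
move=> wr zr; rewrite normcM mulrC ler_wpM2r ?normc_ge0//.
by have := GN zr; lra.
Qed.

(** Fixed point of [z |-> w cexp (- P z)], which contracts distances by 1/2 on the disc of radius
    [rho] and whose iterates from 0 stay within [2 |w|]. *)
Let psi_solve w : normc w <= rho / 2 -> exists z, normc z <= 2 * normc w /\ psi z = w.
Proof.
move=> wr; pose u n := iter n (fun z => w * G z) 0.
have w2 : 2 * normc w <= rho by lra.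
have ub n : normc (u n) <= 2 * normc w.
  elim: n => [|n IH]; first by rewrite normc0 mulr_ge0 ?normc_ge0.
  by apply: stay => //; exact: le_trans IH w2.
have ur n : normc (u n) <= rho := le_trans (ub n) w2.
have cu n : normc (u n.+1 - u n) <= 2 * normc w * 2^-1 ^+ n.
  elim: n => [|n IH].
    by rewrite subr0 expr0 mulr1; exact: (ub 1%N).
  apply: le_trans (contract wr (ur n) (ur n.+1)) _.
  rewrite exprS; have := IH; lra.
have [l Hl] := complex_geometric_cvg cu.
have lw : normc l <= 2 * normc w.
  rewrite -subr_ge0; set K := 4 * (2 * normc w).
  rewrite leNgt; apply/negP => lt0.
  have := @ler_geometric_eq0 _ (normc l - 2 * normc w) K _ _.
  move=> H; suff : normc l - 2 * normc w = 0 by lra.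
  apply: H => [|n]; first lra.
  have := normc_le_dist l (u n); rewrite normc_distC.
  by have := Hl n; have := ub n; rewrite -/K; lra.
have lr : normc l <= rho := le_trans lw w2.
exists l; split=> //; apply/psi_fixed/eqP; rewrite -subr_eq0 -normc_eq0; apply/eqP.
apply: (@ler_geometric_eq0 _ _ (4 * (2 * normc w) * 2)); first exact: normc_ge0.
move=> n; have := normc_distD (u n.+1) l (w * G l).
have := contract wr lr (ur n); have := Hl n; have := Hl n.+1.
rewrite (normc_distC l (u n.+1)) exprS -[w * G (u n)]/(u n.+1).
have : 0 <= 4 * (2 * normc w) * 2^-1 ^+ n.
  by rewrite !mulr_ge0 ?normc_ge0// exprn_ge0.
lra.
Qed.

(** Gives the continuity of the inverse that [cderiv_inverse] asks for, and the injectivity that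
    identifies the starting point of the arc. *)
Let psi_inj_lip z z' : normc z <= rho -> normc z' <= rho -> normc (psi z') <= rho / 2 ->
  normc (z' - z) <= 4 * normc (psi z' - psi z).
Proof.
move=> zr zr' wr.
have /psi_fixed e1 : psi z = psi z by []. have /psi_fixed e2 : psi z' = psi z' by [].
have E : z' - z = (psi z' * G z' - psi z' * G z) + (psi z' - psi z) * G z.
  by rewrite {1}e2 {1}e1; ring.
have := contract wr zr zr'; have := ler_normcD (psi z' * G z' - psi z' * G z) ((psi z' - psi z) * G z).
rewrite -E [normc ((psi z' - psi z) * _)]normcM.
have := ler_pM (normc_ge0 (psi z' - psi z)) (normc_ge0 (G z)) (lexx _) (GN zr).
by have := normc_ge0 (psi z' - psi z); lra.
Qed.


Definition arc_speed : C := (s -i* 1)^-1.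
Let lam := arc_speed.
Definition arc_field z := lam * z * (1 + a * z + b * z ^+ 2).

Let s21 : 0 < s ^+ 2 + 1. Proof. by rewrite ltr_wpDl ?sqr_ge0. Qed.
Let Re_lam : Re lam = s / (s ^+ 2 + 1).
Proof. by rewrite Re_inv /= sqrrN expr1n. Qed.
Let Im_lam : Im lam = (s ^+ 2 + 1)^-1.
Proof. by rewrite Im_inv /= sqrrN expr1n opprK div1r. Qed.

(** The right-hand side is the angular speed around 0 of a solution. Times [s^2 + 1] it is
    [1 + s Im D + Re D] with [D = a z + b z^2], and [arc_radius] bounds the perturbation by 1/8. *)
Lemma Im_speed_den z : normc z <= rho ->
  1 / (2 * (s ^+ 2 + 1)) < Im (lam * (1 + a * z + b * z ^+ 2)).
Proof.
move=> zr; set D := a * z + b * z ^+ 2.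
have DN : normc D <= (8 * (1 + A))^-1.
  by apply: le_trans (arc_small zr); exact: ler_normcD.
have -> : Im (lam * (1 + a * z + b * z ^+ 2)) = (1 + (s * Im D + Re D)) / (s ^+ 2 + 1).
  rewrite -addrA -/D Im_mul Re_lam Im_lam !ReImE; field; exact: lt0r_neq0.
rewrite invfM mulrA ltr_pM2r ?invr_gt0//.
have h1 : `|s * Im D| <= A * normc D.
  by rewrite normrM ler_pM//; exact: Im_le_normc.
have h2 := Re_le_normc D.
have h3 : (1 + A) * normc D <= 1 / 8.
  have := ler_wpM2l (ltW A1) DN; rewrite invfM mulrCA mulfV ?gt_eqF// mulr1.
  by rewrite div1r.
move: h1 h2; rewrite !ler_norml; lra.
Qed.

(** The argument of [cexp (lam t)] grows at the speed [1 / (s^2 + 1)] and gains [pi + 1] in this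
    time. The terms in [P] correct it by at most 1/4, so the angle has passed [pi] by then. *)
Definition arc_duration : R := (pi + 1) * (s ^+ 2 + 1).
(** Bound of [|cexp (lam t)|] for [|t| <= arc_duration], from [Re lam = s / (s^2 + 1)]. *)
Definition arc_growth : R := expR (A * (pi + 1)).
(** For such starting points the arc, of modulus at most [4 E x], stays within [rho / 4]. *)
Definition arc_range : R := rho / (16 * arc_growth).
Let T0 := arc_duration.
Let E := arc_growth.
Let E0 : 0 < E. Proof. exact: expR_gt0. Qed.
Let pi1 : 0 < (pi : R) + 1. Proof. by rewrite ltr_pwDl// ?pi_gt0. Qed.
Let T00 : 0 < T0. Proof. exact: mulr_gt0. Qed.

(** The solution through [x] in the linearising coordinate. The time is complex so that
    [cderiv_inverse] applies to its preimage under [psi]. *)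
Let w0 (x : R) (tau : C) : C := x%:C * cexp (P x%:C) * cexp (lam * tau).

Lemma arc_range_rho x : 0 < x <= arc_range -> normc x%:C <= rho.
Proof.
move=> /andP[x0 xr]; rewrite normc_real gtr0_norm// (le_trans xr)//.
rewrite ler_pdivrMr ?mulr_gt0// ler_peMr//; first exact/ltW/arc_radius_gt0.
have : 1 <= E by rewrite -expR0 ler_expR mulr_ge0// ltW.
by rewrite -/E; lra.
Qed.

Let w0N (x t : R) : 0 < x <= arc_range -> `|t| <= T0 ->
  normc (w0 x t%:C) <= 2 * E * x.
Proof.
move=> xr tT; have /andP[x0 _] := xr; rewrite !normcM !normc_cexp normc_real gtr0_norm//.
have h1 : expR (Re (P x%:C)) <= 8 / 7.
  by apply: expN2; rewrite (le_trans (Re_le_normc _))// P_small// arc_range_rho.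
have h2 : expR (Re (lam * t%:C)) <= E.
    rewrite ler_expR Re_mul (Re_real t) (Im_real t) mulr0 subr0 Re_lam (le_trans (ler_norm _))//.
  rewrite -mulrA normrM ler_pM//.
  rewrite mulrC normrM normfV (gtr0_norm s21) ler_pdivrMr//.
have := ler_pM (ltW (expR_gt0 _)) (ltW (expR_gt0 _)) h1 h2.
set p := expR _; set q := expR _ => pq.
have : x * (p * q) <= x * (8 / 7 * E) by rewrite ler_pM2l.
rewrite mulrA; have := mulr_gt0 x0 E0; lra.
Qed.

Let w0r (x t : R) : 0 < x <= arc_range -> `|t| <= T0 -> normc (w0 x t%:C) <= rho / 8.
Proof.
move=> xr tT; apply: le_trans (w0N xr tT) _; case/andP: xr => _.
rewrite /arc_range ler_pdivlMr ?mulr_gt0// ; rewrite -/E -/rho; lra.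
Qed.

Let dw0 x tau : cderiv (w0 x) tau (lam * w0 x tau).
Proof.
have dl : cderiv (fun u => lam * u) tau lam.
  by have := cderivM (cderiv_cst lam tau) (cderiv_id tau); rewrite mul0r add0r mulr1.
have := cderivM (cderiv_cst (x%:C * cexp (P x%:C)) tau) (cderiv_comp dl (cderiv_cexp (lam * tau))).
by rewrite mul0r add0r; congr (cderiv _ _); rewrite /w0; ring.
Qed.

Let dpsi z : normc z <= rho -> cderiv psi z (cexp (P z) * (1 + a * z + b * z ^+ 2)^-1).
Proof.
move=> zr; have := cderivM (cderiv_id z) (cderiv_comp (dP zr) (cderiv_cexp (P z))).
congr (cderiv _ _); rewrite mul1r /r; field; exact: arc_den_neq0.
Qed.

(** The solution is a preimage of [w0 x t] under [psi]. Its angle starts at 0, increases strictly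
    and exceeds [pi] at the end of [arc_duration]; the arc stops when it equals [pi]. *)
Lemma arc_exists (x : R) : 0 < x <= arc_range ->
  exists (y T : R) (z : R -> C),
  [/\ y < 0, 0 < T,
      (`|y| <= 4 * E * x) /\ ((ln (- y / x)) +i* pi + P y%:C - P x%:C = lam * T%:C),
      [/\ z 0 = x%:C, z T = y%:C, (forall t, 0 <= t <= T -> vderiv z t (arc_field (z t))) &
          forall t, 0 < t < T -> 0 < Im (z t)] &
      forall t, 0 <= t <= T -> normc (z t) <= 4 * E * x].
Proof.
move=> xr; have /andP[x0 _] := xr; have xrho := arc_range_rho xr.
have rho0 := arc_radius_gt0; rewrite -/rho in rho0.
have rho4 : 0 < rho / 4 by rewrite divr_gt0.
have /choice[phi Hphi] : forall w, exists z, normc w <= rho / 2 -> normc z <= 2 * normc w /\ psi z = w.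
  move=> w; have [wr|_] := boolP (normc w <= rho / 2); last by exists 0.
  by have [z ?] := psi_solve wr; exists z.
pose zc tau := phi (w0 x tau).
pose z (t : R) := zc t%:C.
have wt t : `|t| <= T0 -> normc (w0 x t%:C) <= rho / 2.
  by move=> /(w0r xr); lra.
have zN t : `|t| <= T0 -> normc (z t) <= 4 * E * x.
  by move=> tT; have [+ _] := Hphi _ (wt _ tT); have := w0N xr tT; rewrite /z /zc; lra.
have zr t : `|t| <= T0 -> normc (z t) <= rho.
  by move=> tT; have [+ _] := Hphi _ (wt _ tT); have := wt _ tT; rewrite /z /zc; lra.
have zpsi t : `|t| <= T0 -> psi (z t) = w0 x t%:C.
  by move=> tT; have [_] := Hphi _ (wt _ tT).
have dz t : `|t| <= T0 -> vderiv z t (arc_field (z t)).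
  move=> tT; apply: (@vderiv_of_cderiv _ zc); rewrite -/(z t).
  have [k k0 Hk] := cderiv_cont (dw0 x t%:C) rho4.
  have near tau : normc (tau - t%:C) < k -> normc (w0 x tau) <= rho / 2.
    move=> /Hk; have := normc_le_dist (w0 x tau) (w0 x t%:C).
    by have := w0r xr tT; lra.
  have Dn := arc_den_neq0 (zr t tT).
  have -> : arc_field (z t) = lam * w0 x t%:C / (cexp (P (z t)) * (1 + a * z t + b * z t ^+ 2)^-1).
    by rewrite -zpsi// /psi /arc_field; field; rewrite Dn cexp_neq0.
  apply: (cderiv_inverse (psi := psi) (W := w0 x) k0).
  - by rewrite mulf_neq0 ?cexp_neq0 ?invr_eq0.
  - by move=> tau /near/Hphi[].
  - move=> e e0; have e4 : 0 < e / 4 by rewrite divr_gt0.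
    have [l l0 Hl] := cderiv_cont (dw0 x t%:C) e4.
    exists (Num.min k l) => [|tau]; first by rewrite lt_min k0.
    rewrite lt_min => /andP[/near wn /Hl wl]; have [zw pw] := Hphi _ wn.
    have nt : normc (zc tau) <= rho by rewrite /zc; move: zw wn; lra.
    have pt : normc (psi (zc tau)) <= rho / 2 by rewrite pw.
    apply: le_lt_trans (psi_inj_lip (zr t tT) nt pt) _.
    by rewrite pw -/(zc t%:C) -/(z t) zpsi//; lra.
  - exact: dpsi (zr t tT).
  - exact: dw0.
have t00 : `|0 : R| <= T0 by rewrite normr0 ltW.
have z0 : z 0 = x%:C.
  have px : psi x%:C = w0 x 0 by rewrite /w0 mulr0 cexp0 mulr1.
  have pr : normc (psi x%:C) <= rho / 2 by rewrite px; exact: (wt 0).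
  have := psi_inj_lip (zr 0 t00) xrho pr; rewrite zpsi// px subrr normc0 mulr0.
  move=> H; apply/esym/eqP; rewrite -subr_eq0 -normc_eq0 eq_le H.
  exact: normc_ge0.
(* A continuous determination of [log (z t)], read off from the conservation of
   [log z + P z - lam t]. It is real at time 0. *)
pose ze (t : R) : C := (ln x)%:C + P x%:C + lam * t%:C - P (z t).
have zeE t : `|t| <= T0 -> cexp (ze t) = z t.
  move=> tT; rewrite /ze cexpD cexpN 2!cexpD.
  have -> : cexp (ln x)%:C = x%:C.
    by apply: complexP; rewrite /= ?cos0 ?sin0 ?mulr0// mulr1 lnK.
  by rewrite -/(w0 x t%:C) -zpsi// /psi mulfK// cexp_neq0.
have dth t : `|t| <= T0 -> is_derive t (1 : R) (fun u => Im (ze u))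
    (Im (lam * (1 + a * z t + b * z t ^+ 2))).
  move=> tT; have [_ HI] := vderiv_comp (dz t tT) (dP (zr t tT)).
  have -> : Im (lam * (1 + a * z t + b * z t ^+ 2)) = 0 + Im lam * 1 - Im (r (z t) * arc_field (z t)).
    rewrite mulr1 add0r -Im_opp -Im_add; congr Im; rewrite /r /arc_field.
    by field; exact: arc_den_neq0 (zr t tT).
  have -> : (fun u => Im (ze u)) = (fun u => Im (P x%:C) + Im lam * u - Im (P (z u))).
    by apply/funext => u; rewrite /ze !ReImE !(Re_real, Im_real); ring.
  apply: (is_deriveB (is_deriveD (is_derive_cst (Im (P x%:C)) t 1)
    (is_deriveZ (Im lam) (is_derive_id t (1 : R)))) HI).
have ze0 : Im (ze 0) = 0 by rewrite /ze z0 mulr0 addr0 addrK.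
have zeT : pi < Im (ze T0).
  have TT : `|T0| <= T0 by rewrite gtr0_norm.
  have := P_small (zr T0 TT); have := P_small xrho.
  have := Im_le_normc (P (z T0)); have := Im_le_normc (P x%:C).
  rewrite /ze !ReImE (Re_real T0) !ler_norml Im_lam.
  have -> : (s ^+ 2 + 1)^-1 * T0 = pi + 1 by rewrite /T0 /arc_duration; field; exact: lt0r_neq0.
  lra.
have tle t : 0 <= t <= T0 -> `|t| <= T0 by move=> /andP[? ?]; rewrite ger0_norm.
have incr u v : 0 <= u -> u < v -> v <= T0 -> Im (ze u) < Im (ze v).
  move=> u0 uv vT.
  apply: (derive_pos_lt (f := fun u => Im (ze u))
     (df := fun t => Im (lam * (1 + a * z t + b * z t ^+ 2)))) => // t /andP[ut tv].
    by apply: dth; apply: tle; rewrite (le_trans u0)//= (le_trans tv).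
  have tT : `|t| <= T0 by apply: tle; rewrite (le_trans u0 (ltW ut)) (le_trans (ltW tv)).
  by rewrite (lt_trans _ (Im_speed_den (zr t tT)))// divr_gt0// mulr_gt0.
have [T] : exists2 T, T \in `[0, T0] & Im (ze T) = pi.
  apply: IVT; first exact: ltW.
    by apply: (derive_continuous_within (df := fun t => Im (lam * (1 + a * z t + b * z t ^+ 2)))) => t /tle/dth.
  by rewrite ge_min le_max ze0 pi_ge0 (ltW zeT) orbT.
rewrite in_itv /= => /andP[T_ge0 TT] zeTpi.
have T_gt0 : 0 < T.
  by rewrite lt_def T_ge0 andbT; apply: contra_eqN zeTpi => /eqP ->; rewrite ze0 lt_eqF ?pi_gt0.
have TT' : `|T| <= T0 by apply: tle; rewrite T_ge0.
pose y := - expR (Re (ze T)).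
have zTy : z T = y%:C.
  by rewrite -zeE//; apply: complexP; rewrite /= zeTpi ?cospi ?sinpi ?mulr0// mulrN1.
have inT t : 0 <= t <= T -> `|t| <= T0.
  by move=> /andP[t0 tT]; apply: tle; rewrite t0 (le_trans tT).
exists y, T, z; split=> //.
- by rewrite oppr_lt0 expR_gt0.
- split; first by rewrite -normc_real -zTy; exact: zN.
  have -> : ln (- y / x) = Re (ze T) - ln x.
    by rewrite /y opprK ln_div ?posrE ?expR_gt0// expRK.
  have zE : (Re (ze T)) +i* pi = ze T by rewrite -zeTpi; case: (ze T).
  have -> : (Re (ze T) - ln x) +i* pi = ze T - (ln x)%:C.
    by rewrite -{2}zE; apply: complexP; rewrite ?ReImE /= ?subr0.
  by rewrite /ze zTy; ring.
- split=> // [t /inT/dz//|t /andP[t0 tT]].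
  have tT0 : `|t| <= T0 by apply: inT; rewrite !ltW.
  have h1 := incr 0 t (lexx 0) t0 (le_trans (ltW tT) TT).
  have h2 := incr t T (ltW t0) tT TT; rewrite ze0 in h1; rewrite zeTpi in h2.
  by rewrite -zeE//= mulr_gt0 ?expR_gt0// sin_gt0_pi// h1 h2.
- by move=> t /inT/zN.
Qed.

(** This is [- Im ((s - i) (ln |x| + P x))]. The argument [pi] of a negative end is accounted for by
    the separate term [s * pi]. *)
Definition arc_phase (x : R) : R := ln `|x| - (s * Im (P x%:C) - Re (P x%:C)).
Definition arc_dphase (x : R) : R := x^-1 - (s * Im (r x%:C) - Re (r x%:C)).

Let normr_rho (x : R) : `|x| <= rho -> normc x%:C <= rho.
Proof. by rewrite normc_real. Qed.

Lemma is_derive_arc_phase x : x != 0 -> `|x| <= rho ->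
  is_derive x (1 : R) arc_phase (arc_dphase x).
Proof.
move=> x0 /normr_rho xr; have [dR dI] := vderiv_of_cderiv (dP xr).
have dl : is_derive x (1 : R) (fun u => ln `|u|) (x^-1).
  have [x_gt0|x_lt0] := ltP 0 x.
    apply: (is_derive_local (f := @ln R) x_gt0); last exact: is_derive1_ln.
    by move=> u /ltr_normlP[h1 h2]; rewrite gtr0_norm//; lra.
  have {}x_lt0 : x < 0 by rewrite lt_neqAle x0.
  have xN : 0 < - x by rewrite oppr_gt0.
  apply: (is_derive_local (f := fun u => ln (- u)) xN).
    by move=> u /ltr_normlP[h1 h2]; rewrite ltr0_norm//; lra.
  have := is_derive1_comp (is_derive1_ln xN) (is_deriveNid x (1 : R)).
  by rewrite invrN mulrNN mulr1.
exact: (is_deriveB dl (is_deriveB (is_deriveZ s dI) dR)).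
Qed.

(** The logarithm dominates: [x * arc_dphase x] is 1 up to an error of at most 1/8. Thus the phase
    is monotone on each half axis, and it determines the end of an arc. *)
Lemma arc_dphase_sign x : x != 0 -> `|x| <= rho -> 7 / 8 <= x * arc_dphase x.
Proof.
move=> x0 xr; rewrite /arc_dphase mulrBr mulfV//.
have h1 := rM (normr_rho xr); have h2 := Re_le_normc (r x%:C).
have h3 : `|s * Im (r x%:C)| <= A * normc (r x%:C).
  by rewrite normrM ler_pM//; exact: Im_le_normc.
set S := s * _ in h3 *; set c := Re _ in h2 *; set N := normc _ in h1 h2 h3.
have h4 : `|S - c| <= (1 + A) * (2 * M).
  by rewrite (le_trans (ler_normB _ _))//; have := ler_wpM2l (ltW A1) h1; lra.
have h5 : `|x * (S - c)| <= 1 / 8.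
  rewrite normrM; apply: le_trans (ler_pM (normr_ge0 _) (normr_ge0 _) xr h4) _.
  by have := rhoE; lra.
by move: h5; rewrite ler_norml; lra.
Qed.

Lemma arc_dphase_lt0 y : - rho <= y < 0 -> arc_dphase y < 0.
Proof.
move=> /andP[yr y0]; have ny : `|y| <= rho by rewrite ltr0_norm// lerNl.
have := arc_dphase_sign (ltr0_neq0 y0) ny.
by rewrite leNgt; apply: contraNT; rewrite -leNgt => h; nra.
Qed.

Lemma arc_dphase_gt0 x : 0 < x <= rho -> 0 < arc_dphase x.
Proof.
move=> /andP[x0 xr]; have nx : `|x| <= rho by rewrite gtr0_norm.
have := arc_dphase_sign (lt0r_neq0 x0) nx.
by rewrite leNgt; apply: contraNT; rewrite -leNgt => h; nra.
Qed.

Lemma arc_phase_decr y y' : - rho <= y -> y < y' -> y' < 0 -> arc_phase y' < arc_phase y.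
Proof.
move=> yr yy y'0; rewrite -ltrN2.
have inn t : y <= t <= y' -> - rho <= t < 0.
  by move=> /andP[h1 h2]; rewrite (le_trans yr)//= (le_lt_trans h2).
apply: (derive_pos_lt (f := fun t => - arc_phase t) (df := fun t => - arc_dphase t)) => //.
  move=> t /inn/andP[tr t0]; apply: is_deriveN; apply: is_derive_arc_phase; first exact: ltr0_neq0.
  by rewrite ltr0_norm// lerNl.
by move=> t /andP[/ltW h1 /ltW h2]; rewrite oppr_gt0; apply/arc_dphase_lt0/inn; rewrite h1.
Qed.

Lemma arc_phase_inj y y' : - rho <= y < 0 -> - rho <= y' < 0 ->
  arc_phase y = arc_phase y' -> y = y'.
Proof.
move=> /andP[yr y0] /andP[yr' y0'] E'; apply/eqP; case: ltgtP => // h.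
  by have := arc_phase_decr yr h y0'; rewrite E' ltxx.
by have := arc_phase_decr yr' h y0; rewrite E' ltxx.
Qed.

(** Real part of [(s - i)] times the increment of [log u + P u] along the arc, which is the elapsed
    time. *)
Definition arc_period (x y : R) : R :=
  pi + s * (ln (- y / x) + (Re (P y%:C) - Re (P x%:C))) + (Im (P y%:C) - Im (P x%:C)).

Lemma arc_map (x : R) : 0 < x <= arc_range -> exists y : R,
  [/\ - rho <= y < 0, `|y| <= 4 * E * x, arc_phase y = arc_phase x + s * pi &
     half_arc arc_field x y (arc_period x y) (4 * E * x)].
Proof.
move=> xr; have [y [T [z [y0 T_gt0 [yx J] [z0 zT dz zI] zN]]]] := arc_exists xr.
have /andP[x0 _] := xr.
have ln_y : ln (- y / x) = ln `|y| - ln `|x|.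
  by rewrite ltr0_norm// gtr0_norm// ln_div ?posrE ?oppr_gt0.
have Jinv : (s -i* 1) * ((ln (- y / x)) +i* pi + P y%:C - P x%:C) = T%:C.
  rewrite J mulrA /lam /arc_speed mulfV ?mul1r//.
  by rewrite eq_complex /= oppr_eq0 oner_eq0 andbF.
have yr : `|y| <= rho.
  apply: le_trans yx _; have /andP[_] := xr.
  rewrite /arc_range ler_pdivlMr ?mulr_gt0// -/E -/rho.
  by have := mulr_gt0 E0 x0; lra.
exists y; split=> //.
- by rewrite y0 andbT lerNl -ltr0_norm.
- have := congr1 (@complex.Im R) Jinv.
  by rewrite !ReImE /= ln_y /arc_phase; lra.
- have -> : arc_period x y = T.
    have := congr1 (@complex.Re R) Jinv.
    by rewrite !ReImE /= /arc_period; lra.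
  by exists z; split=> //; split.
Qed.

End HalfPlaneArc.

(** * Filippov solutions *)

Section IntegralBounds.
Variable R : realType.
Local Notation mu := (@lebesgue_measure R).
Implicit Types u : R -> R.

Lemma ae_Rintegral_ge0 (D : set R) u : measurable D -> mu.-integrable D (EFin \o u) ->
  {ae mu, forall x, D x -> 0 <= u x} -> 0 <= \int[mu]_(x in D) u x.
Proof.
move=> mD iu u0; rewrite /Rintegral.
have mu' := measurable_int mu iu.
pose v x := Num.max (u x) 0.
have mv : measurable_fun D v.
  by apply: measurable_maxr; [exact/measurable_EFinP|exact: measurable_cst].
rewrite (@ae_eq_integral _ _ _ mu D (EFin \o v) (EFin \o u))//; last 2 first.
- exact/measurable_EFinP.
- by apply: (@filterS _ _ (ae_filter_ringOfSetsType mu) _ _ _ u0) => x ux Dx; rewrite /= /v max_l// ux.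
by apply/fine_ge0/integral_ge0 => x _; rewrite lee_fin le_max lexx orbT.
Qed.

Lemma Rintegral_increment_ge (u : R -> R) (a b s t lo : R) :
  mu.-integrable `[a, b] (EFin \o u) -> a <= s -> s < t -> t <= b ->
  {ae mu, forall x, x \in `]s, t[ -> lo <= u x} ->
  lo * (t - s) <= \int[mu]_(x in `[a, t]) u x - \int[mu]_(x in `[a, s]) u x.
Proof.
move=> iu as_ st tb lou.
have iat : mu.-integrable `[a, t] (EFin \o u).
  by apply: integrableS iu => //; apply: subset_itvl; rewrite bnd_simp.
rewrite Rintegral_itvB ?bnd_simp ?(ltW st)//.
have ist : mu.-integrable `]s, t] (EFin \o u).
  by apply: integrableS iat => //; apply: subset_itvr; rewrite bnd_simp.
have iso : mu.-integrable `]s, t[ (EFin \o u).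
  by apply: integrableS ist => //; apply: subset_itvl; rewrite bnd_simp.
have ilo : mu.-integrable `]s, t[ (EFin \o (fun=> lo)).
  apply: integrableS (continuous_compact_integrable (@segment_compact _ s t) _) => //.
    exact: subset_itv_oo_cc.
  by apply: continuous_subspaceT => x; exact: cvg_cst.
rewrite -Rintegral_itv_bndo_bndc//.
have iul : mu.-integrable `]s, t[ (EFin \o (fun x => u x - lo)).
  by apply: eq_integrable (integrableB _ iso ilo).
have : 0 <= \int[mu]_(x in `]s, t[) (u x - lo).
  apply: ae_Rintegral_ge0 => //.
  by apply: (@filterS _ _ (ae_filter_ringOfSetsType mu) _ _ _ lou) => x H; rewrite /= => xst; rewrite subr_ge0; apply: H.
have mst : lebesgue_measure (`]s, t[%classic : set R) = (t - s)%:E.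
  by rewrite lebesgue_measure_itv /= lte_fin st -EFinB.
rewrite RintegralB// Rintegral_cst//.
rewrite (_ : fine _ = t - s); last exact: (congr1 fine mst).
by rewrite subr_ge0.
Qed.

Lemma Rintegral_increment_le (u : R -> R) (a b s t hi : R) :
  mu.-integrable `[a, b] (EFin \o u) -> a <= s -> s < t -> t <= b ->
  {ae mu, forall x, x \in `]s, t[ -> u x <= hi} ->
  \int[mu]_(x in `[a, t]) u x - \int[mu]_(x in `[a, s]) u x <= hi * (t - s).
Proof.
move=> iu as_ st tb uhi.
have sub (c : R) : c <= b -> mu.-integrable `[a, c] (EFin \o u).
  by move=> cb; apply: integrableS iu => //; apply: subset_itvl; rewrite bnd_simp.
have NE (c : R) : c <= b -> \int[mu]_(x in `[a, c]) (- u x) = - \int[mu]_(x in `[a, c]) u x.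
  move=> /sub ic; have := RintegralZl (-1) _ ic.
  rewrite mulN1r => <-//; apply: eq_Rintegral => x _; by rewrite mulN1r.
have iN : mu.-integrable `[a, b] (EFin \o (fun x => - u x)).
  by apply: eq_integrable (integrableN iu).
have uN : {ae mu, forall x, x \in `]s, t[ -> - hi <= - u x}.
  by apply: (@filterS _ _ (ae_filter_ringOfSetsType mu) _ _ _ uhi) => x H /H; rewrite lerN2.
have := Rintegral_increment_ge iN as_ st tb uN.
rewrite !NE//; last by rewrite (le_trans (ltW st)).
by rewrite mulNr -opprD lerN2.
Qed.

End IntegralBounds.

(** * Concatenation, classical solutions and increments for the inclusion *)

Section FilippovSolutions.
Variable R : realType.
Local Notation C := R[i].
Local Notation mu := (@lebesgue_measure R).
Implicit Types (S : pwhs R) (g : R -> C) (u : R -> R).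

Lemma integrable_itv_cat u (a b c : R) : a <= b -> b <= c ->
  mu.-integrable `[a, b] (EFin \o u) -> mu.-integrable `]b, c] (EFin \o u) ->
  mu.-integrable `[a, c] (EFin \o u).
Proof.
move=> ab bc i1 i2.
rewrite (@itv_bndbnd_setU _ _ _ (BRight b)); last 2 first.
- by rewrite bnd_simp.
- by rewrite bnd_simp.
apply/integrable_mkcond; first exact: measurableU.
move/integrable_mkcond : i1 => /(_ (measurable_itv _)) i1.
move/integrable_mkcond : i2 => /(_ (measurable_itv _)) i2.
apply: eq_integrable (integrableD _ i1 i2) => // x _ /=.
rewrite !patchE in_setU.
case: ifPn => [|_] /=; last first.
  by case: ifPn => //= _; rewrite ?add0e ?adde0.
rewrite inE /= in_itv /= => /andP[_ xb]; rewrite ifF ?adde0//.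
by apply/negbTE; rewrite notin_setE /= in_itv /= => /andP[]; rewrite ltNge xb.
Qed.

Lemma Rintegral_itv_cat u (a b t : R) : a <= b -> b < t ->
  mu.-integrable `[a, t] (EFin \o u) ->
  \int[mu]_(x in `[a, t]) u x = \int[mu]_(x in `[a, b]) u x + \int[mu]_(x in `[b, t]) u x.
Proof.
move=> ab bt it.
have i2 : mu.-integrable `]b, t] (EFin \o u).
  by apply: integrableS it => //; apply: subset_itvr; rewrite bnd_simp.
rewrite -(Rintegral_itv_obnd_cbnd i2) -(@Rintegral_itvB _ u (BLeft a) (BRight t) b)//.
- by rewrite addrC subrK.
- by rewrite bnd_simp ltW.
Qed.

Lemma filippov_cat S (a b c : R) (g1 g2 : R -> C) : a <= b -> b <= c ->
  filippov_solution S a b g1 -> filippov_solution S b c g2 -> g1 b = g2 b ->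
  filippov_solution S a c (fun t => if t <= b then g1 t else g2 t).
Proof.
move=> ab bc [u1 [ir1 ii1 ae1 e1]] [u2 [ir2 ii2 ae2 e2]] g12.
pose u t := if t <= b then u1 t else u2 t.
have cat (p : C -> R) : mu.-integrable `[a, b] (fun s => (p (u1 s))%:E) ->
    mu.-integrable `[b, c] (fun s => (p (u2 s))%:E) ->
    mu.-integrable `[a, c] (fun s => (p (u s))%:E) /\
    forall t, a <= t <= c -> \int[mu]_(x in `[a, t]) p (u x) =
      if t <= b then \int[mu]_(x in `[a, t]) p (u1 x)
      else \int[mu]_(x in `[a, b]) p (u1 x) + \int[mu]_(x in `[b, t]) p (u2 x).
  move=> i1 i2.
  have iu : mu.-integrable `[a, c] (EFin \o (fun s => p (u s))).
    apply: (integrable_itv_cat ab bc).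
      apply: eq_integrable i1 => // x; rewrite inE /= in_itv /= => /andP[_ xb].
      by rewrite /u xb.
    have i2' : mu.-integrable `]b, c] (fun s => (p (u2 s))%:E).
      by apply: integrableS i2 => //; apply: subset_itvr; rewrite bnd_simp.
    apply: eq_integrable i2' => // x; rewrite inE /= in_itv /= => /andP[bx _].
    by rewrite /u leNgt bx.
  split=> // t /andP[at_ tc].
  have [tb|bt] := leP t b.
    apply: eq_Rintegral => x; rewrite inE /= in_itv /= => /andP[_ xt].
    by rewrite /u (le_trans xt tb).
  have it : mu.-integrable `[a, t] (EFin \o (fun s => p (u s))).
    by apply: integrableS iu => //; apply: subset_itvl; rewrite bnd_simp.
  rewrite (Rintegral_itv_cat ab bt it); congr (_ + _).
    apply: eq_Rintegral => x; rewrite inE /= in_itv /= => /andP[_ xb].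
    by rewrite /u xb.
  have i2' : mu.-integrable `]b, t] (EFin \o (fun s => p (u s))).
    by apply: integrableS it => //; apply: subset_itvr; rewrite bnd_simp.
  have i2'' : mu.-integrable `]b, t] (EFin \o (fun s => p (u2 s))).
    apply: eq_integrable i2' => // x; rewrite inE /= in_itv /= => /andP[bx _].
    by rewrite /u leNgt bx.
  rewrite -(Rintegral_itv_obnd_cbnd i2') -(Rintegral_itv_obnd_cbnd i2'').
  apply: eq_Rintegral => x; rewrite inE /= in_itv /= => /andP[bx _].
  by rewrite /u leNgt bx.
have [ir er] := cat _ ir1 ir2; have [ii ei] := cat _ ii1 ii2.
exists u; split=> //.
  have fi := ae_filter_ringOfSetsType mu.
  apply: (@filterS2 _ _ fi _ _ _ _ ae1 ae2) => s H1 H2.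
  rewrite /u !in_itv /= in H1 H2 *; move=> /andP[as_ sc].
  have [sb|bs] := leP s b; first by apply: H1; rewrite as_.
  by apply: H2; rewrite sc (ltW bs).
move=> t; rewrite in_itv /= => /andP[at_ tc]; rewrite ab er ?at_// ei ?at_//.
have [tb|bt] := leP t b; first by apply: e1; rewrite in_itv /= at_.
rewrite e2 ?in_itv /= ?tc ?(ltW bt)// -g12 e1 ?in_itv /= ?lexx ?ab// -addrA.
by congr (_ + _).
Qed.

Lemma derive_Rintegral (f u : R -> R) (a b : R) : a < b ->
  (forall t, a <= t <= b -> is_derive t (1 : R) f (u t)) ->
  (forall t, a <= t <= b -> {for t, continuous u}) ->
  mu.-integrable `[a, b] (EFin \o u) /\
  forall t, a <= t <= b -> \int[mu]_(x in `[a, t]) u x = f t - f a.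
Proof.
move=> ab df cu.
have wc t : t <= b -> {within `[a, t], continuous u}.
  move=> tb; apply: continuous_in_subspaceT => x /set_mem /=; rewrite in_itv /= => /andP[ax xt].
  by apply: cu; rewrite ax (le_trans xt).
split.
  by apply: continuous_compact_integrable; [exact: segment_compact|exact: wc].
move=> t /andP[]; rewrite le_eqVlt => /predU1P[<-|at_] tb.
  by rewrite set_itv1 Rintegral_set1 subrr.
have inn x : a <= x <= t -> a <= x <= b by move=> /andP[-> /le_trans->].
rewrite /Rintegral (@continuous_FTC2 _ u f)//; first exact: wc.
- split=> [x||].
  + by rewrite in_itv /= => /andP[/ltW ax /ltW xt]; have [] := df x (inn x _); rewrite ?ax.
  + apply: cvg_at_right_filter; apply: (is_derive_continuous (df a _)).
    by rewrite lexx ltW.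
  + by apply: cvg_at_left_filter; apply: (is_derive_continuous (df t _)); rewrite tb ltW.
- move=> x; rewrite in_itv /= => /andP[/ltW ax /ltW xt].
  by rewrite derive1E; have [] := df x (inn x _); rewrite ?ax.
Qed.

Lemma filippov_smooth S (a b : R) g (u : R -> C) : a < b ->
  (forall t, a <= t <= b -> vderiv g t (u t)) ->
  (forall t, a <= t <= b -> {for t, continuous (fun s => Re (u s))} /\
                            {for t, continuous (fun s => Im (u s))}) ->
  (forall t, a <= t <= b -> filippov_field S (g t) (u t)) ->
  filippov_solution S a b g.
Proof.
move=> ab dg cu fu.
have [ir er] := derive_Rintegral ab (fun t h => (dg t h).1) (fun t h => (cu t h).1).
have [ii ei] := derive_Rintegral ab (fun t h => (dg t h).2) (fun t h => (cu t h).2).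
exists u; split=> //.
  by apply: aeW => t; rewrite in_itv /=; exact: fu.
move=> t; rewrite in_itv /= => h; rewrite er// ei//.
by apply: complexP; rewrite !ReImE /=; ring.
Qed.

(** All that the isolation argument takes from the inclusion: bounds on the admissible velocities
    bound the increments. Lebesgue integrals do not occur in that argument after this point. *)
Lemma filippov_increment (p : C -> R) S (a b s t lo hi : R) g : p = @complex.Re R \/ p = @complex.Im R ->
  filippov_solution S a b g -> a <= s -> s < t -> t <= b ->
  (forall x w, s < x < t -> filippov_field S (g x) w -> lo <= p w <= hi) ->
  lo * (t - s) <= p (g t) - p (g s) <= hi * (t - s).
Proof.
move=> pE [u [ir ii ae e]] as_ st tb H.
have ip : mu.-integrable `[a, b] (EFin \o (fun x => p (u x))) by case: pE => ->.
have pg x : a <= x <= b -> p (g x) = p (g a) + \int[mu]_(y in `[a, x]) p (u y).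
  move=> h; have := e x; rewrite in_itv /= => /(_ h) ->.
  by case: pE => ->; rewrite !ReImE.
have h1 : a <= s <= b by rewrite as_ (le_trans (ltW st)).
have h2 : a <= t <= b by rewrite tb (le_trans as_ (ltW st)).
rewrite (pg t h2) (pg s h1).
set X := p (g a); set I1 := Rintegral _ _ _; set I2 := Rintegral _ _ _.
have -> : X + I1 - (X + I2) = I1 - I2 by ring.
have fi := ae_filter_ringOfSetsType mu.
have sub x : x \in `]s, t[ -> x \in `[a, b] /\ s < x < t.
  rewrite !in_itv /= => /andP[sx xt]; rewrite sx xt; split=> //.
  by rewrite (le_trans as_ (ltW sx)) (le_trans (ltW xt) tb).
apply/andP; split.
  apply: Rintegral_increment_ge ip as_ st tb _.
  apply: (@filterS _ _ fi _ _ _ ae) => x Hx /sub[/Hx fx /H/(_ fx)/andP[]//].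
apply: Rintegral_increment_le ip as_ st tb _.
apply: (@filterS _ _ fi _ _ _ ae) => x Hx /sub[/Hx fx h].
by have /andP[] := H _ _ h fx.
Qed.

End FilippovSolutions.

(** * Uniqueness of arcs *)

Section PlanarOde.
Variable R : realType.
Local Notation C := R[i].
Implicit Types (F : C -> C) (g h z : R -> C).

Lemma is_derive_ext (f f' : R -> R) (x d d' : R) : is_derive x (1 : R) f d ->
  f =1 f' -> d = d' -> is_derive x (1 : R) f' d'.
Proof. by move=> H /funext <- <-. Qed.

Lemma Re_subR (z : C) (x : R) : Re (z - x%:C) = Re z - x.
Proof. by case: z. Qed.
Lemma Im_subR (z : C) (x : R) : Im (z - x%:C) = Im z.
Proof. by case: z => a b /=; rewrite subr0. Qed.

Definition gcont g (t : R) := forall e : R, 0 < e ->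
  exists2 k : R, 0 < k & forall s, `|s - t| < k -> normc (g s - g t) < e.

Lemma gcont_Re g t : gcont g t -> {for t, continuous (fun s => Re (g s))}.
Proof.
move=> H; apply/continuous_epsP => e /H[k k0 kH]; exists k => // s /kH.
by apply: le_lt_trans; rewrite (le_trans _ (Re_le_normc _))// !ReImE.
Qed.

Lemma gcont_Im g t : gcont g t -> {for t, continuous (fun s => Im (g s))}.
Proof.
move=> H; apply/continuous_epsP => e /H[k k0 kH]; exists k => // s /kH.
by apply: le_lt_trans; rewrite (le_trans _ (Im_le_normc _))// !ReImE.
Qed.

Lemma continuous_within (f : R -> R) (a b : R) :
  (forall t, a <= t <= b -> {for t, continuous f}) -> {within `[a, b], continuous f}.
Proof.
move=> H; apply: continuous_in_subspaceT => x /set_mem /=; rewrite in_itv /=; exact: H.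
Qed.

Definition clipschitz F (B L : R) := 0 <= L /\
  forall z w : C, normc z <= B -> normc w <= B -> normc (F z - F w) <= L * normc (z - w).

Lemma horner_lipschitz (p : {poly C}) (B : R) : exists L, clipschitz (horner p) B L.
Proof.
elim/poly_ind: p => [|p c [L [L0 IH]]].
  by exists 0; split=> // z w _ _; rewrite !horner0 subrr normc0 mul0r.
have [B0|B0] := leP 0 B; last first.
  by exists 0; split=> // z w zB; have := le_lt_trans (le_trans (normc_ge0 _) zB) B0; rewrite ltxx.
exists (L * B + (normc p.[0] + L * B)); split.
  by rewrite !addr_ge0 ?mulr_ge0 ?normc_ge0.
move=> z w zB wB; rewrite !hornerMXaddC.
have -> : p.[z] * z + c - (p.[w] * w + c) = (p.[z] - p.[w]) * z + p.[w] * (z - w) by ring.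
have z0 : normc 0 <= B by rewrite normc0.
have h1 : normc ((p.[z] - p.[w]) * z) <= L * normc (z - w) * B.
  by rewrite normcM; apply: ler_pM; rewrite ?normc_ge0//; exact: IH.
have h2 : normc (p.[w] * (z - w)) <= (normc p.[0] + L * B) * normc (z - w).
  rewrite normcM ler_wpM2r ?normc_ge0//.
  rewrite (le_trans (normc_le_dist _ p.[0]))// lerD2l (le_trans (IH _ _ wB z0))//.
  by rewrite subr0 ler_wpM2l.
apply: le_trans (ler_normcD _ _) (le_trans (lerD h1 h2) _).
by rewrite [leRHS]mulrDl lerD// mulrAC.
Qed.

Lemma gcont_comp F g t B L : clipschitz F B L -> (exists2 k : R, 0 < k &
   forall s, `|s - t| < k -> normc (g s) <= B) -> gcont g t -> gcont (fun s => F (g s)) t.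
Proof.
move=> [L0 FL] [k k0 kB] gc e e0; have L1 : 0 < L + 1 by rewrite ltr_wpDl.
have eL : 0 < e / (L + 1) by rewrite divr_gt0.
have [l l0 lg] := gc _ eL; exists (Num.min k l) => [|s]; first by rewrite lt_min k0.
rewrite lt_min => /andP[sk /lg]; rewrite ltr_pdivlMr// => H.
have tB : normc (g t) <= B by apply: kB; rewrite subrr normr0.
apply: le_lt_trans (FL _ _ (kB _ sk) tB) (le_lt_trans _ H).
by rewrite mulrC ler_wpM2l ?normc_ge0// lerDl.
Qed.

Lemma mean_value_open (f df : R -> R) (a b : R) : a < b ->
  (forall x, a < x < b -> is_derive x (1 : R) f (df x)) ->
  (forall x, a <= x <= b -> {for x, continuous f}) ->
  exists2 c, a < c < b & f b - f a = df c * (b - a).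
Proof.
move=> ab H Hc; have H' x : x \in `]a, b[ -> is_derive x (1 : R) f (df x).
  by rewrite in_itv /=; exact: H.
have [c] := MVT ab H' (continuous_within Hc).
by rewrite in_itv /=; exists c.
Qed.

(* Gronwall: [exp (-2 L t) |g - h|^2] does not increase. *)
Lemma ode_unique F (B L : R) g h (a b : R) : clipschitz F B L ->
  (forall t, a <= t <= b -> gcont g t /\ gcont h t) ->
  (forall t, a < t < b -> vderiv g t (F (g t)) /\ vderiv h t (F (h t))) ->
  (forall t, a <= t <= b -> normc (g t) <= B /\ normc (h t) <= B) ->
  g a = h a -> forall t, a <= t <= b -> g t = h t.
Proof.
move=> [L0 FL] gc dg gB gha t /andP[]; rewrite le_eqVlt => /predU1P[<-//|at_] tb.
pose D s := (Re (g s) - Re (h s)) ^+ 2 + (Im (g s) - Im (h s)) ^+ 2.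
pose D' s := 2 * ((Re (g s) - Re (h s)) * (Re (F (g s)) - Re (F (h s))) +
                  (Im (g s) - Im (h s)) * (Im (F (g s)) - Im (F (h s)))).
have DE s : D s = normc (g s - h s) ^+ 2 by rewrite sqr_normcE !ReImE.
have [||c /andP[ac ct]] := @mean_value_open (fun s => expR (- (2 * L) * s) * D s)
   (fun s => expR (- (2 * L) * s) * (D' s - 2 * L * D s)) a t at_ _ _.
- move=> s /andP[as_ st]; have [|[gr gi] [hr hi]] := dg s.
    by rewrite as_ (lt_le_trans st).
  have dD : is_derive s (1 : R) D (D' s).
    have d1 := is_deriveX 2 (is_deriveB gr hr); have d2 := is_deriveX 2 (is_deriveB gi hi).
    apply: (is_derive_ext (is_deriveD d1 d2)) => //.
    by rewrite /D' /GRing.scale /= !fctE; ring.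
  have de : is_derive s (1 : R) (fun u => expR (- (2 * L) * u)) (expR (- (2 * L) * s) * - (2 * L)).
    have d1 := is_deriveZ (- (2 * L)) (is_derive_id s (1 : R)).
    apply: (is_derive_ext (is_derive1_comp (is_derive_expR (- (2 * L) * s)) d1)) => //.
    by rewrite /GRing.scale /= mulr1.
  apply: (is_derive_ext (is_deriveM de dD)) => //.
  by rewrite /GRing.scale /=; ring.
- move=> s /andP[as_ st]; have [|gs hs] := gc s; first by rewrite as_ (le_trans st).
  have cr : {for s, continuous (fun u => Re (g u) - Re (h u))}.
    by apply: cvgB; [exact: gcont_Re|exact: gcont_Re].
  have ci : {for s, continuous (fun u => Im (g u) - Im (h u))}.
    by apply: cvgB; [exact: gcont_Im|exact: gcont_Im].
  apply: cvgM.
    apply: (@continuous_comp _ _ _ (fun u => - (2 * L) * u) (@expR R) s); last exact: continuous_expR.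
    by apply: cvgM; [exact: cvg_cst|exact: cvg_id].
  by apply: cvgD; rewrite expr2; apply: cvgM.
have Da : D a = 0 by rewrite /D gha !subrr expr0n addr0.
rewrite Da mulr0 subr0 => E.
have : D' c - 2 * L * D c <= 0.
  have [|cg ch] := gB c; first by rewrite (ltW ac) (le_trans (ltW ct)).
  have -> : D' c = 2 * Re ((g c - h c)^* * (F (g c) - F (h c))).
    by rewrite Re_conjM !ReImE.
  have := Re_le_normc ((g c - h c)^* * (F (g c) - F (h c))).
  rewrite normcM normc_conj; have := FL _ _ cg ch.
  have := normc_ge0 (g c - h c); rewrite DE; set n := normc _; set m := normc _ => n0 mn.
  rewrite ler_norml => /andP[_ H]; have : n * m <= n * (L * n) by rewrite ler_wpM2l.
  lra.
move=> neg; have : expR (- (2 * L) * t) * D t <= 0.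
  by rewrite E mulr_le0_ge0 ?mulr_ge0_le0 ?expR_ge0// subr_ge0 ltW.
rewrite pmulr_rle0 ?expR_gt0// DE => H.
apply/eqP; rewrite -subr_eq0 -normc_eq0 -(sqrf_eq0 (normc _)) eq_le H /=.
exact: sqr_ge0.
Qed.

Lemma vderiv_gcont g t d : vderiv g t d -> gcont g t.
Proof. by move=> /vderiv_cont. Qed.

Lemma vderiv_shift g (c t : R) d : vderiv g (c + t) d -> vderiv (fun s => g (c + s)) t d.
Proof.
move=> /vderiv_epsP H; apply/vderiv_epsP => e /H[k k0 kH]; exists k => // s sk.
have := kH (c + s); have -> : c + s - (c + t) = s - t by ring.
exact.
Qed.

Lemma gcont_shift g (c t : R) : gcont g (c + t) -> gcont (fun s => g (c + s)) t.
Proof.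
move=> H e /H[k k0 kH]; exists k => // s sk; apply: kH.
by have -> : c + s - (c + t) = s - t by ring.
Qed.

(** Let [q] be the supremum of the durations for which [g] stays in the open half plane. Uniqueness
    gives [g = z] up to [q], and if [q < T] then [Im (z q) > 0] lets [g] stay there a little
    longer. *)
Lemma arc_follow F (B L : R) g (s x y T : R) z : clipschitz F B L ->
  arc_curve F x y T B z -> (forall t, gcont g t) -> (forall t, normc (g t) <= B) ->
  (forall t, 0 < Im (g t) -> vderiv g t (F (g t))) -> g s = x%:C ->
  (exists2 k, 0 < k & forall t, s < t < s + k -> 0 < Im (g t)) ->
  forall r, 0 <= r <= T -> g (s + r) = z r.
Proof.
move=> FL [T0 [z0 zT] dz zI zB] gc gB dg gs [k k0 kg].
have same q : 0 <= q <= T -> (forall r, 0 < r < q -> 0 < Im (g (s + r))) ->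
    forall r, 0 <= r <= q -> g (s + r) = z r.
  move=> /andP[q0 qT] qI; apply: (ode_unique FL (g := fun r => g (s + r)) (h := z)).
  - move=> t /andP[t0 tq]; split; first exact/gcont_shift/gc.
    by apply: vderiv_gcont (dz t _); rewrite t0 (le_trans tq).
  - move=> t /andP[t0 tq]; split; first by apply/vderiv_shift/dg/qI; rewrite t0.
    by apply: dz; rewrite (ltW t0) (le_trans (ltW tq)).
  - by move=> t /andP[t0 tq]; split; [exact: gB|apply: zB; rewrite t0 (le_trans tq)].
  - by rewrite addr0 gs z0.
pose E := [set q | 0 <= q <= T /\ forall r, 0 < r < q -> 0 < Im (g (s + r))].
have E0 : E (Num.min k T).
  split=> [|r /andP[r0]]; first by rewrite le_min (ltW k0) (ltW T0) ge_min lexx orbT.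
  by rewrite lt_min => /andP[rk _]; apply: kg; rewrite ltrDl r0 ltrD2l.
have hE : has_sup E by split; [exists (Num.min k T)|exists T => q [/andP[]]].
set q := sup E.
have qE r : r < q -> 0 < r -> 0 < Im (g (s + r)).
  move=> rq r0; have qr : 0 < q - r by rewrite subr_gt0.
  have [e Ee] := sup_adherent qr hE; rewrite -/q.
  have -> : q - (q - r) = r by ring.
  by move=> re; apply: Ee.2; rewrite r0.
have qT : q <= T by apply: ge_sup; [exact: hE.1|move=> e [/andP[]]].
have q0 : 0 < q.
  by apply: lt_le_trans (sup_upper_bound hE E0); rewrite lt_min k0.
have gz := same q; rewrite (ltW q0) qT in gz.
have {gz}gz : forall r, 0 <= r <= q -> g (s + r) = z r.
  by apply: gz => // r /andP[r0 rq]; exact: qE.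
have [qlt|qge] := ltP q T; last first.
  by have -> : T = q by apply/eqP; rewrite eq_le qT qge.
have Iq : 0 < Im (g (s + q)) by rewrite gz ?zI ?q0// ltW// lexx.
have [l l0 lI] := (continuous_epsP _ _).1 (gcont_Im (gc (s + q))) _ Iq.
have : E (Num.min (q + l / 2) T).
  split=> [|r /andP[r0]].
    by rewrite le_min (ltW T0) ge_min lexx orbT andbT /= addr_ge0 ?(ltW q0)// divr_ge0// ltW.
  rewrite lt_min => /andP[rq rT]; have [rq'|qr] := ltP r q; first exact: qE.
  have := lI (s + r); have -> : s + r - (s + q) = r - q by ring.
  by rewrite ger0_norm ?subr_ge0// ltr_norml => /(_ _)/wrap[]; lra.
move/(sup_upper_bound hE); rewrite -/q leNgt lt_min qlt andbT ltrDl divr_gt0//.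
Qed.

(* The polar angle increases at least at rate [m], but stays in an interval of length [pi]. *)
Lemma angle_increase F g (c m a b : R) : a < b ->
  (forall t, a <= t <= b -> 0 < Im (g t) /\ vderiv g t (F (g t))) ->
  (forall t, a <= t <= b ->
     m * normc (g t - c%:C) ^+ 2 <= Im ((g t - c%:C)^* * F (g t))) ->
  0 < m -> m * (b - a) < 2 * pi /\ g a <> g b.
Proof.
move=> ab dg mF m0.
pose u t := Re (g t) - c.
pose df t := Im ((g t - c%:C)^* * F (g t)) / normc (g t - c%:C) ^+ 2.
have n0 t : a <= t <= b -> 0 < normc (g t - c%:C).
  move=> /dg[It _]; rewrite normc_gt0; apply: contraTneq It => H.
  by have := congr1 (@complex.Im R) H; rewrite Im_subR => ->; rewrite ltxx.
(* On the open upper half plane [atan (- u / Im)] is the argument of [g t - c] minus [pi / 2], so it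
   is differentiable without a branch of the argument. *)
have dth t : a <= t <= b -> is_derive t (1 : R) (fun t => atan (- (u t / Im (g t)))) (df t).
  move=> tab; have [It [gr gi]] := dg t tab.
  have In : Im (g t) != 0 by rewrite gt_eqF.
  have du : is_derive t (1 : R) u (Re (F (g t))).
    by have := is_deriveB gr (is_derive_cst c t (1 : R)); rewrite subr0.
  have di := is_deriveV In gi.
  have dq := is_deriveN (is_deriveM du di).
  have dc := @is_derive1_comp R (@atan R) (fun t => - (u t / Im (g t))) t _ _ (is_derive1_atan _) dq.
  apply: (is_derive_ext dc) => //.
  rewrite /df sqr_normcE Im_conjM !Re_subR !Im_subR -/(u t).
  rewrite /GRing.scale /= ?fctE; field.
  apply/andP; split; last exact: In.
  by apply: lt0r_neq0; apply: ltr_wpDl; [exact: sqr_ge0|exact: exprn_gt0].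
have [d /andP[ad db] E] := mean_value ab dth.
have dab : a <= d <= b by rewrite !ltW.
have : m * (b - a) <= df d * (b - a).
  by rewrite ler_wpM2r ?subr_ge0 ?(ltW ab)// /df ler_pdivlMr ?exprn_gt0 ?n0 ?mF.
rewrite -E => le; split; last first.
  by move=> gab; move: le; rewrite /u gab subrr leNgt mulr_gt0// subr_gt0.
have := atan_gtNpi2 (- (u a / Im (g a))); have := atan_ltpi2 (- (u b / Im (g b))).
by have := pi_gt0 R; lra.
Qed.

(** A solution that stayed above the real line for the time [(2 pi + 1) / m] would turn more than
    [angle_increase] allows. *)
Lemma arc_escape F g (c m a : R) : 0 < m ->
  (forall t, 0 < Im (g t) -> vderiv g t (F (g t))) ->
  (forall t, 0 < Im (g t) -> m * normc (g t - c%:C) ^+ 2 <= Im ((g t - c%:C)^* * F (g t))) ->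
  exists2 t, a <= t & Im (g t) <= 0.
Proof.
move=> m0 dg mF; apply: contrapT => /forall2NP H.
have pos t : a <= t -> 0 < Im (g t) by move=> at_; have [//|/negP] := H t; rewrite ltNge.
pose b := a + (2 * pi + 1) / m.
have ab : a < b by rewrite ltrDl divr_gt0// ltr_wpDl// mulr_ge0// pi_ge0.
have [||+ _] := @angle_increase F g c m a b ab _ _ m0.
- by move=> t /andP[/pos It _]; split=> //; exact: dg.
- by move=> t /andP[/pos/mF].
have -> : b - a = (2 * pi + 1) / m by rewrite /b; ring.
by rewrite [m * _]mulrC divfK ?gt_eqF// ltNge lerDl ler01.
Qed.

(** In the open half plane the angle around [c] increases strictly; the two ends are real and
    distinct, so they coincide neither with each other nor with interior points. *)
Lemma arc_injective F (x y T B c m : R) z : arc_curve F x y T B z -> x != y -> 0 < m ->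
  (forall t, 0 < t < T -> m * normc (z t - c%:C) ^+ 2 <= Im ((z t - c%:C)^* * F (z t))) ->
  forall s t, 0 <= s <= T -> 0 <= t <= T -> z s = z t -> s = t.
Proof.
move=> [T0 [z0 zT] dz zI zB] xy m0 mF.
wlog : / forall s t, 0 <= s -> s < t -> t <= T -> z s <> z t => [W|].
  apply: W => s t; rewrite le_eqVlt => /predU1P[<- t0|s0 st].
    rewrite le_eqVlt => /predU1P[->|tT]; first by rewrite z0 zT => -[/eqP]; apply/negP.
    by have := zI t; rewrite t0 tT z0 => /(_ isT) It E; move: It; rewrite -E ltxx.
  rewrite le_eqVlt => /predU1P[tT E|tT].
    by have := zI s; rewrite s0 -tT st E tT zT ltxx => /(_ isT).
  have inn r : s <= r <= t -> 0 < r < T.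
    by move=> /andP[sr rt]; rewrite (lt_le_trans s0 sr) (le_lt_trans rt tT).
  have [||_ //] := @angle_increase F z c m s t st _ _ m0.
  - move=> r /inn rT; split; first exact: zI.
    by apply: dz; case/andP: rT => /ltW -> /ltW ->.
  - by move=> r /inn/mF.
move=> H s t /andP[s0 sT] /andP[t0 tT] E; apply/eqP; case: ltgtP => // h.
  by case: (H s t s0 h tT).
by case: (H t s t0 h sT).
Qed.

(** Away from its ends the arc has a positive minimal height, so a real point close to the arc is
    close to one of the ends. *)
Lemma arc_separation F (x y T B : R) z : arc_curve F x y T B z -> forall d, 0 < d ->
  exists2 e, 0 < e & forall t (c : R), 0 <= t <= T -> normc (c%:C - z t) < e ->
    `|c - x| < d \/ `|c - y| < d.
Proof.
move=> [T0 [z0 zT] dz zI zB] d d0; have d2 : 0 < d / 2 by rewrite divr_gt0.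
have cz t : 0 <= t <= T -> gcont z t by move=> /dz/vderiv_gcont.
have [|k1 k10 H1] := cz 0 _ _ d2; first by rewrite lexx ltW.
have [|k2 k20 H2] := cz T _ _ d2; first by rewrite lexx ltW.
have close (c a : R) (w : C) : normc (c%:C - w) < d / 2 -> normc (w - a%:C) < d / 2 -> `|c - a| < d.
  move=> h1 h2; rewrite -normc_real rmorphB (le_lt_trans (normc_distD w _ _))//; lra.
pose k := Num.min (Num.min k1 k2) (T / 2).
have k0 : 0 < k by rewrite !lt_min k10 k20 divr_gt0.
have kk1 : k <= k1 by rewrite !ge_min lexx.
have kk2 : k <= k2 by rewrite !ge_min lexx orbT.
have kT2 : k <= T / 2 by rewrite !ge_min lexx orbT.
have kT : k <= T - k by lra.
clearbody k.
have cw : {within `[k, T - k], continuous (fun t => Im (z t))}.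
  by apply: continuous_within => t /andP[h1 h2]; apply/gcont_Im/cz; apply/andP; split; lra.
have [c] := EVT_min kT cw; rewrite in_itv /= => /andP[c1 c2] cmin.
have Ic : 0 < Im (z c) by apply: zI; apply/andP; split; lra.
exists (Num.min (d / 2) (Im (z c))) => [|t b /andP[t0 tT]]; first by rewrite lt_min d2.
rewrite lt_min => /andP[bz1 bz2].
have [tk|kt] := ltP t k.
  left; apply: close bz1 _; rewrite -z0; apply: H1; rewrite subr0 ger0_norm//; lra.
have [tk|kt2] := ltP (T - k) t.
  right; apply: close bz1 _; rewrite -zT; apply: H2; rewrite distrC ger0_norm; lra.
have := cmin t; rewrite in_itv /= kt kt2 => /(_ isT) le.
have := Im_le_normc (b%:C - z t); rewrite -normrN -Im_opp opprB Im_subR.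
by have := ler_norm (Im (z t)); lra.
Qed.

End PlanarOde.

(** * Periodic solutions of the inclusion, extended to all times *)

Section FilippovFlow.
Variable R : realType.
Local Notation C := R[i].
Implicit Types (S : pwhs R) (g G : R -> C).

Lemma Re_mulRr (z : C) (x : R) : Re (z * x%:C) = Re z * x.
Proof. by case: z => a b /=; ring. Qed.
Lemma Im_mulRr (z : C) (x : R) : Im (z * x%:C) = Im z * x.
Proof. by case: z => a b /=; ring. Qed.

Lemma filippov_convex S (z w : C) : filippov_field S z w -> exists2 l : R, 0 <= l <= 1 &
  w = l%:C * (Fup S).[z] + (1 - l)%:C * (Fdn S).[z].
Proof.
rewrite /filippov_field; case: ifP => _; last case: ifP => _ //.
  move=> /= ->; exists 1; rewrite ?ler01 ?lexx//.
  by rewrite subrr rmorph1 rmorph0 mul0r mul1r addr0.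
move=> /= ->; exists 0; rewrite ?ler01 ?lexx//.
by rewrite subr0 rmorph1 rmorph0 mul0r mul1r add0r.
Qed.

Lemma filippov_bound S (B : R) : exists2 K : R, 0 < K & forall z w : C, normc z <= B ->
  filippov_field S z w -> normc w <= K.
Proof.
have [L1 [L10 H1]] := horner_lipschitz (Fup S) B.
have [L2 [L20 H2]] := horner_lipschitz (Fdn S) B.
have [B0|B0] := leP 0 B; last first.
  by exists 1 => // z w zB; have := le_lt_trans (le_trans (normc_ge0 _) zB) B0; rewrite ltxx.
have z0 : normc 0 <= B by rewrite normc0.
have fb (F : {poly C}) L (z : C) : normc (F.[z] - F.[0]) <= L * normc (z - 0) -> 0 <= L ->
    normc z <= B -> normc F.[z] <= normc F.[0] + L * B.
  move=> H L0 zB; rewrite (le_trans (normc_le_dist _ F.[0]))// lerD2l (le_trans H)//.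
  by rewrite subr0 ler_wpM2l.
set K1 := normc (Fup S).[0] + L1 * B; set K2 := normc (Fdn S).[0] + L2 * B.
have K10 : 0 <= K1 by rewrite addr_ge0 ?normc_ge0 ?mulr_ge0.
have K20 : 0 <= K2 by rewrite addr_ge0 ?normc_ge0 ?mulr_ge0.
exists (K1 + K2 + 1) => [|z w zB /filippov_convex[l /andP[l0 l1] ->]]; first by lra.
rewrite (le_trans (ler_normcD _ _))// !normcM !normc_real.
rewrite (ger0_norm l0) ger0_norm ?subr_ge0//.
have h1 := fb _ _ _ (H1 _ _ zB z0) L10 zB; have h2 := fb _ _ _ (H2 _ _ zB z0) L20 zB.
rewrite -/K1 in h1; rewrite -/K2 in h2.
have n1 := normc_ge0 (Fup S).[z]; have n2 := normc_ge0 (Fdn S).[z].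
have : l * normc (Fup S).[z] <= normc (Fup S).[z] by rewrite ler_piMl.
have : (1 - l) * normc (Fdn S).[z] <= normc (Fdn S).[z] by rewrite ler_piMl//; lra.
by lra.
Qed.

(** A solution on the whole line, known through its increments. The intervals lie on one side of
    [t], so that none of them straddles a multiple of the period, where two copies of a periodic
    solution are glued. *)
Definition filippov_flow S G := forall t : R, exists2 k : R, 0 < k &
  forall (p : C -> R) s1 s2 lo hi, p = @complex.Re R \/ p = @complex.Im R -> s1 < s2 ->
    (t <= s1 /\ s2 <= t + k) \/ (t - k <= s1 /\ s2 <= t) ->
    (forall r w, s1 < r < s2 -> filippov_field S (G r) w -> lo <= p w <= hi) ->
    lo * (s2 - s1) <= p (G s2) - p (G s1) <= hi * (s2 - s1).

(** Periodic extension by [t - T floor (t / T)]. All times are needed because the given orbit may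
    start anywhere on the cycle and its period is not known to be that of the cycle. *)
Lemma periodic_flow S T g : 0 < T -> filippov_solution S 0 T g -> g T = g 0 ->
  exists G, [/\ filippov_flow S G, forall t, 0 <= t <= T -> G t = g t,
    forall t, exists2 s, 0 <= s <= T & G t = g s & forall t, G (t + T) = G t].
Proof.
move=> T0 sol gT; pose fl (t : R) : int := Num.floor (t / T).
pose G t := g (t - T * (fl t)%:~R).
have flP t : T * (fl t)%:~R <= t < T * (fl t)%:~R + T.
  have /andP[h1 h2] := floor_itv (t / T); apply/andP; split.
    by rewrite mulrC -ler_pdivlMr.
  by move: h2; rewrite ltr_pdivrMr// intrD rmorph1 mulrDl mul1r mulrC.
have flU t (k : int) : T * k%:~R <= t < T * k%:~R + T -> fl t = k.
  move=> /andP[h1 h2]; apply: floor_def; apply/andP; split.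
    by rewrite ler_pdivlMr// mulrC.
  by rewrite ltr_pdivrMr// intrD rmorph1 mulrDl mul1r mulrC.
have cell t (k : int) : T * k%:~R <= t <= T * k%:~R + T -> G t = g (t - T * k%:~R).
  move=> /andP[h1]; rewrite le_eqVlt => /predU1P[tE|h2]; last by rewrite /G (flU _ k) ?h1.
  have k1 : T * (k + 1)%:~R = T * k%:~R + T by rewrite intrD rmorph1 mulrDr mulr1.
  rewrite /G (flU _ (k + 1)) ?k1 -tE ?lexx ?ltrDl// subrr -gT; congr g.
  by rewrite tE addrC addKr.
exists G; split.
- move=> t; have := flP t; set k := fl t => /andP[kt tk].
  have inc (c : R) (p : C -> R) s1 s2 lo hi : p = @complex.Re R \/ p = @complex.Im R ->
      (exists k : int, c = T * k%:~R) -> s1 < s2 ->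
      c <= s1 -> s2 <= c + T -> (forall r w, s1 < r < s2 -> filippov_field S (G r) w -> lo <= p w <= hi) ->
      lo * (s2 - s1) <= p (G s2) - p (G s1) <= hi * (s2 - s1).
    move=> pE [j ->] s12 h1 h2 H.
    rewrite !(cell _ j) ?h1 ?h2 ?(le_trans (ltW s12) h2) ?(le_trans h1 (ltW s12))//.
    have -> : s2 - s1 = (s2 - T * j%:~R) - (s1 - T * j%:~R) by ring.
    apply: (filippov_increment pE sol); rewrite ?subr_ge0 ?ltrD2r//; first by lra.
    move=> x w /andP[x1 x2] fw; apply: (H (x + T * j%:~R)); first by apply/andP; split; lra.
    rewrite (cell _ j) ?addrK//; apply/andP; split; lra.
  have [kt'|tk'] := ltP (T * k%:~R) t.
    exists (Num.min (T * k%:~R + T - t) (t - T * k%:~R)) => [|p s1 s2 lo hi pE s12 h H].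
      by rewrite lt_min !subr_gt0 tk kt'.
    have m1 : Num.min (T * k%:~R + T - t) (t - T * k%:~R) <= T * k%:~R + T - t by rewrite ge_min lexx.
    have m2 : Num.min (T * k%:~R + T - t) (t - T * k%:~R) <= t - T * k%:~R by rewrite ge_min lexx orbT.
    by apply: (inc (T * k%:~R)) => //; [exists k|case: h; lra|case: h; lra].
  have tE : t = T * k%:~R by apply/eqP; rewrite eq_le kt tk'.
  exists T => // p s1 s2 lo hi pE s12 [[h1 h2]|[h1 h2]] H.
    by apply: (inc (T * k%:~R)) => //; [exists k|lra|lra].
  have k1 : T * (k - 1)%:~R = T * k%:~R - T by rewrite intrB rmorph1 mulrBr mulr1.
  by apply: (inc (T * (k - 1)%:~R)) => //; [exists (k - 1)|rewrite k1; lra|rewrite k1; lra].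
- by move=> t h; rewrite (cell _ 0) ?mulr0 ?subr0// add0r.
- move=> t; have /andP[h1 h2] := flP t; exists (t - T * (fl t)%:~R) => //.
  by apply/andP; split; lra.
- move=> t; have /andP[h1 h2] := flP t; rewrite /G.
  have k1 : T * (fl t + 1)%:~R = T * (fl t)%:~R + T by rewrite intrD rmorph1 mulrDr mulr1.
  rewrite (flU (t + T) (fl t + 1)) ?k1; first by congr g; ring.
  by apply/andP; split; lra.
Qed.

Section FlowFacts.
Variables (S : pwhs R) (G : R -> C) (B : R).
Hypothesis GF : filippov_flow S G.
Hypothesis GB : forall t, normc (G t) <= B.

Lemma flow_increment t : exists2 k : R, 0 < k & forall (p : C -> R) s c d,
  p = @complex.Re R \/ p = @complex.Im R -> `|s - t| < k ->
  (forall r w, `|r - t| < `|s - t| -> filippov_field S (G r) w -> `|p w - c| <= d) ->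
  `|p (G s) - p (G t) - c * (s - t)| <= d * `|s - t|.
Proof.
have [k k0 Hk] := GF t; exists k => // p s c d pE sk H.
have H' r w : `|r - t| < `|s - t| -> filippov_field S (G r) w -> c - d <= p w <= c + d.
  by move=> h1 h2; have := H r w h1 h2; rewrite ler_norml; lra.
have [st|ts|->] := ltgtP s t; last by rewrite !subrr mulr0 subrr normr0 mulr0.
  move: sk H'; rewrite ltr0_norm ?subr_lt0// opprB => sk H'.
  have h : t <= s /\ t <= t + k \/ t - k <= s /\ t <= t by right; split; lra.
  have H2 r w : s < r < t -> filippov_field S (G r) w -> c - d <= p w <= c + d.
    by move=> /andP[sr rt]; apply: H'; rewrite ltr0_norm; lra.
  by have := Hk p s t (c - d) (c + d) pE st h H2; rewrite ler_norml; lra.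
move: sk H'; rewrite gtr0_norm ?subr_gt0// => sk H'.
have h : t <= t /\ s <= t + k \/ t - k <= t /\ s <= t by left; split; lra.
have H2 r w : t < r < s -> filippov_field S (G r) w -> c - d <= p w <= c + d.
  by move=> /andP[sr rt]; apply: H'; rewrite gtr0_norm; lra.
by have := Hk p t s (c - d) (c + d) pE ts h H2; rewrite ler_norml; lra.
Qed.

Lemma flow_cont t : gcont G t.
Proof.
have [K K0 HK] := filippov_bound S B; have [k k0 Hk] := flow_increment t.
move=> e e0; exists (Num.min k (e / (3 * K))) => [|s].
  by rewrite lt_min k0 divr_gt0// mulr_gt0.
rewrite lt_min ltr_pdivlMr ?mulr_gt0// => /andP[sk se].
have inc (p : C -> R) : p = @complex.Re R \/ p = @complex.Im R -> `|p (G s) - p (G t)| <= K * `|s - t|.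
  move=> pE; have := Hk p s 0 K pE sk; rewrite mul0r subr0; apply=> r w _ /(HK _ _ (GB r)).
  rewrite subr0; apply: le_trans.
  by case: pE => ->; [exact: Re_le_normc|exact: Im_le_normc].
rewrite (le_lt_trans (normc_le_ReIm _))// !ReImE.
have := inc _ (or_introl erefl); have := inc _ (or_intror erefl).
by have := normr_ge0 (s - t); nra.
Qed.

Lemma flow_field_cont (F : {poly C}) t : gcont (fun s => F.[G s]) t.
Proof.
have [L FL] := horner_lipschitz F B.
by apply: (gcont_comp FL) (flow_cont t); exists 1.
Qed.

(** Near [t] the only admissible velocity is the continuous field [F], so the increment bounds
    squeeze the difference quotient: off the real line the solution is classical. *)
Lemma flow_vderiv (F : {poly C}) t (k : R) : 0 < k ->
  (forall r w, `|r - t| < k -> filippov_field S (G r) w -> w = F.[G r]) ->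
  vderiv G t F.[G t].
Proof.
move=> k0 Fk; have [l l0 Hl] := flow_increment t.
apply/vderiv_epsP => e e0; have e20 : 0 < e / 2 by rewrite divr_gt0.
have [m m0 Hm] := flow_field_cont F t e20.
exists (Num.min k (Num.min l m)) => [|s]; first by rewrite !lt_min k0 l0.
rewrite !lt_min => /and3P[sk sl sm].
have inc (p : C -> R) : p = @complex.Re R \/ p = @complex.Im R ->
    `|p (G s) - p (G t) - p F.[G t] * (s - t)| <= e / 2 * `|s - t|.
  move=> pE; apply: (Hl _ _ _ _ pE sl) => r w rs fw.
  rewrite (Fk r w (lt_trans rs sk) fw); apply: ltW; apply: le_lt_trans (Hm r (lt_trans rs sm)).
  have -> : p F.[G r] - p F.[G t] = p (F.[G r] - F.[G t]) by case: pE => ->; rewrite !ReImE.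
  by case: pE => ->; [exact: Re_le_normc|exact: Im_le_normc].
have h1 := inc _ (or_introl erefl); have h2 := inc _ (or_intror erefl).
rewrite (le_trans (normc_le_ReIm _))//.
have -> : Re (G s - G t - F.[G t] * (s - t)%:C) = Re (G s) - Re (G t) - Re F.[G t] * (s - t).
  by rewrite 2!Re_add 2!Re_opp Re_mulRr.
have -> : Im (G s - G t - F.[G t] * (s - t)%:C) = Im (G s) - Im (G t) - Im F.[G t] * (s - t).
  by rewrite 2!Im_add 2!Im_opp Im_mulRr.
by rewrite [e]splitr mulrDl lerD.
Qed.

Lemma flow_up t : 0 < Im (G t) -> vderiv G t (Fup S).[G t].
Proof.
move=> It; have [k k0 Hk] := (continuous_epsP _ _).1 (gcont_Im (flow_cont t)) _ It.
apply: (flow_vderiv k0) => r w /Hk; rewrite ltr_norml /filippov_field => h.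
by rewrite ifT//; lra.
Qed.

Lemma flow_down t : Im (G t) < 0 -> vderiv G t (Fdn S).[G t].
Proof.
move=> It; have It' : 0 < - Im (G t) by rewrite oppr_gt0.
have [k k0 Hk] := (continuous_epsP _ _).1 (gcont_Im (flow_cont t)) _ It'.
apply: (flow_vderiv k0) => r w /Hk; rewrite ltr_norml /filippov_field => h.
by rewrite ifF ?ifT//; [lra|apply/negbTE; rewrite -leNgt; lra].
Qed.

(* [e] is the orientation of the crossing. *)
Lemma flow_cross (e : R) t : e ^+ 2 = 1 -> Im (G t) = 0 ->
  0 < e * Im (Fup S).[G t] -> 0 < e * Im (Fdn S).[G t] ->
  exists2 k : R, 0 < k & forall s, t < s < t + k -> 0 < e * Im (G s).
Proof.
move=> e2 It up dn; set c := Num.min (e * Im (Fup S).[G t]) (e * Im (Fdn S).[G t]).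
have e1 : `|e| = 1 by apply/eqP; rewrite -sqr_norm_eq1 e2.
have c0 : 0 < c by rewrite lt_min up.
have c20 : 0 < c / 2 by rewrite divr_gt0.
have [k1 k10 H1] := flow_field_cont (Fup S) t c20.
have [k2 k20 H2] := flow_field_cont (Fdn S) t c20.
have [l l0 Hl] := flow_increment t.
have [K K0 HK] := filippov_bound S B.
exists (Num.min l (Num.min k1 k2)) => [|s /andP[ts]]; first by rewrite !lt_min l0 k10.
rewrite -ltrBlDl !lt_min => /and3P[sl s1 s2].
have st : `|s - t| = s - t by rewrite gtr0_norm ?subr_gt0.
(* An admissible velocity is a convex combination of the two fields, both of which satisfy
   [c <= e Im] at [G t], hence [c / 2 <= e Im] nearby. The interval from [c / 2] to [K] is then
   passed to [flow_increment] through its centre and radius. *)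
have low r w : `|r - t| < `|s - t| -> filippov_field S (G r) w -> c / 2 <= e * Im w <= K.
  rewrite st => rt fw; apply/andP; split; last first.
    rewrite (le_trans (ler_norm _))// normrM e1 mul1r (le_trans (Im_le_normc _))//.
    exact: HK fw.
  have near (F : {poly C}) : normc (F.[G r] - F.[G t]) < c / 2 -> c <= e * Im F.[G t] ->
      c / 2 <= e * Im F.[G r].
    move=> h cF; have := Im_le_normc (F.[G r] - F.[G t]); rewrite !ReImE => h'.
    have : `|e * (Im F.[G r] - Im F.[G t])| < c / 2 by rewrite normrM e1 mul1r (le_lt_trans h').
    by rewrite ltr_norml mulrBr; lra.
  have n1 : c / 2 <= e * Im (Fup S).[G r].
    by apply: near; [apply: H1; lra|rewrite ge_min lexx].
  have n2 : c / 2 <= e * Im (Fdn S).[G r].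
    by apply: near; [apply: H2; lra|rewrite ge_min lexx orbT].
  have [q /andP[q0 q1] ->] := filippov_convex fw.
  rewrite Im_add ![_%:C * _]mulrC !Im_mulRr.
  by nra.
have := Hl (@complex.Im R) s (e * (c / 2 + K) / 2) ((K - c / 2) / 2) (or_intror erefl).
rewrite st => /(_ sl) H.
have : `|Im (G s) - Im (G t) - e * (c / 2 + K) / 2 * (s - t)| <= (K - c / 2) / 2 * (s - t).
  apply: H => r w rt fw; have := low r w; rewrite st => /(_ rt fw) lw.
  have -> : Im w - e * (c / 2 + K) / 2 = e * (e * Im w - (c / 2 + K) / 2).
    by rewrite -[Im w in LHS]mul1r -e2; ring.
  by rewrite normrM e1 mul1r ler_norml; lra.
rewrite It subr0 => h.
have : `|e * (Im (G s) - e * (c / 2 + K) / 2 * (s - t))| <= (K - c / 2) / 2 * (s - t).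
  by rewrite normrM e1 mul1r.
have -> : e * (Im (G s) - e * (c / 2 + K) / 2 * (s - t)) =
  e * Im (G s) - (e ^+ 2) * ((c / 2 + K) / 2 * (s - t)) by ring.
rewrite e2 mul1r ler_norml => /andP[h1 _].
have : 0 < c / 2 * (s - t) by rewrite mulr_gt0// subr_gt0.
lra.
Qed.

End FlowFacts.
End FilippovFlow.

(** * Cycles crossing the real line *)

Section CrossingCycle.
Variable R : realType.
Local Notation C := R[i].
Implicit Types (S : pwhs R) (g G z : R -> C).

(** The lower field in the coordinate [- z], where it acts on the upper half plane, so that each
    fact about arcs is proved once. *)
Definition lower_field S (z : C) : C := - (Fdn S).[- z].

Lemma lower_field_lipschitz S B : exists L, clipschitz (lower_field S) B L.
Proof.
have [L [L0 H]] := horner_lipschitz (Fdn S) B; exists L; split=> // z w zB wB.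
have := H (- z) (- w); rewrite !normcN => /(_ zB wB).
by rewrite /lower_field -!opprD !normcN.
Qed.

Lemma vderiv_opp g t d : vderiv g t d -> vderiv (fun s => - g s) t (- d).
Proof.
move=> /vderiv_epsP H; apply/vderiv_epsP => e /H[k k0 kH]; exists k => // s /kH.
have -> : - g s - - g t - - d * (s - t)%:C = - (g s - g t - d * (s - t)%:C) by ring.
by rewrite normcN.
Qed.

Lemma gcont_opp g t : gcont g t -> gcont (fun s => - g s) t.
Proof.
move=> H e /H[k k0 kH]; exists k => // s /kH.
by rewrite -opprD normcN.
Qed.

Definition up_cross S (x : R) := 0 < Im (Fup S).[x%:C] /\ 0 < Im (Fdn S).[x%:C].
(** The point of the negative axis is [- p], since [p] is the start of the lower arc in the
    coordinate [- z]. *)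
Definition down_cross S (p : R) := Im (Fup S).[(- p)%:C] < 0 /\ Im (Fdn S).[(- p)%:C] < 0.

Lemma follow_up S G (B s x y T : R) z : filippov_flow S G -> (forall t, normc (G t) <= B) ->
  arc_curve (horner (Fup S)) x y T B z -> up_cross S x -> G s = x%:C ->
  forall r, 0 <= r <= T -> G (s + r) = z r.
Proof.
move=> GF GB za [xu xd] Gs; have [L FL] := horner_lipschitz (Fup S) B.
apply: (arc_follow FL za (flow_cont GF GB) GB) => //; first exact: flow_up GF GB.
have [|||k k0 Hk] := flow_cross GF GB (expr1n R 2) (t := s); rewrite ?Gs ?mul1r//.
by exists k => // t /Hk; rewrite mul1r.
Qed.

Lemma follow_down S G (B s p y T : R) z : filippov_flow S G -> (forall t, normc (G t) <= B) ->
  arc_curve (lower_field S) p y T B z -> down_cross S p -> G s = (- p)%:C ->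
  forall r, 0 <= r <= T -> G (s + r) = - z r.
Proof.
move=> GF GB za [xu xd] Gs r rT; have [L FL] := lower_field_lipschitz S B.
apply/eqP; rewrite -eqr_oppLR; apply/eqP; move: r rT.
apply: (arc_follow FL za (g := fun t => - G t)).
- by move=> t; exact/gcont_opp/flow_cont.
- by move=> t; rewrite normcN.
- move=> t; rewrite Im_opp oppr_gt0 => It.
  by rewrite /lower_field opprK; exact/vderiv_opp/(flow_down GF GB).
- by rewrite Gs rmorphN opprK.
have e2 : (-1 : R) ^+ 2 = 1 by rewrite sqrrN expr1n.
have [|||k k0 Hk] := flow_cross GF GB e2 (t := s); rewrite ?Gs ?mulN1r ?oppr_gt0//.
by exists k => // t /Hk; rewrite mulN1r Im_opp.
Qed.

Definition loop (Tu : R) zu zd (t : R) : C := if t <= Tu then zu t else - zd (t - Tu).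

Lemma horner_continuous_curve (F : {poly C}) g t : gcont g t -> gcont (fun s => F.[g s]) t.
Proof.
move=> gc; have [k k0 Hk] := gc 1 ltr01.
have [L FL] := horner_lipschitz F (normc (g t) + 1).
apply: (gcont_comp FL) => //; exists k => // s /Hk h.
by rewrite (le_trans (normc_le_dist _ (g t)))// lerD2l ltW.
Qed.

Lemma loop_filippov S (x p x' Tu Td B : R) zu zd :
  arc_curve (horner (Fup S)) x (- p) Tu B zu -> arc_curve (lower_field S) p (- x') Td B zd ->
  let g := loop Tu zu zd in
  [/\ filippov_solution S 0 (Tu + Td) g, [/\ g 0 = x%:C, g Tu = (- p)%:C & g (Tu + Td) = x'%:C],
      forall t, 0 < t < Tu -> 0 < Im (g t), forall t, Tu < t < Tu + Td -> Im (g t) < 0 &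
      forall t, 0 <= t <= Tu + Td -> normc (g t) <= B].
Proof.
move=> [Tu0 [zu0 zuT] dzu zuI zuB] [Td0 [zd0 zdT] dzd zdI zdB] g.
have zuTd : zu Tu = - zd (Tu - Tu) by rewrite subrr zuT zd0 rmorphN.
have TT : Tu < Tu + Td by rewrite ltrDl.
split.
- apply: (@filippov_cat _ _ 0 Tu (Tu + Td) zu (fun t => - zd (t - Tu))) => //; try exact: ltW.
    apply: (filippov_smooth Tu0 (u := fun t => (Fup S).[zu t])) => // t tT.
      have gc := horner_continuous_curve (Fup S) (vderiv_gcont (dzu t tT)).
      by split; [exact: gcont_Re gc|exact: gcont_Im gc].
    (* At both ends the arc is on the real line, where the upper field is the extremity [l = 1] of
       the Filippov segment. *)
    rewrite /filippov_field; have [t0|t0] := eqVneq t 0.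
      rewrite t0 zu0 /= ltxx; exists 1; rewrite ?ler01 ?lexx//.
      by rewrite subrr rmorph1 rmorph0 mul0r mul1r addr0.
    have [t1|t1] := eqVneq t Tu.
      rewrite t1 zuT /= ltxx; exists 1; rewrite ?ler01 ?lexx//.
      by rewrite subrr rmorph1 rmorph0 mul0r mul1r addr0.
    by rewrite ifT// zuI// !lt_def t0 eq_sym t1; case/andP: tT => -> ->.
  apply: (filippov_smooth TT (u := fun t => (Fdn S).[- zd (t - Tu)])).
  + move=> t tT; have tT' : 0 <= - Tu + t <= Td by case/andP: tT => ? ?; apply/andP; split; lra.
    have -> : (Fdn S).[- zd (t - Tu)] = - (lower_field S (zd (- Tu + t))).
      by rewrite /lower_field opprK addrC.
    have := vderiv_shift (dzd _ tT'); under eq_fun do rewrite addrC.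
    exact: vderiv_opp.
  + move=> t tT; have tT' : 0 <= - Tu + t <= Td by case/andP: tT => ? ?; apply/andP; split; lra.
    have gc := gcont_shift (vderiv_gcont (dzd _ tT')).
    have {}gc : gcont (fun s => - zd (s - Tu)) t.
      by apply: gcont_opp; under eq_fun do rewrite addrC.
    have {}gc := horner_continuous_curve (Fdn S) gc.
    by split; [exact: gcont_Re gc|exact: gcont_Im gc].
  + move=> t /andP[t1 t2]; rewrite /filippov_field.
    have l0 (w : C) : Im w = 0 -> (Fdn S).[w] \in (if 0 < Im w then [set (Fup S).[w]]
         else if Im w < 0 then [set (Fdn S).[w]] else [set w0 | exists2 l : R, 0 <= l <= 1 &
           w0 = l%:C * (Fup S).[w] + (1 - l)%:C * (Fdn S).[w]]).
      move=> ->; rewrite ltxx inE /=; exists 0; rewrite ?ler01 ?lexx//.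
      by rewrite subr0 rmorph1 rmorph0 mul0r mul1r add0r.
    have [tE|tE] := eqVneq t Tu.
      by have := l0 (- zd (t - Tu)); rewrite inE; apply; rewrite tE subrr zd0 /= oppr0.
    have [tF|tF] := eqVneq t (Tu + Td).
      by have := l0 (- zd (t - Tu)); rewrite inE; apply; rewrite tF addrAC subrr add0r zdT /= oppr0.
    have I : 0 < Im (zd (t - Tu)).
      apply: zdI; apply/andP; split; first by rewrite subr_gt0 lt_def tE.
      by rewrite ltrBlDl lt_def eq_sym tF.
    by rewrite Im_opp oppr_gt0 oppr_lt0 I (lt_gtF I).
- rewrite /g /loop (ltW Tu0) lexx; split=> //.
  by rewrite leNgt TT addrAC subrr add0r zdT rmorphN opprK.
- by move=> t /andP[t0 tT]; rewrite /g /loop (ltW tT) zuI// t0.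
- move=> t /andP[t1 t2]; rewrite /g /loop leNgt t1 /= Im_opp oppr_lt0 zdI//.
  by rewrite subr_gt0 t1 ltrBlDl.
- move=> t /andP[t0 tT]; rewrite /g /loop; have [h|h] := leP t Tu.
    by rewrite zuB ?t0.
  by rewrite normcN zdB// subr_ge0 (ltW h) lerBlDl.
Qed.

End CrossingCycle.

(** * A crossing cycle whose multiplier is not of modulus 1 *)

Section Cycle.
Variable R : realType.
Local Notation C := R[i].
Variables (S : pwhs R) (x0 p0 d B B1 Y' X' m c : R) (Y X Tu Td : R -> R).
Hypothesis x00 : 0 < x0.
Hypothesis p00 : 0 < p0.
Hypothesis d0 : 0 < d.
Hypothesis BB1 : B < B1.
Hypothesis m0 : 0 < m.
Hypothesis HU : forall x, `|x - x0| < d ->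
  0 < Y x /\ half_arc (horner (Fup S)) x (- (Y x)) (Tu x) B.
Hypothesis HD : forall p, `|p - p0| < d ->
  0 < X p /\ half_arc (lower_field S) p (- (X p)) (Td p) B.
Hypothesis Yx0 : Y x0 = p0.
Hypothesis Xp0 : X p0 = x0.
Hypothesis dY : is_derive x0 (1 : R) Y Y'.
Hypothesis dX : is_derive p0 (1 : R) X X'.
Hypothesis cTu : {for x0, continuous Tu}.
Hypothesis cTd : {for p0, continuous Td}.
Hypothesis mu1 : `|X' * Y'| != 1.
Hypothesis rotU : forall z : C, normc z < B1 -> 0 < Im z ->
  m * normc (z - c%:C) ^+ 2 <= Im ((z - c%:C)^* * (Fup S).[z]).
Hypothesis rotD : forall z : C, normc z < B1 -> 0 < Im z ->
  m * normc (z - 0%:C) ^+ 2 <= Im ((z - 0%:C)^* * lower_field S z).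
Hypothesis upx : up_cross S x0.
Hypothesis dnp : down_cross S p0.

Lemma Im_horner_real_pos (F : {poly C}) (e x : R) : 0 < e * Im F.[x%:C] ->
  exists2 k, 0 < k & forall y, `|y - x| < k -> 0 < e * Im F.[y%:C].
Proof.
move=> H; have gc : gcont (fun t : R => t%:C) x.
  move=> r r0; exists r => // s; by rewrite -rmorphB normc_real.
have cI := gcont_Im (horner_continuous_curve F gc).
have ce : {for x, continuous (fun y : R => e * Im F.[y%:C])}.
  by apply: cvgM; [exact: cvg_cst|exact: cI].
have [k k0 Hk] := (continuous_epsP _ _).1 ce _ H.
by exists k => // y /Hk; rewrite ltr_norml; lra.
Qed.

Lemma up_cross_near : exists2 k, 0 < k & forall x, `|x - x0| < k -> up_cross S x.
Proof.
have [u v] := upx.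
have [|k k0 Hk] := @Im_horner_real_pos (Fup S) 1 x0; first by rewrite mul1r.
have [|l l0 Hl] := @Im_horner_real_pos (Fdn S) 1 x0; first by rewrite mul1r.
exists (Num.min k l) => [|x]; first by rewrite lt_min k0.
by rewrite lt_min => /andP[/Hk + /Hl]; rewrite !mul1r.
Qed.

Lemma down_cross_near : exists2 k, 0 < k & forall p, `|p - p0| < k -> down_cross S p.
Proof.
have [u v] := dnp.
have [|k k0 Hk] := @Im_horner_real_pos (Fup S) (-1) (- p0); first by rewrite mulN1r oppr_gt0.
have [|l l0 Hl] := @Im_horner_real_pos (Fdn S) (-1) (- p0); first by rewrite mulN1r oppr_gt0.
exists (Num.min k l) => [|x]; first by rewrite lt_min k0.
have -> : `|x - p0| = `|- x - - p0| by rewrite -opprD normrN.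
by rewrite lt_min => /andP[/Hk + /Hl]; rewrite !mulN1r !oppr_gt0.
Qed.

Let Q x := X (Y x).

Lemma return_derive : is_derive x0 (1 : R) Q (X' * Y').
Proof. by have dX' := dX; rewrite -Yx0 in dX'; exact: is_derive1_comp dX' dY. Qed.

(** The same alternative holds for all points near [x0], so it can be iterated. Half of the gap
    between [|X' Y'|] and 1 absorbs the remainder of the expansion. *)
Lemma return_moves : exists2 k, 0 < k &
  (forall x, `|x - x0| < k -> x != x0 -> `|Q x - x0| < `|x - x0|) \/
  (forall x, `|x - x0| < k -> x != x0 -> `|x - x0| < `|Q x - x0|).
Proof.
have Qx0 : Q x0 = x0 by rewrite /Q Yx0 Xp0.
pose M := X' * Y'; have h : 0 < `| `|M| - 1 | / 2 by rewrite divr_gt0// normr_gt0 subr_eq0.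
have [k k0 Hk] := (is_derive_epsP _ _ _).1 return_derive _ h; exists k => //.
have est x : `|x - x0| < k -> x != x0 -> [/\ 0 < `|x - x0|,
    `|Q x - x0| <= `|M| * `|x - x0| + `| `|M| - 1 | / 2 * `|x - x0| &
    `|M| * `|x - x0| - `| `|M| - 1 | / 2 * `|x - x0| <= `|Q x - x0|].
  move=> /Hk; rewrite Qx0 -/M => H xx; split; first by rewrite normr_gt0 subr_eq0.
    have := ler_normD (Q x - x0 - M * (x - x0)) (M * (x - x0)); rewrite subrK.
    by rewrite [`|M * _|]normrM; lra.
  have := ler_normB (Q x - x0) (Q x - x0 - M * (x - x0)).
  by rewrite opprB addrC subrK [`|M * _|]normrM; lra.
have [Mlt|Mge] := ltP (`|M|) 1; [left|right] => x xk xx; have [n0 e1 e2] := est x xk xx.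
  rewrite (ltr0_norm (x := `|M| - 1)) ?subr_lt0// in e1.
  have : 0 < (1 - `|M|) * `|x - x0| by rewrite mulr_gt0// subr_gt0.
  lra.
have Mgt : 1 < `|M| by rewrite lt_def mu1.
rewrite (gtr0_norm (x := `|M| - 1)) ?subr_gt0// in e2.
have : 0 < (`|M| - 1) * `|x - x0| by rewrite mulr_gt0// subr_gt0.
lra.
Qed.

(** A uniform lower bound on the time of a turn, so that a finite time contains finitely many
    turns. *)
Lemma period_lower : exists2 k, 0 < k & forall x, `|x - x0| < k -> Tu x0 / 2 < Tu x.
Proof.
have [_ [z [T0 _ _ _ _]]] : 0 < Y x0 /\ half_arc (horner (Fup S)) x0 (- Y x0) (Tu x0) B.
  by apply: HU; rewrite subrr normr0.
have T2 : 0 < Tu x0 / 2 by rewrite divr_gt0.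
have [k k0 Hk] := (continuous_epsP _ _).1 cTu _ T2; exists k => // x /Hk.
by rewrite ltr_norml; lra.
Qed.

Variables (zu zd : R -> C).
Hypothesis zuA : arc_curve (horner (Fup S)) x0 (- p0) (Tu x0) B zu.
Hypothesis zdA : arc_curve (lower_field S) p0 (- x0) (Td p0) B zd.

Let T0 := Tu x0 + Td p0.
Let g0 := loop (Tu x0) zu zd.
Definition cycle_set : set C := g0 @` `[0, T0]%classic.
Let Gam := cycle_set.

Let Tu0 : 0 < Tu x0. Proof. by case: zuA. Qed.
Let Td0 : 0 < Td p0. Proof. by case: zdA. Qed.
Let T00 : 0 < T0. Proof. by rewrite /T0 addr_gt0. Qed.

Lemma cycle_real_points (delta : R) : 0 < delta -> exists2 e, 0 < e & forall (w : C) (b : R), Gam w ->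
  normc (b%:C - w) < e -> `|b - x0| < delta \/ `|b + p0| < delta.
Proof.
move=> dl0; have [e1 e10 H1] := arc_separation zuA dl0; have [e2 e20 H2] := arc_separation zdA dl0.
exists (Num.min e1 e2) => [|w b [t]]; first by rewrite lt_min e10.
rewrite /= in_itv /= => /andP[t0 tT] <-; rewrite lt_min /g0 /loop; have [tu|tu] := leP t (Tu x0).
  move=> /andP[/H1 + _]; rewrite t0 tu opprK => /(_ isT)[]; by [left|right].
rewrite opprK => /andP[_ h].
have : normc ((- b)%:C - zd (t - Tu x0)) < e2.
  by rewrite rmorphN -normcN opprB opprK addrC.
move/H2; rewrite subr_ge0 (ltW tu) lerBlDl tT => /(_ isT)[].
  by rewrite -normrN opprB opprK addrC; right.
by rewrite opprK addrC distrC; left.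
Qed.

(** In a thin tube an orbit meets the real line only near [x0] and [- p0], where it has to cross. It
    is thus made of arcs, and its passages near [x0] are iterates of [Q]. Periodicity and
    [return_moves] force all of them to be [x0], after which the orbit follows the cycle. *)
Lemma cycle_isolated : exists2 e : R, 0 < e & forall H : set C, periodic_orbit S H ->
  (forall z, H z -> exists2 w, Gam w & `|z - w| < e%:C) -> H = Gam.
Proof.
have [k1 k10 K1] := up_cross_near; have [k2 k20 K2] := down_cross_near.
have [k3 k30 K3] := return_moves; have [k4 k40 K4] := period_lower.
pose dl := Num.min (Num.min (Num.min k1 k2) (Num.min k3 k4)) (Num.min d (Num.min x0 p0)).
have dl0 : 0 < dl by rewrite !lt_min k10 k20 k30 k40 d0 x00.
have [dlk1 dlk2 dlk3 dlk4] : [/\ dl <= k1, dl <= k2, dl <= k3 & dl <= k4].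
  by split; rewrite /dl !ge_min lexx ?orbT.
have [dld dlx dlp] : [/\ dl <= d, dl <= x0 & dl <= p0].
  by split; rewrite /dl !ge_min lexx ?orbT.
clearbody dl.
have [e1 e10 E1] := cycle_real_points dl0.
have BB0 : 0 < B1 - B by rewrite subr_gt0.
exists (Num.min e1 (B1 - B)) => [|H [T [g [[T_gt0 sol gT ginj] HE]]] tube].
  by rewrite lt_min e10.
have [G [GF Gg Gran GT]] := periodic_flow T_gt0 sol gT.
have HG t : H (G t) by have [s sT ->] := Gran t; rewrite HE; exists s.
have tubeG t : exists2 w, Gam w & normc (G t - w) < Num.min e1 (B1 - B).
  by have [w Gw h] := tube _ (HG t); exists w => //; rewrite -ltcR -normcE2.
have GamB w : Gam w -> normc w <= B.
  move=> [t]; rewrite /= in_itv /= => tT <-.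
  by have [_ _ _ _] := loop_filippov zuA zdA; apply.
have GB t : normc (G t) < B1.
  have [w /GamB wB] := tubeG t; rewrite lt_min => /andP[_ h].
  by have := normc_le_dist (G t) w; lra.
have GB' t : normc (G t) <= B1 by exact: ltW.
have arcB F x y T' z : arc_curve F x y T' B z -> arc_curve F x y T' B1 z.
  by case=> h1 h2 h3 h4 h5; split=> // t /h5 /le_trans; apply; exact: ltW.
have real_pts t : Im (G t) = 0 -> exists2 b, G t = b%:C & `|b - x0| < dl \/ `|b + p0| < dl.
  move=> It; have GE : G t = (Re (G t))%:C by apply: complexP.
  exists (Re (G t)) => //; have [w Gw] := tubeG t; rewrite lt_min => /andP[h _].
  by apply: E1 Gw _; rewrite -GE.
have step_down s p : `|p - p0| < dl -> G s = (- p)%:C -> [/\ G (s + Td p) = (X p)%:C,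
    `|X p - x0| < dl, 0 < Td p & forall r, 0 < r < Td p -> Im (G (s + r)) < 0].
  move=> pd Gs; have [Xp [z za]] := HD (lt_le_trans pd dld).
  have := follow_down GF GB' (arcB _ _ _ _ _ za) (K2 _ (lt_le_trans pd dlk2)) Gs.
  have [Tdp [_ zT] _ zI _] := za => fol.
  have GE : G (s + Td p) = (X p)%:C by rewrite fol ?lexx ?(ltW Tdp)// zT rmorphN opprK.
  split=> //; last first.
    move=> r rT; rewrite fol ?Im_opp ?oppr_lt0 ?zI//.
    by case/andP: rT => /ltW -> /ltW ->.
  have [|b] := real_pts (s + Td p); first by rewrite GE.
  rewrite GE => -[<-] [//|h]; move: h; rewrite gtr0_norm; lra.
have step_up s x : `|x - x0| < dl -> G s = x%:C -> [/\ G (s + Tu x) = (- Y x)%:C,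
    `|Y x - p0| < dl, Tu x0 / 2 < Tu x & forall r, 0 < r < Tu x -> 0 < Im (G (s + r))].
  move=> xd Gs; have [Yx [z za]] := HU (lt_le_trans xd dld).
  have := follow_up GF GB' (arcB _ _ _ _ _ za) (K1 _ (lt_le_trans xd dlk1)) Gs.
  have [Tux [_ zT] _ zI _] := za => fol.
  have GE : G (s + Tu x) = (- Y x)%:C by rewrite fol ?lexx ?(ltW Tux).
  split=> //; last 2 first.
  - by apply: K4; exact: lt_le_trans xd dlk4.
  - by move=> r rT; rewrite fol ?zI//; case/andP: rT => /ltW -> /ltW ->.
  have [|b] := real_pts (s + Tu x); first by rewrite GE.
  rewrite GE => -[<-] [h|h]; last by rewrite distrC addrC in h *.
  move: h; rewrite ltr0_norm; lra.
have step s x : `|x - x0| < dl -> G s = x%:C -> exists T', [/\ Tu x0 / 2 < T',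
    G (s + T') = (Q x)%:C, `|Q x - x0| < dl &
    forall r x', 0 < r < T' -> `|x' - x0| < dl -> G (s + r) <> x'%:C].
  move=> xd Gs; have [G1 Yd T1 I1] := step_up _ _ xd Gs.
  have [G2 Xd T2 I2] := step_down _ _ Yd G1.
  exists (Tu x + Td (Y x)); split=> //; first by lra.
    by rewrite addrA.
  move=> r x' /andP[r0 rT] xd' GE.
  have [rTu|rTu|rE] := ltgtP r (Tu x).
  - by have := I1 r; rewrite r0 rTu GE Im_real ltxx => /(_ isT).
  - have := I2 (r - Tu x); have -> : s + Tu x + (r - Tu x) = s + r by ring.
    by rewrite GE Im_real ltxx subr_gt0 rTu ltrBlDl rT => /(_ isT).
  - move: G1; rewrite -rE GE => -[xE]; move: xd'; rewrite xE.
    have : 0 < Y x by have [] := HU (lt_le_trans xd dld).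
    rewrite ltr_norml; lra.
have Tm : 0 < Tu x0 / 2 by rewrite divr_gt0.
(* One period later the orbit is again at [x]. If [x] were not [x0], the turns in between would have
   made the distance to [x0] strictly smaller, or strictly larger. *)
have all_x0 s x : `|x - x0| < dl -> G s = x%:C -> x = x0.
  move=> xd Gs; apply/eqP/negPn/negP => xx.
  have trans (P : R -> R -> Prop) : (forall a b b', P a b -> P b b' -> P a b') ->
      (forall x, `|x - x0| < dl -> x != x0 -> P `|Q x - x0| `|x - x0|) ->
      P `|x - x0| `|x - x0|.
    move=> Ptr PQ.
    (* Induction on a bound for the number of turns between two passages, each turn lasting more
       than [Tu x0 / 2]. The relation [P] stands for either of the two strict orders. *)
    have ind n s1 s2 x1 x2 : `|x1 - x0| < dl -> `|x2 - x0| < dl -> G s1 = x1%:C -> G s2 = x2%:C ->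
        s1 < s2 -> s2 <= s1 + n%:R * (Tu x0 / 2) ->
        (x1 = x0 -> x2 = x0) /\ (x1 != x0 -> P `|x2 - x0| `|x1 - x0|).
      elim: n s1 x1 => [|n IH] s1 x1 xd1 xd2 G1 G2 s12.
        by rewrite mul0r addr0 leNgt s12.
      have [T' [T1 GT' Qd none]] := step _ _ xd1 G1.
      rewrite mulrS mulrDl mul1r => s2n.
      have [lt2|gt2|e2] := ltgtP (s1 + T') s2.
      - have [] := IH _ _ Qd xd2 GT' G2 lt2; first by lra.
        move=> h1 h2; split=> [xE|xN]; first by apply: h1; rewrite xE /Q Yx0 Xp0.
        have := PQ _ xd1 xN; have [/eqP QE|QN] := boolP (Q x1 == x0).
          by rewrite (h1 QE) QE.
        by apply: Ptr; exact: h2.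
      - case: (none (s2 - s1) x2) => //; last by have -> : s1 + (s2 - s1) = s2 by ring.
        by rewrite subr_gt0 s12 ltrBlDl gt2.
      - move: G2; rewrite -e2 GT' => -[<-]; split=> [->|xN]; first by rewrite /Q Yx0 Xp0.
        exact: PQ.
    have [n nT] : exists n : nat, T / (Tu x0 / 2) < n%:R.
      by exists (Num.bound (T / (Tu x0 / 2))); apply: archi_boundP; rewrite divr_ge0// ltW.
    have [] := ind n s (s + T) x x xd xd Gs.
    - by rewrite GT.
    - by rewrite ltrDl.
    - by rewrite lerD2l; rewrite ltr_pdivrMr// in nT; exact: ltW.
    - by move=> _; apply.
  case: K3 => K3.
    have : `|x - x0| < `|x - x0|; last by rewrite ltxx.
    apply: (trans (fun a b => a < b)) => [a b b' h1 h2|y yd]; first exact: lt_trans h1 h2.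
    by apply: K3; exact: lt_le_trans yd dlk3.
  have : `|x - x0| < `|x - x0|; last by rewrite ltxx.
  apply: (trans (fun a b => b < a)) => [a b b' h1 h2|y yd]; first exact: lt_trans h2 h1.
  by apply: K3; exact: lt_le_trans yd dlk3.
(* By [arc_escape] the orbit cannot remain in one half plane. If it is then found near [- p0], one
   lower arc brings it near [x0]. *)
have start : exists s, G s = x0%:C.
  have [t It] : exists t, Im (G t) = 0.
    have cI t : {for t, continuous (fun t => Im (G t))} by exact/gcont_Im/flow_cont.
    have ivt (a b : R) : a <= b -> Num.min (Im (G a)) (Im (G b)) <= 0 <= Num.max (Im (G a)) (Im (G b)) ->
        exists t, Im (G t) = 0.
      move=> ab h; have cw : {within `[a, b], continuous (fun t => Im (G t))}.
        by apply: continuous_within => t _; exact: cI.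
      by have [t _ ?] := IVT ab cw h; exists t.
    have [lt0|gt0|e0] := ltgtP (Im (G 0)) 0; last by exists 0.
      have d1 t : 0 < Im (- G t) -> vderiv (fun t => - G t) t (lower_field S (- G t)).
        rewrite Im_opp oppr_gt0 => It.
        by rewrite /lower_field opprK; exact/vderiv_opp/(flow_down GF GB').
      have r1 t : 0 < Im (- G t) ->
          m * normc (- G t - 0%:C) ^+ 2 <= Im ((- G t - 0%:C)^* * lower_field S (- G t)).
        by apply: rotD; rewrite normcN.
      have [t t0] := arc_escape 0 m0 d1 r1.
      rewrite Im_opp oppr_le0 => It; apply: (ivt 0 t t0).
      by rewrite ge_min le_max (ltW lt0) It orbT.
    have [t t0 It] := arc_escape 0 m0 (fun t => @flow_up _ _ _ _ GF GB' t) (fun t => @rotU _ (GB t)).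
    apply: (ivt 0 t t0); by rewrite ge_min le_max (ltW gt0) It orbT.
  have [b Gb [bx|bp]] := real_pts t It; first by exists t; rewrite Gb (all_x0 t b).
  have bp' : `|- b - p0| < dl by rewrite -opprD normrN.
  have Gb' : G t = (- - b)%:C by rewrite opprK.
  have [X1 X2 _ _] := step_down t (- b) bp' Gb'.
  by exists (t + Td (- b)); rewrite X1 (all_x0 _ _ X2 X1).
have fol s r : G s = x0%:C -> 0 <= r <= T0 -> G (s + r) = g0 r.
  move=> Gs /andP[r0 rT]; have fu := follow_up GF GB' (arcB _ _ _ _ _ zuA) upx Gs.
  rewrite /g0 /loop; have [rT1|rT1] := leP r (Tu x0); first by rewrite fu ?r0.
  have [_ [_ zT] _ _ _] := zuA.
  have G1 : G (s + Tu x0) = (- p0)%:C by rewrite fu ?zT ?lexx ?ltW.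
  rewrite -(follow_down GF GB' (arcB _ _ _ _ _ zdA) dnp G1); first by congr G; ring.
  by rewrite subr_ge0 (ltW rT1) lerBlDl.
have g0T : g0 T0 = x0%:C by have [_ []] := loop_filippov zuA zdA.
have [s Gs] := start.
have inGam n s' t : G s' = x0%:C -> s' <= t -> t <= s' + n%:R * T0 -> Gam (G t).
  elim: n s' => [|n IH] s' Gs' st tn.
    have -> : t = s' by apply/eqP; rewrite eq_le st andbT; move: tn; rewrite mul0r addr0.
    exists 0; rewrite /= ?in_itv /= ?lexx ?(ltW T00)//.
    by rewrite -(fol s') ?addr0// lexx ltW.
  have [h|h] := leP t (s' + T0).
    exists (t - s'); first by rewrite /= in_itv /= subr_ge0 st lerBlDl.
    rewrite -(fol s')//; first by congr G; ring.
    by rewrite subr_ge0 st lerBlDl.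
  apply: (IH (s' + T0)).
  - by rewrite fol ?lexx ?ltW.
  - exact: ltW.
  - by move: tn; rewrite mulrS mulrDl mul1r addrA.
have GTn n t : G (t + n%:R * T) = G t.
  by elim: n => [|n IH]; rewrite ?mul0r ?addr0// mulrS mulrDl mul1r [T + _]addrC addrA GT.
(* To place [G t] on the cycle, [t] is moved by periods of the orbit to a time after [s], and the
   turns of length [T0] made since [s] are counted. *)
apply/seteqP; split=> [z|z [r]].
  rewrite HE => -[t /=]; rewrite in_itv /= => tT <-; rewrite -Gg//.
  pose k := Num.bound `|(s - t) / T|.
  have kP : (s - t) / T < k%:R by rewrite (le_lt_trans (ler_norm _))// archi_boundP.
  rewrite -(GTn k t); pose t' := t + k%:R * T.
  have st' : s <= t' by move: kP; rewrite ltr_pdivrMr// /t'; lra.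
  pose n := Num.bound `|(t' - s) / T0|.
  have nP : (t' - s) / T0 < n%:R by rewrite (le_lt_trans (ler_norm _))// archi_boundP.
  apply: (inGam n s) => //; rewrite -/t'; move: nP; rewrite ltr_pdivrMr//; lra.
rewrite /= in_itv /= => rT <-; rewrite -(fol s)//.
Qed.
Lemma cycle_real (w : C) : Gam w -> Im w = 0 -> w = x0%:C \/ w = (- p0)%:C.
Proof.
move=> [t]; rewrite /= in_itv /= => /andP[t0 tT] <-.
have [_ [g00 g0u g0T] up dn _] := loop_filippov zuA zdA; rewrite -/g0 -/T0 in g00 g0u g0T up dn *.
have [<-|t_neq0] := eqVneq 0 t; first by left.
have t_gt0 : 0 < t by rewrite lt_def t0 eq_sym t_neq0.
have [tu|tu|->] := ltgtP t (Tu x0); last by right.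
  by have := up t; rewrite t_gt0 tu => /(_ isT) I E; move: I; rewrite E ltxx.
have [<-|tne] := eqVneq T0 t; first by left.
by have := dn t; rewrite tu lt_def tne tT => /(_ isT) I E; move: I; rewrite E ltxx.
Qed.

Lemma cycle_norm (w : C) : Gam w -> normc w <= B.
Proof.
move=> [t]; rewrite /= in_itv /= => tT <-.
by have [_ _ _ _] := loop_filippov zuA zdA; apply.
Qed.

Lemma cycle_periodic : periodic_solution S T0 g0.
Proof.
have [sol [g00 g0u g0T] up dn _] := loop_filippov zuA zdA; rewrite -/g0 -/T0 in sol g00 g0u g0T up dn.
split=> //; first by rewrite g00 g0T.
have inju : forall s t, 0 <= s <= Tu x0 -> 0 <= t <= Tu x0 -> zu s = zu t -> s = t.
  apply: (arc_injective zuA (c := c) _ m0) => [|t tT].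
    by rewrite gt_eqF// (lt_trans _ x00)// oppr_lt0.
  have [_ _ _ zI zB] := zuA; apply: rotU; last exact: zI.
  by apply: le_lt_trans BB1; apply: zB; case/andP: tT => /ltW -> /ltW ->.
have injd : forall s t, 0 <= s <= Td p0 -> 0 <= t <= Td p0 -> zd s = zd t -> s = t.
  apply: (arc_injective zdA (c := 0) _ m0) => [|t tT].
    by rewrite gt_eqF// (lt_trans _ p00)// oppr_lt0.
  have [_ _ _ zI zB] := zdA; apply: rotD; last exact: zI.
  by apply: le_lt_trans BB1; apply: zB; case/andP: tT => /ltW -> /ltW ->.
have low s t : 0 <= s -> s <= Tu x0 -> Tu x0 < t -> t < T0 -> g0 s <> g0 t.
  move=> s0 su tu tT E; have := dn t; rewrite tu tT -E => /(_ isT).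
  have [s00|sn] := eqVneq 0 s; first by rewrite -s00 g00 Im_real ltxx.
  have [su0|sun] := eqVneq (Tu x0) s; first by rewrite -su0 g0u Im_real ltxx.
  have := up s; rewrite !lt_def s0 su eq_sym sn sun => /(_ isT); lra.
move=> s t; rewrite !in_itv /= => /andP[s0 sT] /andP[t0 tT] E.
have [su|su] := leP s (Tu x0); have [tu|tu] := leP t (Tu x0).
- by move: E; rewrite /g0 /loop su tu; apply: inju; rewrite ?s0 ?t0.
- by case: (low s t).
- by case: (low t s).
- move: E; rewrite /g0 /loop !leNgt su tu /= => /oppr_inj/injd.
  rewrite !subr_ge0 !lerBlDl !ltW// => /(_ isT isT); lra.
Qed.

Lemma cycle_hyperbolic : hyperbolic_limit_cycle S Gam.
Proof.
have per := cycle_periodic.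
have [sol [g00 g0u g0T] _ _ _] := loop_filippov zuA zdA; rewrite -/g0 -/T0 in sol g00 g0u g0T.
split; first by split; [exists T0, g0|exact: cycle_isolated].
(* The section is the real axis at [x0]: both fields point upward there, so no convex combination of
   them is parallel to it. *)
exists T0, g0, 1, (fun s => Q (x0 + s) - x0), (fun s => Tu (x0 + s) + Td (Y (x0 + s))), (X' * Y').
have cx : {for 0, continuous (fun s : R => x0 + s)}.
  by apply: cvgD; [exact: cvg_cst|exact: cvg_id].
have cY : {for x0, continuous Y} := is_derive_continuous dY.
have cYx : {for 0, continuous (fun s : R => Y (x0 + s))}.
  by apply: (@continuous_comp _ _ _ (fun s : R => x0 + s) Y 0 cx); rewrite addr0.
split.
- by split.
- move=> z Gz Iz; rewrite /crossing_point; have [->|->] := cycle_real Gz Iz.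
    by rewrite mulr_gt0; case: upx.
  by have [u v] := dnp; rewrite nmulr_rgt0.
- rewrite g00 => w /filippov_convex[l /andP[l0 l1] ->]; rewrite conjc1 mul1r gt_eqF//.
  rewrite Im_add ![_%:C * _]mulrC !Im_mulRr; have [u v] := upx.
  by nra.
- split.
  + by rewrite addr0 /Q Yx0 Xp0 subrr.
  + by rewrite addr0 Yx0.
  + apply: cvgD.
      by apply: (@continuous_comp _ _ _ (fun s : R => x0 + s) Tu 0 cx); rewrite addr0.
    apply: (@continuous_comp _ _ _ (fun s : R => Y (x0 + s)) Td 0 cYx).
    by rewrite addr0 Yx0.
  have [k k0 Hk] := (continuous_epsP _ _).1 cYx _ d0.
  apply/nbhs_ballP; exists (Num.min k d) => [|s]; first by rewrite /= lt_min k0.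
  rewrite /ball /= sub0r normrN lt_min => /andP[sk sd].
  have := Hk s; rewrite subr0 addr0 Yx0 => /(_ sk) Ys.
  have xs : `|x0 + s - x0| < d by rewrite addrAC subrr add0r.
  have [_ [z1 a1]] := HU xs; have [_ [z2 a2]] := HD Ys.
  have [sol' [h1 _ h2] _ _ _] := loop_filippov a1 a2.
  split; first by rewrite addr_gt0//; [case: a1|case: a2].
  exists (loop (Tu (x0 + s)) z1 z2); split=> //.
    by rewrite h1 g00 mulr1 rmorphD.
  by rewrite h2 g00 mulr1 rmorphB [RHS]addrC subrK.
- split=> //.
  have dx : is_derive (0 : R) (1 : R) (fun s : R => x0 + s) 1.
    by have := is_deriveD (is_derive_cst x0 (0 : R) (1 : R)) (is_derive_id (0 : R) (1 : R)); rewrite add0r.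
  have dQ : is_derive ((fun s : R => x0 + s) 0) (1 : R) Q (X' * Y').
    by rewrite addr0; exact: return_derive.
  have := is_deriveB (@is_derive1_comp R Q (fun s : R => x0 + s) 0 _ _ dQ dx)
     (is_derive_cst x0 (0 : R) (1 : R)).
  by move=> H; apply: (is_derive_ext H) => //; rewrite mulr1 subr0.
Qed.

End Cycle.

(** * Regular values and half-return maps *)

Section RegularValues.
Variable R : realType.
Implicit Types (f df : R -> R).

Definition c1_on f df (u v : R) := forall x, u <= x <= v ->
  is_derive x (1 : R) f (df x) /\ {for x, continuous df}.

(** Take the last [p] with [f p <= c1] and the first [q] after it with [c2 <= f q]. Between them [f]
    has values in []c1, c2[], and the mean value theorem on [[p, q]] provides a positive
    derivative. *)
Lemma steep_point f df (u v c1 c2 : R) : u < v -> c1_on f df u v ->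
  f u <= c1 -> c1 < c2 -> c2 <= f v ->
  exists x, [/\ u < x < v, c1 < f x < c2 & 0 < df x].
Proof.
move=> uv fC1 fu c12 fv.
have fc x : u <= x <= v -> {for x, continuous f} by move=> /fC1[/is_derive_continuous].
pose E1 := [set x | u <= x <= v /\ f x <= c1].
have E1u : E1 u by split; rewrite ?lexx ?(ltW uv).
have hE1 : has_sup E1 by split; [exists u|exists v => x [/andP[]]].
set p := sup E1.
have up : u <= p by apply: (sup_upper_bound hE1).
have pv : p <= v by apply: ge_sup; [exists u|move=> x [/andP[]]].
have fp : f p <= c1.
  rewrite leNgt; apply/negP => h; have cp : 0 < f p - c1 by rewrite subr_gt0.
  have [k k0 Hk] := (continuous_epsP _ _).1 (fc p (introT andP (conj up pv))) _ cp.
  have [x [xuv fx] px] := sup_adherent k0 hE1.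
  have xp : x <= p by apply: (sup_upper_bound hE1).
  have := Hk x; rewrite ler0_norm ?subr_le0// opprB -/p in px *; rewrite ltr_norml.
  have xk : p - x < k by move: px; rewrite -/p; lra.
  by move=> /(_ xk); lra.
have above x : p < x -> x <= v -> c1 < f x.
  move=> px xv; rewrite ltNge; apply/negP => fx.
  have : x <= p by apply: (sup_upper_bound hE1); split; rewrite ?xv ?(le_trans up (ltW px)).
  by rewrite leNgt px.
pose E2 := [set x | p <= x <= v /\ c2 <= f x].
have E2v : E2 v by split; rewrite ?lexx ?pv.
have hE2 : has_inf E2 by split; [exists v|exists p => x [/andP[]]].
set q := inf E2.
have qv : q <= v by apply: (ge_inf hE2.2).
have pq : p <= q by apply: lb_le_inf; [exists v|move=> x [/andP[]]].
have fq : c2 <= f q.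
  rewrite leNgt; apply/negP => h; have cp : 0 < c2 - f q by rewrite subr_gt0.
  have [k k0 Hk] := (continuous_epsP _ _).1 (fc q (introT andP (conj (le_trans up pq) qv))) _ cp.
  have [x [xuv fx] px] := inf_adherent k0 hE2.
  have xp : q <= x by apply: (ge_inf hE2.2).
  have := Hk x; rewrite ger0_norm ?subr_ge0// ltr_norml.
  have xk : x - q < k by move: px; rewrite -/q; lra.
  by move=> /(_ xk); lra.
have below x : p <= x -> x < q -> f x < c2.
  move=> px xq; rewrite ltNge; apply/negP => fx.
  have : q <= x by apply: (ge_inf hE2.2); split; rewrite ?px ?(le_trans (ltW xq) qv).
  by rewrite leNgt xq.
have pq' : p < q.
  by rewrite lt_neqAle pq andbT; apply: contraTneq fq => <-; rewrite -ltNge; lra.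
have [x /andP[px xq] E] : exists2 x, p < x < q & f q - f p = df x * (q - p).
  apply: mean_value => // x /andP[px xq]; apply: (fC1 x _).1.
  by rewrite (le_trans up px) (le_trans xq qv).
exists x; split.
- by rewrite (le_lt_trans up px) (lt_le_trans xq qv).
- by rewrite above ?below ?(ltW px)// (le_trans (ltW xq) qv).
- by rewrite -(@pmulr_lgt0 _ (q - p)) ?subr_gt0// -E; lra.
Qed.

Definition regular_hit f df (u v c : R) := exists x, [/\ u < x < v, f x = c & df x != 0].

(** Since [df] is continuous, [f] increases strictly around a steep point, so every value in some
    interval is taken there with nonzero derivative. *)
Lemma regular_values_up f df (u v c1 c2 : R) : u < v -> c1_on f df u v ->
  f u <= c1 -> c1 < c2 -> c2 <= f v ->
  exists c1' c2', [/\ c1 <= c1', c1' < c2', c2' <= c2 &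
    forall c, c1' < c < c2' -> regular_hit f df u v c].
Proof.
move=> uv fC1 fu c12 fv; have [x [/andP[ux xv] /andP[x1 x2] dx]] := steep_point uv fC1 fu c12 fv.
have xuv : u <= x <= v by rewrite !ltW.
have [fx cdx] := fC1 x xuv.
have [k k0 Hk] := (continuous_epsP _ _).1 cdx _ dx.
have m0 : 0 < Num.min (f x - c1) (c2 - f x) by rewrite lt_min !subr_gt0 x1.
have [l l0 Hl] := (continuous_epsP _ _).1 (is_derive_continuous fx) _ m0.
pose h := Num.min (Num.min k l) (Num.min (x - u) (v - x)) / 2.
have h0 : 0 < h by rewrite divr_gt0// !lt_min k0 l0 !subr_gt0 ux.
have h2 : h + h = Num.min (Num.min k l) (Num.min (x - u) (v - x)) by rewrite /h; lra.
have [hk hl hu hv] : [/\ h + h <= k, h + h <= l, h + h <= x - u & h + h <= v - x].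
  by rewrite h2; split; rewrite !ge_min lexx ?orbT.
clearbody h.
have dpos t : x - h <= t <= x + h -> 0 < df t.
  move=> /andP[t1 t2]; have tk : `|t - x| < k by rewrite ltr_norml; apply/andP; split; lra.
  by have := Hk t tk; rewrite ltr_norml; lra.
have duv t : x - h <= t <= x + h -> u < t < v.
  by move=> /andP[t1 t2]; apply/andP; split; lra.
have duv' t : x - h <= t <= x + h -> u <= t <= v.
  by move=> /duv/andP[/ltW -> /ltW ->].
have hh : x - h < x + h by lra.
have inc : f (x - h) < f (x + h).
  apply: (derive_pos_lt (df := df)) => // t; first by move=> /duv'/fC1[].
  by move=> /andP[/ltW t1 /ltW t2]; apply: dpos; rewrite t1.
exists (f (x - h)), (f (x + h)).
have n1 : `|x - h - x| < l by rewrite addrAC subrr add0r normrN gtr0_norm//; lra.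
have n2 : `|x + h - x| < l by rewrite addrAC subrr add0r gtr0_norm//; lra.
have := Hl _ n1; have := Hl _ n2; rewrite !lt_min => /andP[b1 b2] /andP[b3 b4].
rewrite !ltr_norml in b1 b2 b3 b4; split=> //; [lra|lra|].
move=> c /andP[cl cr].
have cw : {within `[x - h, x + h], continuous f}.
  by apply: continuous_within => t /duv'/fC1[/is_derive_continuous].
have [|y] := IVT (v := c) (ltW hh) cw; first by rewrite ge_min le_max (ltW cl) (ltW cr) orbT.
by rewrite in_itv /= => /[dup]/duv yuv /dpos dy fy; exists y; rewrite gt_eqF.
Qed.

Lemma c1_onN f df u v : c1_on f df u v -> c1_on (fun x => - f x) (fun x => - df x) u v.
Proof.
move=> H x /H[d1 d2]; split; first exact: is_deriveN.
exact: cvgN.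
Qed.

Lemma regular_values f df (u v c1 c2 : R) : u < v -> c1_on f df u v -> c1 < c2 ->
  (f u <= c1 /\ c2 <= f v) \/ (f v <= c1 /\ c2 <= f u) ->
  exists c1' c2', [/\ c1 <= c1', c1' < c2', c2' <= c2 &
    forall c, c1' < c < c2' -> regular_hit f df u v c].
Proof.
move=> uv fC1 c12 [[fu fv]|[fv fu]]; first exact: regular_values_up.
have [||||d1 [d2 [h1 h2 h3 h4]]] := @regular_values_up (fun x => - f x) (fun x => - df x) u v (- c2) (- c1) uv.
- exact: c1_onN.
- by rewrite lerN2.
- by rewrite ltrN2.
- by rewrite lerN2.
exists (- d2), (- d1); split; [lra|lra|lra|].
move=> c /andP[e1 e2]; have [|x [xuv fx dx]] := h4 (- c); first by apply/andP; split; lra.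
by exists x; split=> //; [exact: oppr_inj|rewrite -oppr_eq0].
Qed.

(* Instead of Sard's theorem: an interval of values is shrunk once per sign change. *)
Lemma common_regular_value f df (k : nat) (q : nat -> R) (c0 eps : R) : 0 < eps ->
  (forall i, (i < k)%N -> q i < q i.+1) ->
  (forall i, (i < k)%N -> c1_on f df (q i) (q i.+1)) ->
  (forall i, (i < k)%N -> (f (q i) - c0) * (f (q i.+1) - c0) < 0) ->
  exists2 c, `|c - c0| < eps & forall i, (i < k)%N -> regular_hit f df (q i) (q i.+1) c.
Proof.
move=> eps0 qinc fC1 alt.
(* The second conjunct, that the values from [c1] to [c2] lie between the end values on every
   interval, survives shrinking and lets the next interval be treated. *)
have ind n : (n <= k)%N -> exists c1 c2, [/\ c0 - eps < c1, c1 < c2, c2 < c0 + eps,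
    True & forall c, c1 < c < c2 -> forall i, (i < n)%N ->
      regular_hit f df (q i) (q i.+1) c] /\
    forall i, (i < k)%N -> (f (q i) <= c1 /\ c2 <= f (q i.+1)) \/ (f (q i.+1) <= c1 /\ c2 <= f (q i)).
  elim: n => [_|n IH nk].
    have [eta [eta0 etae Heta]] : exists eta, [/\ 0 < eta, eta < eps & forall i, (i < k)%N ->
        (f (q i) <= c0 - eta /\ c0 + eta <= f (q i.+1)) \/
        (f (q i.+1) <= c0 - eta /\ c0 + eta <= f (q i))].
      have : (k <= k)%N by [].
      elim: {-2}k => [_|m IHm mk].
        by exists (eps / 2); split=> //; [rewrite divr_gt0|lra].
      have [eta [eta0 etae Heta]] := IHm (ltnW mk).
      have := alt m mk; set A := f (q m) - c0; set B := f (q m.+1) - c0 => AB.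
      exists (Num.min eta (Num.min `|A| `|B|)).
      have An : A != 0 by apply: contraTneq AB => ->; rewrite mul0r ltxx.
      have Bn : B != 0 by apply: contraTneq AB => ->; rewrite mulr0 ltxx.
      have m1 : Num.min eta (Num.min `|A| `|B|) <= eta by rewrite ge_min lexx.
      have m2 : Num.min eta (Num.min `|A| `|B|) <= `|A| by rewrite !ge_min lexx orbT.
      have m3 : Num.min eta (Num.min `|A| `|B|) <= `|B| by rewrite !ge_min lexx !orbT.
      split; first by rewrite !lt_min eta0 !normr_gt0 An.
        exact: le_lt_trans etae.
      move=> i; rewrite ltnS leq_eqVlt => /predU1P[->|im].
        have [A0|A0] := ltP A 0.
          have B0 : 0 < B by nra.
          by left; move: m2 m3; rewrite (ltr0_norm A0) (gtr0_norm B0) /A /B; split; lra.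
        have {}A0 : 0 < A by rewrite lt_def An.
        have B0 : B < 0 by nra.
        by right; move: m2 m3; rewrite (gtr0_norm A0) (ltr0_norm B0) /A /B; split; lra.
      by case: (Heta i im) => -[h1 h2]; [left|right]; split; lra.
    by exists (c0 - eta), (c0 + eta); split; [split=> //; lra|].
  have [c1 [c2 [[h1 h2 h3 _ h4] h5]]] := IH (ltnW nk).
  have [d1 [d2 [e1 e2 e3 e4]]] := regular_values (qinc n nk) (fC1 n nk) h2 (h5 n nk).
  exists d1, d2; split.
    split=> //; [lra|lra|].
    move=> c /andP[cd1 cd2] i; rewrite ltnS leq_eqVlt => /predU1P[->|im].
      by apply: e4; rewrite cd1.
    by apply: h4 => //; apply/andP; split; lra.
  by move=> i /h5[] [g1 g2]; [left|right]; split; lra.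
have [c1 [c2 [[h1 h2 h3 _ h4] _]]] := ind k (leqnn k).
exists ((c1 + c2) / 2); first by rewrite ltr_norml; apply/andP; split; lra.
by apply: h4; apply/andP; split; lra.
Qed.

End RegularValues.

Section ImplicitDerivative.
Variable R : realType.

(** Strict monotonicity of [al] makes [y] continuous at [x0]; the quotient of the derivatives then
    comes out as in [cderiv_inverse]. *)
Lemma implicit_derive (al be y : R -> R) (x0 lo hi da db k : R) : 0 < k ->
  (forall x, `|x - x0| < k -> lo < y x < hi /\ al (y x) = be x) ->
  (forall u v, lo < u -> u < v -> v < hi -> al v < al u) ->
  is_derive x0 (1 : R) be db -> is_derive (y x0) (1 : R) al da -> da != 0 ->
  is_derive x0 (1 : R) y (db / da).
Proof.
move=> k0 H decr dbe dal da0.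
have x0k : `|x0 - x0| < k by rewrite subrr normr0.
have [/andP[lo0 hi0] E0] := H x0 x0k.
have cy : forall e, 0 < e -> exists2 l, 0 < l & forall x, `|x - x0| < l -> `|y x - y x0| < e.
  move=> e e0; pose eta := Num.min e (Num.min (y x0 - lo) (hi - y x0)) / 2.
  have eta0 : 0 < eta by rewrite divr_gt0// !lt_min e0 !subr_gt0 lo0.
  have eta2 : eta + eta = Num.min e (Num.min (y x0 - lo) (hi - y x0)) by rewrite /eta; lra.
  have [h1 h2 h3] : [/\ eta + eta <= e, eta + eta <= y x0 - lo & eta + eta <= hi - y x0].
    by rewrite eta2; split; rewrite !ge_min lexx ?orbT.
  clearbody eta.
  have a1 : al (y x0 + eta) < al (y x0) by apply: decr; lra.
  have a2 : al (y x0) < al (y x0 - eta) by apply: decr; lra.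
  have m0 : 0 < Num.min (al (y x0) - al (y x0 + eta)) (al (y x0 - eta) - al (y x0)).
    by rewrite lt_min !subr_gt0 a1.
  have [l l0 Hl] := (continuous_epsP _ _).1 (is_derive_continuous dbe) _ m0.
  exists (Num.min k l) => [|x]; first by rewrite lt_min k0.
  rewrite lt_min => /andP[/H[/andP[y1 y2] yE] /Hl]; rewrite -yE -E0 lt_min !ltr_norml.
  move=> /andP[/andP[b1 b2] /andP[b3 b4]].
  have c1 : y x0 - eta < y x.
    rewrite ltNge; apply/negP; rewrite le_eqVlt => /predU1P[yy|yy].
      by rewrite yy in b4; lra.
    have := decr _ _ y1 yy; have : y x0 - eta < hi by lra.
    by move=> hh /(_ hh); lra.
  have c2 : y x < y x0 + eta.
    rewrite ltNge; apply/negP; rewrite le_eqVlt => /predU1P[yy|yy].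
      by rewrite -yy in b1; lra.
    have := decr (y x0 + eta) (y x); have : lo < y x0 + eta by lra.
    by move=> hh /(_ hh yy y2); lra.
  by apply/andP; split; lra.
apply/is_derive_epsP => e e0.
have nd : 0 < `|da| by rewrite normr_gt0.
set Bd := `|db| + 1; have B0 : 0 < Bd by rewrite /Bd ltr_wpDl.
set e1 := Num.min (`|da| / 2) (e * `|da| ^+ 2 / (4 * Bd)).
have e10 : 0 < e1 by rewrite /e1 lt_min !divr_gt0 ?mulr_gt0 ?exprn_gt0.
have e20 : 0 < Num.min 1 (e * `|da| / 2) by rewrite lt_min ltr01 divr_gt0 ?mulr_gt0.
have [ka ka0 Ha] := (is_derive_epsP _ _ _).1 dal _ e10.
have [l l0 Hl] := cy _ ka0; have [m m0 Hm] := (is_derive_epsP _ _ _).1 dbe _ e20.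
exists (Num.min k (Num.min l m)) => [|x]; first by rewrite !lt_min k0 l0.
rewrite !lt_min => /and3P[/H[_ yE] /Hl/Ha sa /Hm sm]; rewrite yE E0 in sa.
set Z := `|y x - y x0| in sa; set N := `|x - x0| in sm *.
have Z0 : 0 <= Z by exact: normr_ge0.
have N0 : 0 <= N by exact: normr_ge0.
have le11 : e1 <= `|da| / 2 by rewrite /e1 ge_min lexx.
have le12 : e1 <= e * `|da| ^+ 2 / (4 * Bd) by rewrite /e1 ge_min lexx orbT.
have sm1 : `|be x - be x0 - db * (x - x0)| <= N.
  by apply: le_trans sm _; rewrite ler_piMl// ge_min lexx.
have sm2 : `|be x - be x0 - db * (x - x0)| <= e * `|da| / 2 * N.
  by apply: le_trans sm _; rewrite ler_wpM2r// ge_min lexx orbT.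
have sb : `|be x - be x0| <= Bd * N.
  have := ler_normD (be x - be x0 - db * (x - x0)) (db * (x - x0)).
  by rewrite subrK [`|db * _|]normrM -/N /Bd; lra.
have h1 : `|da| * Z <= 2 * (Bd * N).
  have := ler_normB (be x - be x0) (be x - be x0 - da * (y x - y x0)).
  rewrite opprB addrC subrK [`|da * _|]normrM -/Z.
  have : e1 * Z <= `|da| / 2 * Z by rewrite ler_wpM2r.
  lra.
have h2 : `|da * (y x - y x0) - db * (x - x0)| <= e * `|da| * N.
  have -> : da * (y x - y x0) - db * (x - x0) =
    (be x - be x0 - db * (x - x0)) - (be x - be x0 - da * (y x - y x0)) by ring.
  rewrite (le_trans (ler_normB _ _))//.
  have : e1 * Z <= e * `|da| ^+ 2 / (4 * Bd) * Z by rewrite ler_wpM2r.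
  have -> : e * `|da| ^+ 2 / (4 * Bd) * Z = (e * `|da|) / (4 * Bd) * (`|da| * Z).
    by field; rewrite gt_eqF.
  have c0 : 0 <= e * `|da| / (4 * Bd) by rewrite divr_ge0 ?mulr_ge0 ?(ltW e0) ?(ltW B0).
  move=> /le_trans/(_ (ler_wpM2l c0 h1)).
  have -> : e * `|da| / (4 * Bd) * (2 * (Bd * N)) = e * `|da| / 2 * N.
    by field; rewrite gt_eqF.
  by move: sm2 sa; lra.
have -> : y x - y x0 - db / da * (x - x0) = (da * (y x - y x0) - db * (x - x0)) / da by field.
by rewrite normrM normfV ler_pdivrMr// mulrAC.
Qed.
End ImplicitDerivative.

(** * The half-return map of one half plane and its regularity *)

Section HalfMap.
Variable R : realType.
Local Notation C := R[i].
Variables (a b : C) (P : C -> C) (s M A : R).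

Definition arc_bounds := [/\ 1 <= M, 0 <= A, normc a <= M, normc b <= M & `|s| <= A].
Hypothesis bd : arc_bounds.
Hypothesis HP : log_primitive a b P.

Let M1 : 1 <= M. Proof. by case: bd. Qed.
Let A0 : 0 <= A. Proof. by case: bd. Qed.
Let aM : normc a <= M. Proof. by case: bd. Qed.
Let bM : normc b <= M. Proof. by case: bd. Qed.
Let sA : `|s| <= A. Proof. by case: bd. Qed.
Let rho := arc_radius M A.
Let E := arc_growth A.
Let rng := arc_range M A.
Let rho0 : 0 < rho. Proof. exact: arc_radius_gt0. Qed.
Let E0 : 0 < E. Proof. exact: expR_gt0. Qed.

Lemma arc_growth_ge1 : 1 <= E.
Proof. by rewrite -expR0 ler_expR mulr_ge0// addr_ge0// pi_ge0. Qed.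

Lemma arc_rangeE : rng * (16 * E) = rho.
Proof. by rewrite /rng /arc_range divfK// gt_eqF// mulr_gt0. Qed.

Lemma arc_range_gt0 : 0 < rng.
Proof. by rewrite divr_gt0// mulr_gt0. Qed.

Lemma arc_range_le : rng <= rho / 16.
Proof. by have := arc_rangeE; have := arc_growth_ge1; have := arc_range_gt0; nra. Qed.

Lemma arc_coef_continuous (x : R) : `|x| <= rho ->
  {for x, continuous (fun x : R => Re (- (a + b * x%:C) / (1 + a * x%:C + b * x%:C ^+ 2)))} /\
  {for x, continuous (fun x : R => Im (- (a + b * x%:C) / (1 + a * x%:C + b * x%:C ^+ 2)))}.
Proof.
move=> xr; have nx : normc x%:C <= rho by rewrite normc_real.
have Dn := arc_den_neq0 M1 A0 aM bM nx.
have dlin (u v z : C) : cderiv (fun z => u + v * z) z v.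
  by have := cderivD (cderiv_cst u z) (cderivM (cderiv_cst v z) (cderiv_id z));
     rewrite mul0r !add0r mulr1.
have dn : cderiv (fun z => - a + - b * z) x%:C (- b) by exact: dlin.
have dd : cderiv (fun z => 1 + (a + b * z) * z) x%:C (0 + (b * x%:C + (a + b * x%:C) * 1)).
  exact: cderivD (cderiv_cst _ _) (cderivM (dlin a b _) (cderiv_id _)).
have De : 1 + (a + b * x%:C) * x%:C = 1 + a * x%:C + b * x%:C ^+ 2 by ring.
have D' : 1 + (a + b * x%:C) * x%:C != 0 by rewrite De.
have fE (z : C) : (- a + - b * z) * (1 + (a + b * z) * z)^-1 = - (a + b * z) / (1 + a * z + b * z ^+ 2).
  by congr (_ / _); ring.
have := cderivM dn (cderiv_comp dd (cderiv_inv D')).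
move=> /(cderiv_local ltr01 (fun w _ => fE w))/vderiv_of_cderiv[h1 h2].
by split; [exact: is_derive_continuous h1|exact: is_derive_continuous h2].
Qed.

Lemma arc_dphase_continuous (x : R) : x != 0 -> `|x| <= rho ->
  {for x, continuous (arc_dphase a b s)}.
Proof.
move=> x0 /arc_coef_continuous[cr ci].
apply: cvgB; first exact: cvgV x0 (@cvg_id _ _).
by apply: cvgB; [apply: cvgM; [exact: cvg_cst|exact: ci]|exact: cr].
Qed.

Definition half_map_at (y : R -> R) (x : R) :=
  [/\ - rho / 4 <= y x < 0, `|y x| <= 4 * E * x,
      arc_phase P s (y x) = arc_phase P s x + s * pi &
      half_arc (arc_field a b s) x (y x) (arc_period P s x (y x)) (4 * E * x)].

Lemma half_map_exists : exists y, forall x, 0 < x <= rng -> half_map_at y x.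
Proof.
have /choice[y Hy] : forall x, exists v, 0 < x <= rng -> half_map_at (fun=> v) x.
  move=> x; have [xr|_] := boolP (0 < x <= rng); last by exists 0.
  have [v [/andP[v1 v2] v3 v4 v5]] := arc_map M1 A0 aM bM sA HP xr.
  exists v => _; split=> //; rewrite v2 andbT.
  case/andP: xr => x0 xr; move: v3; rewrite ltr0_norm// -/E => v3.
  by have := arc_rangeE; have := E0; nra.
by exists y => x /Hy.
Qed.

Variable y : R -> R.
Hypothesis Hy : forall x, 0 < x <= rng -> half_map_at y x.

Lemma half_map_unique x v : 0 < x <= rng -> - rho <= v < 0 ->
  arc_phase P s v = arc_phase P s x + s * pi -> y x = v.
Proof.
move=> /Hy[/andP[y1 y2] _ yE _] vr vE.
apply: (arc_phase_inj M1 A0 aM bM sA HP) => //; last by rewrite yE vE.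
by rewrite y2 andbT -/rho; lra.
Qed.

Lemma half_map_derive x : 0 < x < rng ->
  is_derive x (1 : R) y (arc_dphase a b s x / arc_dphase a b s (y x)).
Proof.
move=> /andP[x0 xr]; have xr' : 0 < x <= rng by rewrite x0 ltW.
have [/andP[y1 y2] _ yE _] := Hy xr'.
have k0 : 0 < Num.min x (rng - x) by rewrite lt_min x0 subr_gt0.
have xrho : `|x| <= rho by rewrite gtr0_norm//; have := arc_range_le; lra.
have yrho : `|y x| <= rho by rewrite ltr0_norm//; lra.
apply: (implicit_derive (al := arc_phase P s) (be := fun x => arc_phase P s x + s * pi)
  (lo := - rho) (hi := 0) k0).
- move=> u; rewrite lt_min !ltr_norml => /andP[/andP[u1 u2] /andP[u3 u4]].
  have [|/andP[v1 v2] _ vE _] := Hy (x := u); first by apply/andP; split; lra.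
  by split=> //; apply/andP; split=> //; lra.
- move=> u v u1 uv v0; apply: (arc_phase_decr M1 A0 aM bM sA HP) => //; exact: ltW.
- have dA := is_derive_arc_phase s M1 A0 aM bM HP (lt0r_neq0 x0) xrho.
  by have := is_deriveD dA (is_derive_cst (s * pi) x (1 : R)); rewrite addr0.
- exact: (is_derive_arc_phase s M1 A0 aM bM HP (ltr0_neq0 y2) yrho).
- apply: ltr0_neq0; apply: (arc_dphase_lt0 M1 A0 aM bM sA); rewrite y2 andbT -/rho; lra.
Qed.

Lemma half_map_slope x : 0 < x < rng -> arc_dphase a b s x / arc_dphase a b s (y x) < 0.
Proof.
move=> /andP[x0 xr]; have xr' : 0 < x <= rng by rewrite x0 ltW.
have [/andP[y1 y2] _ _ _] := Hy xr'.
have h1 : 0 < arc_dphase a b s x.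
  by apply: (arc_dphase_gt0 M1 A0 aM bM sA); rewrite x0 -/rho; have := arc_range_le; lra.
have h2 : arc_dphase a b s (y x) < 0.
  by apply: (arc_dphase_lt0 M1 A0 aM bM sA); rewrite y2 andbT -/rho; lra.
by rewrite pmulr_rlt0// invr_lt0.
Qed.

Lemma half_map_slope_continuous x : 0 < x < rng ->
  {for x, continuous (fun x => arc_dphase a b s x / arc_dphase a b s (y x))}.
Proof.
move=> xin; have /andP[x0 xr] := xin; have xr' : 0 < x <= rng by rewrite x0 ltW.
have [/andP[y1 y2] _ _ _] := Hy xr'.
have xrho : `|x| <= rho by rewrite gtr0_norm//; have := arc_range_le; lra.
have yrho : `|y x| <= rho by rewrite ltr0_norm//; lra.
have h2 : arc_dphase a b s (y x) < 0.
  by apply: (arc_dphase_lt0 M1 A0 aM bM sA); rewrite y2 andbT -/rho; lra.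
apply: cvgM; first exact: arc_dphase_continuous (lt0r_neq0 x0) xrho.
apply: cvgV; first exact: ltr0_neq0.
apply: (@continuous_comp _ _ _ y (arc_dphase a b s) x).
  exact: is_derive_continuous (half_map_derive xin).
exact: arc_dphase_continuous (ltr0_neq0 y2) yrho.
Qed.

Lemma half_map_period_continuous x : 0 < x < rng ->
  {for x, continuous (fun x => arc_period P s x (y x))}.
Proof.
move=> xin; have /andP[x0 xr] := xin; have xr' : 0 < x <= rng by rewrite x0 ltW.
have [/andP[y1 y2] _ _ _] := Hy xr'.
have xrho : normc x%:C <= rho by rewrite normc_real gtr0_norm//; have := arc_range_le; lra.
have yrho : normc (y x)%:C <= rho by rewrite normc_real ltr0_norm//; lra.
have cy := is_derive_continuous (half_map_derive xin).
have [pr pi'] := vderiv_of_cderiv (dP M1 A0 aM bM HP xrho).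
have [qr qi] := vderiv_of_cderiv (dP M1 A0 aM bM HP yrho).
have cqr := @continuous_comp _ _ _ y (fun v : R => Re (P v%:C)) x cy (is_derive_continuous qr).
have cqi := @continuous_comp _ _ _ y (fun v : R => Im (P v%:C)) x cy (is_derive_continuous qi).
apply: cvgD; [apply: cvgD; [exact: cvg_cst|]|].
  apply: cvgM; [exact: cvg_cst|apply: cvgD].
    apply: (@continuous_comp _ _ _ (fun u => - y u / u) (@ln R) x).
      apply: cvgM; [exact: cvgN cy|exact: cvgV (lt0r_neq0 x0) (@cvg_id _ _)].
    by apply: continuous_ln; rewrite divr_gt0// oppr_gt0.
  by apply: cvgB; [exact: cqr|exact: is_derive_continuous pr].
by apply: cvgB; [exact: cqi|exact: is_derive_continuous pi'].
Qed.

End HalfMap.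

(** * Systems with an explicit centre in each half *)

Section HalfPoly.
Variable R : realType.
Local Notation C := R[i].
Implicit Types (a b z : C) (s t : R).

(* The translate by [t] of [lam (z + a z^2 + b z^3)], where [1 / lam = s - i]. *)
Definition half_poly a b s t : {poly C} :=
  Poly [:: arc_speed s * (- t%:C + a * t%:C ^+ 2 - b * t%:C ^+ 3);
           arc_speed s * (1 - 2 * a * t%:C + 3 * b * t%:C ^+ 2);
           arc_speed s * (a - 3 * b * t%:C); arc_speed s * b].

Lemma horner_half_poly a b s t z : (half_poly a b s t).[z] = arc_field a b s (z - t%:C).
Proof. by rewrite horner_Poly /= /arc_field; ring. Qed.

Lemma arc_speed_neq0 s : arc_speed s != 0.
Proof. by rewrite invr_eq0 eq_complex /= oppr_eq0 oner_eq0 andbF. Qed.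

Lemma size_half_poly3 a b s t : b != 0 -> size (half_poly a b s t) = 4%N.
Proof. by move=> b0; rewrite /half_poly (PolyK (c := 0))//= mulf_neq0// arc_speed_neq0. Qed.

Lemma size_half_poly2 a s t : a != 0 -> size (half_poly a 0 s t) = 3%N.
Proof.
move=> a0; have -> : half_poly a 0 s t = Poly [:: arc_speed s * (- t%:C + a * t%:C ^+ 2);
    arc_speed s * (1 - 2 * a * t%:C); arc_speed s * a].
  apply/polyP => j; rewrite !coef_Poly; case: j => [|[|[|[|j]]]] //=.
  - by congr (_ * _); ring.
  - by congr (_ * _); ring.
  - by congr (_ * _); ring.
  - by rewrite mulr0.
  - by rewrite !nth_nil.
by rewrite (PolyK (c := 0))//= mulf_neq0// arc_speed_neq0.
Qed.

Lemma size_half_poly1 s t : size (half_poly 0 0 s t) = 2%N.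
Proof.
have -> : half_poly 0 0 s t = Poly [:: arc_speed s * (- t%:C); arc_speed s].
  apply/polyP => j; rewrite !coef_Poly; case: j => [|[|[|[|j]]]] //=.
  - by congr (_ * _); ring.
  - by ring.
  - by rewrite mulr0 mul0r subr0 mulr0.
  - by rewrite mulr0.
  - by rewrite !nth_nil.
by rewrite (PolyK (c := 0))//= arc_speed_neq0.
Qed.

Lemma arc_speed_le1 s : normc (arc_speed s) <= 1.
Proof.
rewrite normcV invf_le1; last by rewrite -invr_gt0 -normcV normc_gt0 arc_speed_neq0.
by have := Im_le_normc (s -i* 1); rewrite /= normrN normr1.
Qed.

Lemma arc_speed_lipschitz s s' : normc (arc_speed s - arc_speed s') <= `|s - s'|.
Proof.
have n0 (u : R) : (u -i* 1) != 0 by rewrite -invr_eq0; exact: arc_speed_neq0.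
have -> : arc_speed s - arc_speed s' = arc_speed s * arc_speed s' * (s' - s)%:C.
  have -> : (s' - s)%:C = (s' -i* 1) - (s -i* 1).
    by apply: complexP => //=; rewrite ?subrr// addrC subrr.
  by rewrite /arc_speed; field; rewrite !n0.
rewrite !normcM normc_real distrC ler_piMl//.
by rewrite mulr_ile1 ?normc_ge0 ?arc_speed_le1.
Qed.

Lemma half_poly_close a0 b0 s0 (e : R) : 0 < e -> exists2 k : R, 0 < k & forall a b s t,
  normc (a - a0) < k -> normc (b - b0) < k -> `|s - s0| < k -> `|t| < k ->
  forall j, normc ((half_poly a b s t)`_j - (half_poly a0 b0 s0 0)`_j) < e.
Proof.
move=> e0; set N := normc a0 + normc b0 + 1.
have na := normc_ge0 a0; have nb := normc_ge0 b0.
have N0 : 0 < N by rewrite /N; lra.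
(* Without the speed each coefficient moves by at most [9 N k], and the variation of the speed adds
   [N k]; the extra 2 makes the inequality strict. *)
have eN : 0 < e / (10 * N + 2) by rewrite divr_gt0//; lra.
exists (Num.min 1 (e / (10 * N + 2))) => [|a b s t]; first by rewrite lt_min ltr01.
rewrite !lt_min => /andP[a1 a2] /andP[b1 b2] /andP[s1 s2] /andP[t1 t2].
pose k := e / (10 * N + 2); rewrite -/k in a2 b2 s2 t2 eN.
have kE : k * (10 * N + 2) = e by rewrite /k divfK//; apply: lt0r_neq0; lra.
have aN : normc a <= N by have := normc_le_dist a a0; rewrite /N; lra.
have bN : normc b <= N by have := normc_le_dist b b0; rewrite /N; lra.
have term (c c0 : C) : normc (c - c0) <= k * (9 * N) -> normc c0 <= N ->
    normc (arc_speed s * c - arc_speed s0 * c0) < e.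
  move=> h1 h2.
  have -> : arc_speed s * c - arc_speed s0 * c0 =
    arc_speed s * (c - c0) + (arc_speed s - arc_speed s0) * c0 by ring.
  apply: le_lt_trans (ler_normcD _ _) _; rewrite !normcM.
  have m1 : normc (arc_speed s) * normc (c - c0) <= k * (9 * N).
    by apply: le_trans h1; rewrite ler_piMl ?normc_ge0// arc_speed_le1.
  have m2 : normc (arc_speed s - arc_speed s0) * normc c0 <= k * N.
    by apply: ler_pM; rewrite ?normc_ge0// (le_trans (arc_speed_lipschitz _ _))// ltW.
  by rewrite -kE; have := eN; nra.
have nt : normc t%:C <= k by rewrite normc_real ltW.
have nt1 : normc t%:C <= 1 by rewrite normc_real ltW.
have tm (u : C) (n : nat) : normc u <= N -> normc (u * t%:C ^+ n.+1) <= N * k.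
  move=> uN; rewrite normcM; apply: ler_pM; rewrite ?normc_ge0//.
  rewrite exprS normcM; apply: le_trans nt.
  by rewrite ler_piMr ?normc_ge0// normcX exprn_ile1 ?normc_ge0.
have N1 : 1 <= N by rewrite /N; lra.
have kN0 : 0 <= N * k by rewrite mulr_ge0 ?(ltW N0) ?(ltW eN).
have kN : k <= N * k by rewrite ler_peMl ?(ltW eN).
have -> : half_poly a0 b0 s0 0 = Poly [:: arc_speed s0 * 0; arc_speed s0 * 1;
    arc_speed s0 * a0; arc_speed s0 * b0].
  by rewrite /half_poly rmorph0; congr (Poly [:: _; _; _; _]); ring.
have n3 : normc 3 = 3 :> R.
  by rewrite -[3]/(3%:R) -(rmorph_nat (real_complex R)) normc_real ger0_norm.
have n2 : normc 2 = 2 :> R.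
  by rewrite -[2]/(2%:R) -(rmorph_nat (real_complex R)) normc_real ger0_norm.
move=> j; rewrite !coef_Poly; case: j => [|[|[|[|j]]]] /=.
- apply: term; last by rewrite normc0 ltW.
  rewrite subr0; have := tm a 1%N aN; have := tm b 2%N bN.
  have := ler_normcB (- t%:C + a * t%:C ^+ 2) (b * t%:C ^+ 3).
  have := ler_normcD (- t%:C) (a * t%:C ^+ 2); rewrite normcN; lra.
- apply: term; last by rewrite normc1.
  have -> : 1 - 2 * a * t%:C + 3 * b * t%:C ^+ 2 - 1 = 3 * (b * t%:C ^+ 2) - 2 * (a * t%:C ^+ 1).
    by ring.
  have := tm a 0%N aN; have := tm b 1%N bN.
  have := ler_normcB (3 * (b * t%:C ^+ 2)) (2 * (a * t%:C ^+ 1)).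
  rewrite (normcM 3) (normcM 2) n3 n2; lra.
- apply: term; last by rewrite /N; lra.
  have -> : a - 3 * b * t%:C - a0 = (a - a0) - 3 * (b * t%:C ^+ 1) by ring.
  have := tm b 0%N bN; have := ler_normcB (a - a0) (3 * (b * t%:C ^+ 1)).
  rewrite (normcM 3) n3; lra.
- by apply: term; [lra|rewrite /N; lra].
- by rewrite !nth_nil subrr normc0.
Qed.

End HalfPoly.

Section TwoHalves.
Variable R : realType.
Local Notation C := R[i].

(** The sign of [a'] is changed so that the lower field, in the coordinate [- z], is
    [arc_field a' b' s']. *)
Definition two_halves (a b : C) (s t : R) (a' b' : C) (s' : R) : pwhs R :=
  Pwhs (half_poly a b s t) (half_poly (- a') b' s' 0).

Lemma lower_field_two_halves a b s t a' b' s' z :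
  lower_field (two_halves a b s t a' b' s') z = arc_field a' b' s' z.
Proof. by rewrite /lower_field /= horner_half_poly rmorph0 subr0 /arc_field; ring. Qed.

Lemma upper_field_two_halves a b s t a' b' s' z :
  (Fup (two_halves a b s t a' b' s')).[z] = arc_field a b s (z - t%:C).
Proof. exact: horner_half_poly. Qed.

Lemma half_arc_translate (F : C -> C) (x y T B t : R) : half_arc F x y T B ->
  half_arc (fun z => F (z - t%:C)) (x + t) (y + t) T (B + `|t|).
Proof.
move=> [z [T0 [z0 zT] dz zI zB]]; exists (fun r => z r + t%:C); split=> //.
- by rewrite z0 zT !rmorphD.
- move=> r /dz /vderiv_epsP H; rewrite addrK; apply/vderiv_epsP => e /H[k k0 Hk].
  exists k => // u /Hk; have -> : z u + t%:C - (z r + t%:C) = z u - z r by ring.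
  by [].
- by move=> r /zI; rewrite Im_add Im_real addr0.
- by move=> r /zB h; rewrite (le_trans (ler_normcD _ _))// normc_real lerD2r.
Qed.

Lemma half_arc_ext (F F' : C -> C) (x y T B : R) : F =1 F' -> half_arc F x y T B -> half_arc F' x y T B.
Proof. by move=> /funext ->. Qed.

Lemma half_arc_weaken (F : C -> C) (x y T B B' : R) : B <= B' -> half_arc F x y T B -> half_arc F x y T B'.
Proof.
move=> BB [z [h1 h2 h3 h4 h5]]; exists z; split=> // t /h5 h; exact: le_trans h BB.
Qed.

End TwoHalves.

(** * A simple solution of the closing equation is a hyperbolic limit cycle *)

Section CycleOfZero.
Variable R : realType.
Local Notation C := R[i].
Variables (a b : C) (P : C -> C) (s t : R) (a' b' : C) (P' : C -> C) (s' M A : R).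
Hypothesis bd : arc_bounds a b s M A.
Hypothesis HP : log_primitive a b P.
Hypothesis bd' : arc_bounds a' b' s' M A.
Hypothesis HP' : log_primitive a' b' P'.
Variable y' : R -> R.
Hypothesis Hy' : forall x, 0 < x <= arc_range M A -> half_map_at a' b' P' s' M A y' x.
Let rho := arc_radius M A.
Let E := arc_growth A.
Let rng := arc_range M A.
Let S := two_halves a b s t a' b' s'.

Let E0 : 0 < E. Proof. exact: expR_gt0. Qed.

Lemma half_field_Im (a1 b1 : C) (s1 x : R) : arc_bounds a1 b1 s1 M A -> `|x| <= rho ->
  exists2 c : R, 0 < c & Im (arc_field a1 b1 s1 x%:C) = x * c.
Proof.
move=> [h1 h2 h3 h4 h5] xr; have nx : normc x%:C <= rho by rewrite normc_real.
have := Im_speed_den h1 h2 h3 h4 h5 nx => H.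
exists (Im (arc_speed s1 * (1 + a1 * x%:C + b1 * x%:C ^+ 2))).
  by apply: le_lt_trans H; rewrite divr_ge0// mulr_ge0// addr_ge0// sqr_ge0.
rewrite /arc_field mulrAC Im_mulRr mulrC; congr (_ * _).
Qed.

(** Here [conj z] times the field is [|z|^2 lam (1 + a z + b z^2)], so [Im_speed_den] applies;
    [s1^2 <= A^2] makes the constant common to both halves. *)
Lemma half_field_rotation (a1 b1 : C) (s1 : R) (z : C) : arc_bounds a1 b1 s1 M A ->
  normc z <= rho ->
  1 / (2 * (A ^+ 2 + 1)) * normc z ^+ 2 <= Im (z^* * arc_field a1 b1 s1 z).
Proof.
move=> [h1 h2 h3 h4 h5] zr; have := Im_speed_den h1 h2 h3 h4 h5 zr => H.
have -> : z^* * arc_field a1 b1 s1 z =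
    (arc_speed s1 * (1 + a1 * z + b1 * z ^+ 2)) * (normc z ^+ 2)%:C.
  have -> : (normc z ^+ 2)%:C = z * z^*.
    by rewrite sqr_normcE; apply: complexP; case: (z) => u v /=; ring.
  by rewrite /arc_field; ring.
rewrite Im_mulRr ler_wpM2r ?sqr_ge0//; apply: le_trans (ltW H).
have s2A : s1 ^+ 2 <= A ^+ 2 by rewrite -(real_normK (num_real s1)) lerXn2r// nnegrE.
have p1 : 0 < s1 ^+ 2 + 1 by rewrite ltr_wpDl ?sqr_ge0.
have p2 : 0 < A ^+ 2 + 1 by rewrite ltr_wpDl ?sqr_ge0.
by rewrite !div1r lef_pV2 ?posrE ?mulr_gt0// ler_pM2l// lerD2r.
Qed.

Variables (p0 B B1 : R).
Let x0 := - y' p0.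
Hypothesis p0r : 0 < p0 < rng.
Hypothesis x0r : 0 < x0 - t < rng.
Hypothesis p0t : 0 < p0 + t <= rho.
Hypothesis BB1 : B < B1.
Hypothesis B1r : B1 + `|t| <= rho.
Hypothesis xB : 4 * E * (x0 - t) + `|t| < B.
Hypothesis pB : 4 * E * p0 < B.
Hypothesis closing : arc_phase P s (- p0 - t) = arc_phase P s (x0 - t) + s * pi.
Let dX := - (arc_dphase a' b' s' p0 / arc_dphase a' b' s' (y' p0)).
Hypothesis regular : arc_dphase a b s (x0 - t) * dX + arc_dphase a b s (- p0 - t) != 0.

(** The lower arc from [- p0] ends at [x0]; [closing] says that the upper arc from [x0] comes back
    to [- p0]. The number in [regular] is the derivative of the defect at [p0], and its being
    nonzero excludes the multiplier 1. *)
Lemma cycle_of_zero : exists G : set C, [/\ hyperbolic_limit_cycle S G,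
  forall w, G w -> normc w <= B & (exists2 w, G w & w = (- p0)%:C) /\
  forall w, G w -> Im w = 0 -> w = x0%:C \/ w = (- p0)%:C].
Proof.
have [yu Hyu] := half_map_exists bd HP.
have [p00 p0g] := andP p0r; have [xt0 xtg] := andP x0r; have [pt0 ptg] := andP p0t.
have [M1 A0 _ _ _] := bd.
have xr' : 0 < x0 - t <= rng by rewrite xt0 ltW.
have yux : yu (x0 - t) = - p0 - t.
  apply: (half_map_unique bd HP Hyu xr') => //; apply/andP; split; [rewrite -/rho|]; lra.
pose Y x := - (yu (x - t) + t); pose X p := - y' p.
have Yx0 : Y x0 = p0 by rewrite /Y yux; ring.
have [/andP[y1 y2] _ _ _] : half_map_at a' b' P' s' M A y' p0 by apply: Hy'; rewrite p00 ltW.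
have x00 : 0 < x0 by rewrite oppr_gt0.
have x0rho : x0 <= rho / 4 by rewrite /x0 lerNl -mulNr.
pose Y' := - (arc_dphase a b s (x0 - t) / arc_dphase a b s (- p0 - t)).
have dsh : is_derive x0 (1 : R) (fun x => x - t) 1.
  by have := is_deriveB (is_derive_id x0 (1 : R)) (is_derive_cst t x0 (1 : R)); rewrite subr0.
have dY : is_derive x0 (1 : R) Y Y'.
  have d1 := half_map_derive bd HP Hyu x0r; rewrite yux in d1.
  have d2 := @is_derive1_comp R yu (fun x => x - t) x0 _ _ d1 dsh; rewrite mulr1 in d2.
  have := is_deriveN (is_deriveD d2 (is_derive_cst t x0 (1 : R))).
  by rewrite addr0.
have dX0 : is_derive p0 (1 : R) X dX by exact: is_deriveN (half_map_derive bd' HP' Hy' p0r).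
have slope1 := half_map_slope bd Hyu x0r; rewrite yux in slope1.
have slope2 := half_map_slope bd' Hy' p0r.
have den0 : arc_dphase a b s (- p0 - t) != 0.
  by apply: contraTneq slope1 => ->; rewrite invr0 mulr0 ltxx.
(* Both factors are positive, so only the value 1 has to be excluded, and it would make the number
   in [regular] vanish. *)
have mu1 : `|dX * Y'| != 1.
  rewrite gtr0_norm; last by rewrite /dX /Y' mulrNN nmulr_rgt0.
  apply: contraNneq regular => mE.
  have : dX * Y' * arc_dphase a b s (- p0 - t) = arc_dphase a b s (- p0 - t) by rewrite mE mul1r.
  have -> : dX * Y' * arc_dphase a b s (- p0 - t) = - (dX * arc_dphase a b s (x0 - t)).
    by rewrite /Y'; field.
  by move=> <-; rewrite mulrC subrr.
have cY : {for x0, continuous Y} := is_derive_continuous dY.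
have [kY kY0 HkY] := (continuous_epsP _ _).1 cY _ p00.
pose Tu x := arc_period P s (x - t) (yu (x - t)).
pose Td p := arc_period P' s' p (y' p).
(* [h1] and [h2] keep nearby points in the domain of the half maps, [h3] and [h4] keep their arcs
   within the bound [B]. *)
pose h1 := Num.min (x0 - t) (rng - (x0 - t)); pose h2 := Num.min p0 (rng - p0).
pose h3 := (B - (4 * E * (x0 - t) + `|t|)) / (4 * E); pose h4 := (B - 4 * E * p0) / (4 * E).
pose d := Num.min kY (Num.min (Num.min h1 h2) (Num.min h3 h4)).
have E4 : 0 < 4 * E by rewrite mulr_gt0.
have h30 : 0 < h3 by rewrite divr_gt0// subr_gt0.
have h40 : 0 < h4 by rewrite divr_gt0// subr_gt0.
have d0 : 0 < d by rewrite !lt_min kY0 h30 h40 xt0 p00 !subr_gt0 xtg p0g.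
have : d <= Num.min kY (Num.min (Num.min h1 h2) (Num.min h3 h4)) by [].
clearbody d; rewrite !le_min => /and3P[dY1 /andP[/andP[d11 d12] /andP[d21 d22]] /andP[d3 d4]].
rewrite ler_pdivlMr// in d3; rewrite ler_pdivlMr// in d4.
have HU x : `|x - x0| < d -> 0 < Y x /\ half_arc (horner (Fup S)) x (- Y x) (Tu x) B.
  move=> xd; split.
    have := HkY x (lt_le_trans xd dY1); rewrite Yx0 ltr_norml; lra.
  move: xd; rewrite ltr_norml => /andP[xd1 xd2].
  have [|_ _ _ arcx] := Hyu (x - t); first by apply/andP; split; rewrite -/rng; lra.
  have := half_arc_translate t arcx; rewrite subrK /Y opprK.
  move=> /(half_arc_ext (fun z => esym (upper_field_two_halves a b s t a' b' s' z))).
  apply: half_arc_weaken.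
  have : (x - x0) * (4 * E) <= d * (4 * E) by rewrite ler_pM2r// ltW.
  by rewrite -/E; lra.
have HD p : `|p - p0| < d -> 0 < X p /\ half_arc (lower_field S) p (- X p) (Td p) B.
  rewrite ltr_norml => /andP[xd1 xd2].
  have [|/andP[_ yp] _ _ arcx] := Hy' (x := p); first by apply/andP; split; rewrite -/rng; lra.
  rewrite oppr_gt0; split=> //; rewrite opprK.
  move: arcx => /(half_arc_ext (fun z => esym (lower_field_two_halves a b s t a' b' s' z))).
  apply: half_arc_weaken.
  have : (p - p0) * (4 * E) <= d * (4 * E) by rewrite ler_pM2r// ltW.
  by rewrite -/E; lra.
have cTu : {for x0, continuous Tu}.
  apply: (@continuous_comp _ _ _ (fun x => x - t) (fun x => arc_period P s x (yu x)) x0).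
    exact: is_derive_continuous dsh.
  have H := half_map_period_continuous bd HP Hyu x0r; exact: H.
have cTd : {for p0, continuous Td} := half_map_period_continuous bd' HP' Hy' p0r.
have m0 : 0 < 1 / (2 * (A ^+ 2 + 1)).
  by rewrite divr_gt0// mulr_gt0// ltr_wpDl ?sqr_ge0.
have rotU (z : C) : normc z < B1 -> 0 < Im z ->
    1 / (2 * (A ^+ 2 + 1)) * normc (z - t%:C) ^+ 2 <= Im ((z - t%:C)^* * (Fup S).[z]).
  move=> zB _; rewrite upper_field_two_halves; apply: half_field_rotation => //.
  by rewrite (le_trans (ler_normcB _ _))// normc_real; have := B1r; lra.
have rotD (z : C) : normc z < B1 -> 0 < Im z ->
    1 / (2 * (A ^+ 2 + 1)) * normc (z - 0%:C) ^+ 2 <= Im ((z - 0%:C)^* * lower_field S z).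
  move=> zB _; rewrite lower_field_two_halves rmorph0 subr0; apply: half_field_rotation => //.
  by have := normr_ge0 t; have := B1r; lra.
have FdnE (x : R) : (Fdn S).[x%:C] = - arc_field a' b' s' (- x)%:C.
  by rewrite -(lower_field_two_halves a b s t) /lower_field rmorphN opprK opprK.
have FupE (x : R) : (Fup S).[x%:C] = arc_field a b s (x - t)%:C.
  by rewrite upper_field_two_halves rmorphB.
have rngr : rng <= rho / 16 := arc_range_le bd.
have B1r' := B1r; have BB1' := BB1.
have rho0 : 0 < rho by exact: arc_radius_gt0.
have upx : up_cross S x0.
  split.
    rewrite FupE; have [|c c0 ->] := half_field_Im (x := x0 - t) bd; last exact: mulr_gt0.
    by rewrite gtr0_norm//; lra.
  rewrite FdnE; have [|c c0] := half_field_Im (x := - x0) bd'.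
    by rewrite normrN gtr0_norm//; lra.
  by rewrite Im_opp => ->; rewrite -mulNr opprK mulr_gt0.
have dnp : down_cross S p0.
  split.
    rewrite FupE; have [|c c0 ->] := half_field_Im (x := - p0 - t) bd.
      by rewrite -opprD normrN gtr0_norm//; lra.
    by rewrite pmulr_llt0//; lra.
  rewrite FdnE opprK; have [|c c0] := half_field_Im (x := p0) bd'.
    by rewrite gtr0_norm//; lra.
  by rewrite Im_opp => ->; rewrite oppr_lt0 mulr_gt0.
have [_ [zu zuA]] : 0 < Y x0 /\ half_arc (horner (Fup S)) x0 (- Y x0) (Tu x0) B.
  by apply: HU; rewrite subrr normr0.
have [_ [zd zdA]] : 0 < X p0 /\ half_arc (lower_field S) p0 (- X p0) (Td p0) B.
  by apply: HD; rewrite subrr normr0.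
have Xp0 : X p0 = x0 by [].
rewrite Yx0 in zuA; rewrite Xp0 in zdA.
have hyp := cycle_hyperbolic x00 p00 d0 BB1 m0 HU HD Yx0 Xp0 dY dX0 cTu cTd mu1 rotU rotD upx dnp zuA zdA.
exists (cycle_set x0 p0 Tu Td zu zd); split=> //.
- by move=> w; apply: (cycle_norm zuA zdA).
- split; last by move=> w; apply: (cycle_real zuA zdA).
  exists (- p0)%:C => //; exists (Tu x0); last first.
    by have [_ [_ -> _]] := loop_filippov zuA zdA.
  rewrite /= in_itv /=; have [T1 _ _ _ _] := zuA; have [T2 _ _ _ _] := zdA.
  by rewrite (ltW T1) lerDl ltW.
Qed.

End CycleOfZero.

(** * The closing defect *)

Section ClosingDefect.
Variable R : realType.
Local Notation C := R[i].
Variables (a b : C) (P : C -> C) (t : R) (a' b' : C) (P' : C -> C) (s' M A : R).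
Hypothesis bd0 : arc_bounds a b 0 M A.
Hypothesis bd1 : arc_bounds a b 1 M A.
Hypothesis HP : log_primitive a b P.
Hypothesis bd' : arc_bounds a' b' s' M A.
Hypothesis HP' : log_primitive a' b' P'.
Variable y' : R -> R.
Hypothesis Hy' : forall x, 0 < x <= arc_range M A -> half_map_at a' b' P' s' M A y' x.

(** Measured in phase, the distance by which the upper arc from the end of the lower arc through
    [- p] misses [- p]. The variable lives on the negative axis because the lower half is never
    perturbed: [y'] is the same function for all values of the parameters. *)
Definition closing_defect (s p : R) : R :=
  arc_phase P s (- y' p - t) + s * pi - arc_phase P s (- p - t).

Definition closing_ddefect (s p : R) : R :=
  arc_dphase a b s (- y' p - t) * - (arc_dphase a' b' s' p / arc_dphase a' b' s' (y' p)) +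
  arc_dphase a b s (- p - t).

Lemma closing_defect_affine s p :
  closing_defect s p = closing_defect 0 p + s * (closing_defect 1 p - closing_defect 0 p).
Proof. by rewrite /closing_defect /arc_phase; ring. Qed.

Lemma closing_ddefect_affine s p :
  closing_ddefect s p = closing_ddefect 0 p + s * (closing_ddefect 1 p - closing_ddefect 0 p).
Proof. by rewrite /closing_ddefect /arc_dphase; ring. Qed.

(** The last two conditions put the ends of the upper arc on the two sides of its centre [t]. *)
Definition admissible p := [/\ 0 < p < arc_range M A, `|t| < p & `|t| < - y' p].

Lemma admissible_bounds p : admissible p ->
  [/\ 0 < - y' p - t <= arc_radius M A, - arc_radius M A <= - p - t < 0 &
      0 < p + t <= arc_radius M A].
Proof.
move=> [/andP[p0 pr] tp tx]; have [|/andP[h1 h2] _ _ _] := Hy' (x := p); first by rewrite p0 ltW.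
have h3 := arc_range_le bd0.
have [M1 A0 _ _ _] := bd0; have rho0 := arc_radius_gt0 M1 A0.
by move: tp tx; rewrite !ltr_norml => /andP[t1 t2] /andP[t3 t4]; split; apply/andP; split; lra.
Qed.

(** The slope in [s] is [pi] plus a difference of two values of [Im P], each at most 1/8 in
    modulus. *)
Lemma closing_defect_slope_gt0 p : admissible p -> 0 < closing_defect 1 p - closing_defect 0 p.
Proof.
move=> ad; have [/andP[h1 h2] /andP[h3 h4] _] := admissible_bounds ad.
have [M1 A0 aM bM _] := bd0.
have k1 : normc (P (- y' p - t)%:C) <= 1 / 8.
  by apply: (P_small M1 A0 aM bM HP); rewrite normc_real gtr0_norm.
have k2 : normc (P (- p - t)%:C) <= 1 / 8.
  by apply: (P_small M1 A0 aM bM HP); rewrite normc_real ltr0_norm//; lra.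
have := Im_le_normc (P (- y' p - t)%:C); have := Im_le_normc (P (- p - t)%:C).
rewrite !ler_norml /closing_defect /arc_phase; have := pi_ge2 R; lra.
Qed.

Lemma closing_defect_derive s p : arc_bounds a b s M A -> admissible p ->
  is_derive p (1 : R) (closing_defect s) (closing_ddefect s p).
Proof.
move=> bd ad; have [/andP[h1 h2] /andP[h3 h4] _] := admissible_bounds ad.
have [M1 A0 aM bM sA] := bd; have [pr _ _] := ad.
have dy := half_map_derive bd' HP' Hy' pr.
have dx : is_derive p (1 : R) (fun p => - y' p - t)
    (- (arc_dphase a' b' s' p / arc_dphase a' b' s' (y' p))).
  by have := is_deriveB (is_deriveN dy) (is_derive_cst t p (1 : R)); rewrite subr0.
have dq : is_derive p (1 : R) (fun p => - p - t) (- 1).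
  by have := is_deriveB (is_deriveN (is_derive_id p (1 : R))) (is_derive_cst t p (1 : R)); rewrite subr0.
have n1 : `|- y' p - t| <= arc_radius M A by rewrite gtr0_norm.
have n2 : `|- p - t| <= arc_radius M A by rewrite ltr0_norm//; lra.
have d1 := @is_derive1_comp R (arc_phase P s) (fun p => - y' p - t) p _ _
  (is_derive_arc_phase s M1 A0 aM bM HP (lt0r_neq0 h1) n1) dx.
have d2 := @is_derive1_comp R (arc_phase P s) (fun p => - p - t) p _ _
  (is_derive_arc_phase s M1 A0 aM bM HP (ltr0_neq0 h4) n2) dq.
have := is_deriveB (is_deriveD d1 (is_derive_cst (s * pi) p (1 : R))) d2.
by rewrite addr0 mulrN1 opprK.
Qed.

Lemma closing_ddefect_continuous s p : arc_bounds a b s M A -> admissible p ->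
  {for p, continuous (closing_ddefect s)}.
Proof.
move=> bd ad; have [/andP[h1 h2] /andP[h3 h4] _] := admissible_bounds ad.
have [pr _ _] := ad.
have n1 : `|- y' p - t| <= arc_radius M A by rewrite gtr0_norm.
have n2 : `|- p - t| <= arc_radius M A by rewrite ltr0_norm//; lra.
have cy : {for p, continuous y'} := is_derive_continuous (half_map_derive bd' HP' Hy' pr).
apply: cvgD; [apply: cvgM|].
- apply: (@continuous_comp _ _ _ (fun p => - y' p - t) (arc_dphase a b s) p).
    by apply: cvgB; [exact: cvgN cy|exact: cvg_cst].
  by have H := arc_dphase_continuous bd (lt0r_neq0 h1) n1; exact: H.
- by apply: cvgN; have H := half_map_slope_continuous bd' HP' Hy' pr; exact: H.
- apply: (@continuous_comp _ _ _ (fun p => - p - t) (arc_dphase a b s) p).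
    by apply: cvgB; [apply: cvgN; exact: cvg_id|exact: cvg_cst].
  by have H := arc_dphase_continuous bd (ltr0_neq0 h4) n2; exact: H.
Qed.

(* The value of the parameter [s] for which the arc through [- p] closes up. *)
Definition closing_parameter p := - (closing_defect 0 p / (closing_defect 1 p - closing_defect 0 p)).

Definition closing_dparameter p :=
  - (closing_ddefect (closing_parameter p) p / (closing_defect 1 p - closing_defect 0 p)).

Lemma closing_parameterP s p : admissible p ->
  closing_defect s p = (closing_defect 1 p - closing_defect 0 p) * (s - closing_parameter p).
Proof.
move=> ad; have h := closing_defect_slope_gt0 ad.
rewrite closing_defect_affine /closing_parameter.
set u := closing_defect 0 p in h *; set v := closing_defect 1 p in h *.
by field; exact: lt0r_neq0.
Qed.

Lemma closing_parameter_c1 u v : (forall p, u <= p <= v -> admissible p) ->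
  c1_on closing_parameter closing_dparameter u v.
Proof.
move=> H p /H ad; have h := closing_defect_slope_gt0 ad.
have d0 := closing_defect_derive bd0 ad; have d1 := closing_defect_derive bd1 ad.
have c0 := closing_ddefect_continuous bd0 ad; have c1 := closing_ddefect_continuous bd1 ad.
have dj := is_deriveB d1 d0.
have hn := lt0r_neq0 h.
have e0 := is_derive_continuous d0; have e1 := is_derive_continuous d1.
have ds : is_derive p (1 : R) closing_parameter (closing_dparameter p).
  have di := is_deriveV (hn : (closing_defect 1 - closing_defect 0) p != 0) dj.
  apply: (is_derive_ext (is_deriveN (is_deriveM d0 di))) => //; rewrite /closing_dparameter (closing_ddefect_affine (closing_parameter p)) /closing_parameter /=.
  rewrite /GRing.scale /=.
  set w0 := closing_defect 0 p in h hn *; set w1 := closing_defect 1 p in h hn *.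
  rewrite -[(closing_defect 1 - closing_defect 0) p]/(closing_defect 1 p - closing_defect 0 p) -/w0 -/w1. by field.
split=> //.
have cj : {for p, continuous (fun p => closing_defect 1 p - closing_defect 0 p)}.
  by apply: cvgB; [exact: e1|exact: e0].
rewrite (_ : closing_dparameter = fun p => - ((closing_ddefect 0 p + closing_parameter p *
    (closing_ddefect 1 p - closing_ddefect 0 p)) * (closing_defect 1 p - closing_defect 0 p)^-1)).
  apply: cvgN; apply: cvgM; last by apply: cvgV => //; exact: cj.
  apply: cvgD; [exact: c0|apply: cvgM].
    by have := is_derive_continuous ds.
  by apply: cvgB; [exact: c1|exact: c0].
by apply/funext => q; rewrite /closing_dparameter closing_ddefect_affine.
Qed.

End ClosingDefect.

(** * From sign changes of the defect to bifurcating cycles *)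

Section Bifurcation.
Variable R : realType.
Local Notation C := R[i].
Variables (a' b' : C) (P' : C -> C) (s' M A : R) (y' : R -> R).
Hypothesis bd' : arc_bounds a' b' s' M A.
Hypothesis HP' : log_primitive a' b' P'.
Hypothesis Hy' : forall x, 0 < x <= arc_range M A -> half_map_at a' b' P' s' M A y' x.

(** With shift 0 both halves are centred at the origin, and an upper arc followed by a lower one
    makes a turn. Each multiplies the modulus by at most [4 E], hence [16 E^2]. *)
Lemma monodromic_two_halves a0 b0 s0 : arc_bounds a0 b0 s0 M A ->
  monodromic_origin (two_halves a0 b0 s0 0 a' b' s').
Proof.
move=> bd; have [P HP] := exists_log_primitive a0 b0.
have [y Hy] := half_map_exists bd HP.
have e00 : arc_field a0 b0 s0 0 = 0 by rewrite /arc_field mulr0 mul0r.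
split.
- by rewrite upper_field_two_halves rmorph0 subrr.
- by rewrite /= horner_half_poly rmorph0 subrr /arc_field mulr0 mul0r.
- exists true => e e0.
have E1 := arc_growth_ge1 bd; set E := arc_growth A in E1.
have [r rE] : exists r, r = arc_range M A by exists (arc_range M A).
have r0 := arc_range_gt0 bd; rewrite -rE in r0.
have E20 : 0 < 16 * E ^+ 2 + 1 by have := sqr_ge0 E; lra.
exists (Num.min (r / (4 * E)) (e / (16 * E ^+ 2 + 1))) => [|x].
  rewrite lt_min; apply/andP; split; apply: divr_gt0 => //; lra.
rewrite lt_min !ltr_pdivlMr//; last by lra.
move=> /and3P[x0 xr xe].
have xle : x <= x * (4 * E) by rewrite ler_peMr//; lra.
have [|/andP[y1 y2] y3 _ [zu zuA]] := Hy x; first by apply/andP; split=> //; rewrite -rE; lra.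
rewrite -/E ltr0_norm// in y3.
have [|/andP[w1 w2] _ _ [zd zdA]] := Hy' (x := - y x).
  by apply/andP; split; rewrite ?oppr_gt0// -rE; lra.
set B := 16 * E ^+ 2 * x; have EE : E <= E ^+ 2 by rewrite expr2 ler_peMl//; lra.
have Ex : E * x <= E ^+ 2 * x by rewrite ler_pM2r.
have zuA' : arc_curve (horner (Fup (two_halves a0 b0 s0 0 a' b' s'))) x (- (- y x))
    (arc_period P s0 x (y x)) B zu.
  rewrite opprK; case: zuA => h1 h2 h3 h4 h5; split=> //.
    by move=> u /h3; rewrite upper_field_two_halves rmorph0 subr0.
  by move=> u /h5 /le_trans; apply; rewrite -/E /B; lra.
have zdA' : arc_curve (lower_field (two_halves a0 b0 s0 0 a' b' s')) (- y x) (- (- y' (- y x)))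
    (arc_period P' s' (- y x) (y' (- y x))) B zd.
  rewrite opprK; case: zdA => h1 h2 h3 h4 h5; split=> //.
    by move=> u /h3; rewrite lower_field_two_halves.
  move=> u /h5 /le_trans; apply; rewrite -/E /B.
  have : E * - y x <= E * (4 * E * x) by rewrite ler_pM2l//; lra.
  by rewrite expr2; lra.
have [sol [g0 gT gTT] gu gd gB] := loop_filippov zuA' zdA'.
have [T1 _ _ _ _] := zuA'; have [T2 _ _ _ _] := zdA'.
exists (loop (arc_period P s0 x (y x)) zu zd), (arc_period P s0 x (y x)),
  (arc_period P s0 x (y x) + arc_period P' s' (- y x) (y' (- y x))); split=> //.
- by rewrite T1 ltrDl.
- split=> //; first by exists (y x) => //; rewrite gT opprK.
  by exists (- y' (- y x)) => //; rewrite oppr_gt0.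
- move=> u; rewrite in_itv /= => /gB h; rewrite normcE2 ltcR; apply: le_lt_trans h _.
  by rewrite /B mulrC; lra.
Qed.

(** By [closing_parameterP] the defect at [s1] has the sign of [s1 - closing_parameter]. A regular
    value [s] of [closing_parameter] near [s1], common to the [k] intervals, is thus a parameter for
    which the defect has in each of them a zero with nonzero derivative. *)
Lemma bifurcating_of_alternation a0 b0 s0 np nm k :
  1 <= A -> normc a0 + 1 <= M -> normc b0 + 1 <= M -> `|s0| + 1 <= A ->
  (forall d, 0 < d -> exists (a b : C) (s1 t : R) (P : C -> C) (q : nat -> R),
     [/\ [/\ normc (a - a0) < d, normc (b - b0) < d, `|s1 - s0| < d & `|t| < d],
         log_primitive a b P,
         forall s, has_degrees np nm (two_halves a b s t a' b' s'),
         (forall i, (i < k)%N -> q i < q i.+1) /\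
         (forall p, q 0%N <= p <= q k -> [/\ p < d, `|t| < p & `|t| < - y' p]) &
         forall i, (i < k)%N ->
           closing_defect P t y' s1 (q i) * closing_defect P t y' s1 (q i.+1) < 0]) ->
  bifurcating np nm k (two_halves a0 b0 s0 0 a' b' s').
Proof.
move=> A1 a0M b0M s0A H e d e0 d0.
have [M1 A0 a'M b'M s'A] := bd'.
have [kc kc0 Hclose] := half_poly_close a0 b0 s0 d0.
have rho0 := arc_radius_gt0 M1 A0; set rho := arc_radius M A in rho0.
have E1 := arc_growth_ge1 bd'; set E := arc_growth A in E1.
have E0 : 0 < E by lra.
have EE : E <= E ^+ 2 by rewrite expr2 ler_peMl//; lra.
have rE := arc_rangeE M A; have r0 := arc_range_gt0 bd'; have rle := arc_range_le bd'.
set r := arc_range M A in rE r0 rle; rewrite -/E -/rho in rE; rewrite -/rho in rle.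
(* The halves of [kc] and 1 are due to [s] moving twice, from [s0] to [s1] and on to the regular
   value. From [p, |t| < dl] come [x0 - t < 5 dl E] and [4 E (x0 - t) + |t| < 21 dl E^2]; the bounds
   22, 23 and 24 leave room for [B < B1] and [B1 + |t| <= rho]. *)
pose dl := Num.min (Num.min (kc / 2) (1 / 2)) (Num.min (r / (6 * E))
  (Num.min (rho / (24 * E ^+ 2)) (e / (23 * E ^+ 2)))).
have E20 : 0 < E ^+ 2 by rewrite exprn_gt0.
have dl0 : 0 < dl.
  by rewrite !lt_min; apply/andP; split; [|apply/and3P; split]; rewrite ?divr_gt0// ?mulr_gt0//; lra.
have : dl <= dl by []; rewrite {2}/dl !le_min => /andP[/andP[dl1 dl2] /and3P[dl3 dl4 dl5]].
clearbody dl; rewrite ler_pdivlMr// in dl1; rewrite ler_pdivlMr// in dl2.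
rewrite ler_pdivlMr ?mulr_gt0// in dl3; rewrite ler_pdivlMr ?mulr_gt0// in dl4.
rewrite ler_pdivlMr ?mulr_gt0// in dl5.
have [a [b [s1 [t [P [q [[ca cb cs ct] HP deg [qinc qadm] alt]]]]]]] := H dl dl0.
have aM : normc a <= M by have := normc_le_dist a a0; lra.
have bM : normc b <= M by have := normc_le_dist b b0; lra.
have bds s : `|s - s1| < dl -> arc_bounds a b s M A.
  move=> ss; split=> //; have := ler_normD (s - s1) (s1 - s0); have := ler_normD (s - s0) s0.
  by rewrite addrA !subrK; lra.
have bd0 : arc_bounds a b 0 M A by split=> //; rewrite normr0.
have bd1 : arc_bounds a b 1 M A by split=> //; rewrite normr1.
have Edl : dl <= dl * E ^+ 2 by rewrite ler_peMr ?(ltW dl0)//; lra.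
have Edl1 : dl <= dl * E by rewrite ler_peMr ?(ltW dl0).
have Edl2 : dl * E <= dl * E ^+ 2 by rewrite ler_pM2l.
have adm p : q 0%N <= p <= q k -> admissible t M A y' p.
  move=> /qadm[pd tp tx]; split=> //; have := normr_ge0 t; rewrite -/r => tt.
  by apply/andP; split; lra.
have qmono i j : (i <= j)%N -> (j <= k)%N -> q i <= q j.
  move=> /subnKC <-; elim: (j - i)%N => [|n IH]; rewrite ?addn0// addnS => le.
  by apply: le_trans (IH (ltnW le)) (ltW (qinc _ le)).
have adms i p : (i < k)%N -> q i <= p <= q i.+1 -> admissible t M A y' p.
  move=> ik /andP[p1 p2]; apply: adm; rewrite (le_trans _ p1) ?(le_trans p2)//; last first.
    by apply: qmono => //; exact: ltnW.
  exact: qmono.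
clear a0M b0M s0A aM bM a'M b'M s'A M1 rE rle EE dl2.
pose Sg := closing_parameter P t y'; pose dSg := closing_dparameter a b P t a' b' s' y'.
have [s ss Hs] : exists2 s, `|s - s1| < dl & forall i, (i < k)%N -> regular_hit Sg dSg (q i) (q i.+1) s.
  apply: common_regular_value => // i ik.
    by apply: (closing_parameter_c1 bd0 bd1 HP bd' HP' Hy') => p; exact: adms.
  have := alt i ik.
  have /(closing_parameterP bd0 HP Hy' s1) : admissible t M A y' (q i).
    by apply: (adms i) => //; rewrite lexx ltW// qinc.
  have /(closing_parameterP bd0 HP Hy' s1) : admissible t M A y' (q i.+1).
    by apply: (adms i) => //; rewrite lexx ltW// qinc.
  have h1 : 0 < closing_defect P t y' 1 (q i) - closing_defect P t y' 0 (q i).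
    apply: (closing_defect_slope_gt0 bd0 HP Hy').
    by apply: (adms i) => //; rewrite lexx ltW// qinc.
  have h2 : 0 < closing_defect P t y' 1 (q i.+1) - closing_defect P t y' 0 (q i.+1).
    apply: (closing_defect_slope_gt0 bd0 HP Hy').
    by apply: (adms i) => //; rewrite lexx ltW// qinc.
  move=> -> ->; rewrite -/Sg; set u := _ - _ in h1 *; set v := _ - _ in h2 *.
  have -> : u * (s1 - Sg (q i)) * (v * (s1 - Sg (q i.+1))) =
    (u * v) * ((Sg (q i) - s1) * (Sg (q i.+1) - s1)) by ring.
  by rewrite pmulr_rlt0// mulr_gt0.
have bd := bds s ss.
exists (two_halves a b s t a' b' s'); split=> //.
  move=> j; rewrite !normcE2 !ltcR subrr normc0; split=> //; apply: Hclose; try lra.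
  have := ler_normD (s - s1) (s1 - s0); rewrite addrA subrK; lra.
clear dl1 kc0 ca cb cs ss d0.
have cyc (i : 'I_k) : exists G : set C, exists p : R, [/\ q i < p < q i.+1, 0 < - y' p,
    hyperbolic_limit_cycle (two_halves a b s t a' b' s') G,
    forall w, G w -> normc w < e & (exists2 w, G w & w = (- p)%:C) /\
      forall w, G w -> Im w = 0 -> w = (- y' p)%:C \/ w = (- p)%:C].
  have [p [pq pS pd]] := Hs i (ltn_ord i).
  have pq' : q i <= p <= q i.+1 by case/andP: pq => *; apply/andP; split; exact: ltW.
  have ad := adms i p (ltn_ord i) pq'.
  have [/andP[x1 x2] /andP[x3 x4] pt] := admissible_bounds bd0 Hy' ad.
  have [pr tp tx] := ad; have /andP[p0 pr'] := pr.
  have pdl : p < dl.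
    have [] := qadm p => //; case/andP: pq' => h1 h2; apply/andP; split.
      by apply: le_trans h1; apply: qmono => //; exact: ltnW.
    by apply: le_trans h2 _; exact: qmono.
  have [|/andP[y1 y2] y3 _ _] := Hy' (x := p); first by rewrite p0 ltW.
  rewrite -/E ltr0_norm// in y3.
  have Ep : E * p <= dl * E by rewrite mulrC ler_pM2r// ltW.
  have xs : - y' p - t < 5 * (dl * E) by move: ct; rewrite ltr_norml; lra.
  have Ex : E * (- y' p - t) <= 5 * (dl * E ^+ 2).
    have : E * (- y' p - t) <= E * (5 * (dl * E)) by rewrite ler_pM2l// ltW.
    by rewrite expr2; lra.
  have z0 : closing_defect P t y' s p = 0.
    by rewrite (closing_parameterP bd0 HP Hy' s ad) -/Sg pS subrr mulr0.
  have [|||||||||G [G1 G2 [G3 G4]]] := @cycle_of_zero _ a b P s t a' b' P' s' M A bd HP bd' HP' y' Hy' p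
      (22 * (dl * E ^+ 2)) (23 * (dl * E ^+ 2)).
  - by [].
  - by rewrite x1 -/r; lra.
  - by [].
  - by lra.
  - by rewrite -/rho; lra.
  - by rewrite -/E; lra.
  - by rewrite -/E; lra.
  - by move: z0; rewrite /closing_defect; lra.
  - move: pd; rewrite /dSg /closing_dparameter -/Sg pS oppr_eq0; apply: contraNneq => z.
    by rewrite /closing_ddefect z mul0r.
  exists G, p; split=> //; first by lra.
  by move=> w /G2 h; apply: le_lt_trans h _; lra.
clear Edl Edl1 Edl2 dl3 dl4 dl5 E20 rho0 r0 E0 E1 ct e0 A0 A1 dl0.
have /choice[G /choice[p HG]] := cyc.
(* A cycle has a single point on the negative axis, [- p i], and the intervals []q i, q i.+1[] are
   disjoint: equal cycles have equal indices. *)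
exists G; split=> [i j Gij|i]; last first.
  have [_ _ h1 h2 _] := HG i; split=> // w /h2; by rewrite normcE2 ltcR.
have [pi1 _ _ _ [[w Gw wE] _]] := HG i; have [pj1 pj2 _ _ [_ Hj]] := HG j.
rewrite Gij in Gw; have := Hj w Gw; rewrite wE Im_real => /(_ erefl) [] /(congr1 (@complex.Re R)).
  rewrite !Re_real => pp; have [pi2 _ _ _ _] := HG i.
  have /qadm[_ tp _] : q 0%N <= q i <= q k by apply/andP; split; apply: qmono => //; exact: ltnW.
  by exfalso; have := normr_ge0 t; case/andP: pi1; lra.
rewrite !Re_real => pp0; have pp : p i = p j by apply: oppr_inj.
apply/val_inj/eqP; rewrite eqn_leq.
have key (i1 i2 : 'I_k) (u : R) : q i1 < u < q i1.+1 -> q i2 < u < q i2.+1 -> (i1 <= i2)%N.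
  move=> /andP[u1 u2] /andP[u3 u4]; rewrite leqNgt; apply/negP => lt.
  by have := qmono _ _ lt (ltnW (ltn_ord i1)); lra.
by rewrite (key i j (p i)) ?(key j i (p i)) ?pp//= -pp.
Qed.

End Bifurcation.

(** * Rotation *)

Section Rotation.
Variable R : realType.
Local Notation C := R[i].
Implicit Types (S : pwhs R) (z w : C).

Definition rot_poly (p : {poly C}) : {poly C} := \poly_(i < size p) ((-1) ^+ i.+1 * p`_i).

Lemma coef_rot_poly p i : (rot_poly p)`_i = (-1) ^+ i.+1 * p`_i.
Proof. by rewrite coef_poly; case: ltnP => // h; rewrite nth_default// mulr0. Qed.

Lemma horner_rot_poly p z : (rot_poly p).[z] = - p.[- z].
Proof.
rewrite horner_poly horner_coef -sumrN; apply: eq_bigr => i _.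
by rewrite exprS (exprNn z); ring.
Qed.

Lemma rot_polyK : involutive rot_poly.
Proof.
by move=> p; apply/polyP => i; rewrite !coef_rot_poly mulrA -exprMn mulrNN mulr1 expr1n mul1r.
Qed.

Lemma size_rot_poly p : size (rot_poly p) = size p.
Proof.
have le q : (size (rot_poly q) <= size q)%N := size_poly _ _.
by apply/eqP; rewrite eqn_leq le -{1}[p]rot_polyK le.
Qed.

(* The system seen after the change of variable [z -> - z], which exchanges the half planes. *)
Definition rot S : pwhs R := Pwhs (rot_poly (Fdn S)) (rot_poly (Fup S)).

Lemma rotK : involutive rot.
Proof. by case=> p q; rewrite /rot /= !rot_polyK. Qed.

Definition oppset (G : set C) : set C := [set z | G (- z)].

Lemma oppsetK : involutive oppset.
Proof. by move=> G; apply/seteqP; split=> z; rewrite /oppset /= opprK. Qed.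

Lemma filippov_field_rot S z w : filippov_field S z w -> filippov_field (rot S) (- z) (- w).
Proof.
rewrite /filippov_field Im_opp oppr_gt0 oppr_lt0 /=.
have [z0|z0|z0] := ltgtP 0 (Im z).
- by rewrite horner_rot_poly opprK => ->.
- by rewrite horner_rot_poly opprK => ->.
- case=> l /andP[l0 l1] ->; exists (1 - l); first by apply/andP; split; lra.
  by rewrite !horner_rot_poly !opprK !rmorphB /= rmorph1; ring.
Qed.

Lemma filippov_solution_rot S (a b : R) g :
  filippov_solution S a b g -> filippov_solution (rot S) a b (fun t => - g t).
Proof.
move=> [u [ur ui uf ug]]; exists (fun t => - u t); split.
- have := integrableN ur; apply: eq_integrable => // x _; by rewrite Re_opp.
- have := integrableN ui; apply: eq_integrable => // x _; by rewrite Im_opp.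
- by apply: (@filterS _ _ (ae_filter_ringOfSetsType lebesgue_measure) _ _ _ uf) => x h /h /filippov_field_rot.
move=> t tab; rewrite (ug t tab) opprD; congr (_ + _).
have sub : `[a, t] `<=` `[a, b]%classic.
  by move=> x; rewrite /= !in_itv /= => /andP[-> xt]; move: tab; rewrite in_itv /= => /andP[_ /(le_trans xt)].
have N (f : R -> R) : lebesgue_measure.-integrable `[a, b] (EFin \o f) ->
    \int[lebesgue_measure]_(s in `[a, t]) (- f s) = - \int[lebesgue_measure]_(s in `[a, t]) f s.
  move=> fi; have fi' : lebesgue_measure.-integrable `[a, t] (EFin \o f).
    by apply: integrableS fi.
  have := RintegralZl (-1) _ fi'.
  rewrite mulN1r => <-//; apply: eq_Rintegral => x _; by rewrite mulN1r.
by rewrite -[LHS]/((- _) +i* (- _)) -(N _ ur) -(N _ ui); congr (_ +i* _);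
   apply: eq_Rintegral => x _; rewrite ?Re_opp ?Im_opp.
Qed.

Lemma periodic_solution_rot S T g : periodic_solution S T g -> periodic_solution (rot S) T (fun t => - g t).
Proof.
move=> [T0 sol gT inj]; split=> //; [exact: filippov_solution_rot|by rewrite gT|].
by move=> s t sT tT /oppr_inj; exact: inj.
Qed.

Lemma oppset_image (g : R -> C) A : oppset (g @` A) = (fun t => - g t) @` A.
Proof.
apply/seteqP; split=> z /=.
  by case=> t At gt; exists t => //; rewrite gt opprK.
by case=> t At <-; exists t => //; rewrite opprK.
Qed.

Lemma periodic_orbit_rot S G : periodic_orbit S G -> periodic_orbit (rot S) (oppset G).
Proof.
move=> [T [g [/periodic_solution_rot h ->]]]; exists T, (fun t => - g t); split=> //.
exact: oppset_image.
Qed.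

Lemma limit_cycle_rot S G : limit_cycle S G -> limit_cycle (rot S) (oppset G).
Proof.
move=> [/periodic_orbit_rot h [e e0 H]]; split=> //; exists e => // K /periodic_orbit_rot.
rewrite rotK => hK near; rewrite -[K]oppsetK; congr oppset; apply: H hK _ => z /near[w Gw zw].
exists (- w) => //; have -> : z - - w = - (- z - w) by ring.
by rewrite normrN.
Qed.

Lemma hyperbolic_limit_cycle_rot S G :
  hyperbolic_limit_cycle S G -> hyperbolic_limit_cycle (rot S) (oppset G).
Proof.
move=> [/limit_cycle_rot h [T [g [v [P [tau [mu [[per GE] cr tr [P0 tau0 ctau ret] dP]]]]]]]].
split=> //; exists T, (fun t => - g t), (- v), P, tau, mu; split=> //.
- by split; [exact: periodic_solution_rot|rewrite GE oppset_image].
- move=> z Gz z0; have := cr _ Gz; rewrite Im_opp z0 oppr0 => /(_ erefl).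
  by rewrite /crossing_point /= !horner_rot_poly !Im_opp mulrNN mulrC.
- move=> w /filippov_field_rot; rewrite rotK opprK => /tr.
  by rewrite !rmorphN /= mulrN mulNr.
- split=> //; apply: filterS ret => s [ts [f [f1 f2 f3]]]; split=> //.
  exists (fun t => - f t); split; first exact: filippov_solution_rot.
    by rewrite f2 mulrN opprD.
  by rewrite f3 mulrN opprD.
Qed.

Lemma has_degrees_rot np nm S : has_degrees np nm S -> has_degrees nm np (rot S).
Proof. by case=> h1 h2; split; rewrite /= size_rot_poly. Qed.

Lemma bifurcating_rot np nm k S : bifurcating np nm k S -> bifurcating nm np k (rot S).
Proof.
move=> H e d e0 d0; have [S' [deg cl [G [Ginj HG]]]] := H e d e0 d0.
exists (rot S'); split.
- exact: has_degrees_rot.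
- move=> j; have [h1 h2] := cl j; rewrite /= !coef_rot_poly -!mulrBr !normrM normrX normrN1 expr1n !mul1r.
  by [].
- exists (fun i => oppset (G i)); split=> [i j|i].
    by move=> /(congr1 oppset); rewrite !oppsetK; exact: Ginj.
  have [h1 h2] := HG i; split; first exact: hyperbolic_limit_cycle_rot.
  by move=> z /h2; rewrite normrN.
Qed.

Lemma rot_two_halves a b s a' b' s' :
  rot (two_halves a b s 0 a' b' s') = two_halves a' b' s' 0 a b (s : R).
Proof.
have E c1 c2 (u : R) : rot_poly (half_poly c1 c2 u 0) = half_poly (- c1) c2 u 0.
  apply/polyP => i; rewrite coef_rot_poly /half_poly !coef_Poly rmorph0.
  case: i => [|[|[|[|i]]]] /=; rewrite ?nth_nil; try ring.
by rewrite /rot /two_halves /= !E opprK.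
Qed.

Lemma monodromic_origin_two_halves a b s a' b' (s' : R) :
  monodromic_origin (two_halves a b s 0 a' b' s').
Proof.
have [P' HP'] := exists_log_primitive a' b'.
pose M := 1 + (normc a + normc b + normc a' + normc b').
pose A := `|s| + `|s'|.
have [na nb na' nb'] : [/\ 0 <= normc a, 0 <= normc b, 0 <= normc a' & 0 <= normc b'].
  by split; exact: normc_ge0.
have [s0 s0'] : 0 <= `|s| /\ 0 <= `|s'| by [].
have bd : arc_bounds a b s M A by rewrite /M /A; split; lra.
have bd' : arc_bounds a' b' s' M A by rewrite /M /A; split; lra.
have [y' Hy'] := half_map_exists bd' HP'.
exact: (monodromic_two_halves Hy' bd).
Qed.

Lemma cL0_le_cL np nm : (cL0 R np nm <= cL R np nm)%E.
Proof.
apply: ge_ereal_sup => _ [k [S [deg _ bif]] <-]; apply: ereal_sup_ubound; exists k => //.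
have [S' [deg' _ [G [Ginj HG]]]] := bif 1 1 ltr01 ltr01.
exists S'; split=> //; exists G; split=> // i.
by have [[]] := HG i.
Qed.

End Rotation.

(** * Expansion of the closing defect *)

Section SmallParameter.
Variable R : realType.
Implicit Types (f g : R -> R) (c d e : R) (n m : nat).

(** [f e = O(e^n)] as [e] tends to 0 from the right. *)
Definition Oe n f := exists K e0, [/\ 0 <= K, 0 < e0 & forall e, 0 < e < e0 -> `|f e| <= K * e ^+ n].

Lemma Oe_ext n f g e0 : 0 < e0 -> (forall e, 0 < e < e0 -> f e = g e) -> Oe n f -> Oe n g.
Proof.
move=> e00 fg [K [e1 [K0 e10 H]]]; exists K, (Num.min e0 e1); split=> //; first by rewrite lt_min e00.
by move=> e /andP[p0]; rewrite lt_min => /andP[h0 h1]; rewrite -fg ?p0// H// p0.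
Qed.

Lemma OeD n f g : Oe n f -> Oe n g -> Oe n (fun e => f e + g e).
Proof.
move=> [K [e0 [K0 e00 Hf]]] [L [e1 [L0 e10 Hg]]]; exists (K + L), (Num.min e0 e1); split.
- exact: addr_ge0.
- by rewrite lt_min e00.
move=> e /andP[p0]; rewrite lt_min => /andP[h0 h1].
by rewrite (le_trans (ler_normD _ _))// mulrDl lerD ?Hf ?Hg ?p0.
Qed.

Lemma OeM n m f g : Oe n f -> Oe m g -> Oe (n + m) (fun e => f e * g e).
Proof.
move=> [K [e0 [K0 e00 Hf]]] [L [e1 [L0 e10 Hg]]]; exists (K * L), (Num.min e0 e1); split.
- exact: mulr_ge0.
- by rewrite lt_min e00.
move=> e /andP[p0]; rewrite lt_min => /andP[h0 h1].
by rewrite normrM exprD mulrACA ler_pM ?Hf ?Hg ?p0.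
Qed.

Lemma Oe_cst c : Oe 0 (fun=> c).
Proof. by exists `|c|, 1; split=> // e _; rewrite expr0 mulr1. Qed.

Lemma Oe_exp n : Oe n (fun e => e ^+ n).
Proof.
by exists 1, 1; split=> // e /andP[e0 _]; rewrite mul1r ger0_norm// exprn_ge0// ltW.
Qed.

Lemma OeZ c n f : Oe n f -> Oe n (fun e => c * f e).
Proof. exact: OeM (Oe_cst c). Qed.

Lemma OeN n f : Oe n f -> Oe n (fun e => - f e).
Proof. by move=> [K [e0 [? ? H]]]; exists K, e0; split=> // e; rewrite normrN; exact: H. Qed.

Lemma Oe_le n f g e0 : 0 < e0 -> (forall e, 0 < e < e0 -> `|f e| <= `|g e|) -> Oe n g -> Oe n f.
Proof.
move=> e00 fg [K [e1 [K0 e10 H]]]; exists K, (Num.min e0 e1); split=> //; first by rewrite lt_min e00.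
move=> e /andP[p0]; rewrite lt_min => /andP[h0 h1]; apply: le_trans (fg _ _) _; first by rewrite p0.
by rewrite H// p0.
Qed.

Lemma OeW n m f : (n <= m)%N -> Oe m f -> Oe n f.
Proof.
move=> nm [K [e0 [K0 e00 H]]]; exists K, (Num.min e0 1); split=> //; first by rewrite lt_min e00 ltr01.
move=> e /andP[p0]; rewrite lt_min => /andP[h0 h1]; apply: le_trans (H _ _) _; first by rewrite p0.
by rewrite ler_wpM2l// ler_wiXn2l// ltW.
Qed.

Lemma Oe_small n f d : 0 < d -> Oe n.+1 f -> exists2 e0, 0 < e0 & forall e, 0 < e < e0 -> `|f e| < d * e ^+ n.
Proof.
move=> d0 [K [e0 [K0 e00 H]]]; exists (Num.min e0 (d / (K + 1))).
  by rewrite lt_min e00 divr_gt0// ltr_wpDl.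
move=> e /andP[p0]; rewrite lt_min ltr_pdivlMr ?ltr_wpDl// => /andP[h0 h1].
apply: le_lt_trans (H _ _) _; first by rewrite p0.
by rewrite exprS mulrA ltr_pM2r ?exprn_gt0//; lra.
Qed.

(** [f e = c e^n + O(e^(n+1))], where [c] may be 0. *)
Definition asym n c f := Oe n.+1 (fun e => f e - c * e ^+ n).

Lemma asym_ext n c f g e0 : 0 < e0 -> (forall e, 0 < e < e0 -> f e = g e) -> asym n c f -> asym n c g.
Proof. by move=> e00 fg; apply: (Oe_ext e00) => e /fg ->. Qed.

Lemma asym0 n f : Oe n.+1 f -> asym n 0 f.
Proof. by apply: (Oe_ext ltr01) => e _; rewrite mul0r subr0. Qed.

Lemma asym_Oe n c f : asym n c f -> Oe n f.
Proof.
move=> H; have := OeD (OeW (leqnSn n) H) (OeZ c (Oe_exp n)).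
by apply: (Oe_ext ltr01) => e _; rewrite subrK.
Qed.

Lemma asymD n c d f g : asym n c f -> asym n d g -> asym n (c + d) (fun e => f e + g e).
Proof. by move=> Hf Hg; apply: (Oe_ext ltr01) (OeD Hf Hg) => e _; ring. Qed.

Lemma asymN n c f : asym n c f -> asym n (- c) (fun e => - f e).
Proof. by move=> Hf; apply: (Oe_ext ltr01) (OeN Hf) => e _; ring. Qed.

Lemma asymB n c d f g : asym n c f -> asym n d g -> asym n (c - d) (fun e => f e - g e).
Proof. by move=> Hf /asymN; exact: asymD. Qed.

Lemma asymM n m c d f g : asym n c f -> asym m d g -> asym (n + m) (c * d) (fun e => f e * g e).
Proof.
move=> Hf Hg.
have h1 := OeM Hf (asym_Oe Hg); have h2 := OeM (OeZ c (Oe_exp n)) Hg.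
rewrite addnS in h2; apply: (Oe_ext ltr01) (OeD h1 h2) => e _.
by rewrite exprD; ring.
Qed.

Lemma asym_cst c : asym 0 c (fun=> c).
Proof. by exists 0, 1; split=> // e _; rewrite expr0 mulr1 subrr normr0 mul0r. Qed.

Lemma asym_exp c n : asym n c (fun e => c * e ^+ n).
Proof. by exists 0, 1; split=> // e _; rewrite subrr normr0 mul0r. Qed.

Lemma asymZ k n c f : asym n c f -> asym n (k * c) (fun e => k * f e).
Proof. exact: asymM (asym_cst k). Qed.

Lemma asymX n c f : asym 0 c f -> asym 0 (c ^+ n) (fun e => f e ^+ n).
Proof.
move=> H; elim: n => [|n IH]; first exact: asym_cst.
rewrite exprS; apply: (asym_ext ltr01) (asymM H IH) => e _; by rewrite exprS.
Qed.

(** Transfers the sign of the limit polynomial at a sample point to the defect for small [e]. *)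
Lemma asym_sign n c f : c != 0 -> asym n c f ->
  exists2 e0, 0 < e0 & forall e, 0 < e < e0 -> 0 < f e * c.
Proof.
move=> c0 H; have nc : 0 < `|c| by rewrite normr_gt0.
have [e0 e00 He] := Oe_small nc H; exists e0 => // e /[dup] /andP[p0 _] /He h.
have E : f e * c = (f e - c * e ^+ n) * c + c ^+ 2 * e ^+ n by ring.
have : `|(f e - c * e ^+ n) * c| < `|c| * e ^+ n * `|c| by rewrite normrM ltr_pM2r.
rewrite mulrAC -expr2 real_normK ?num_real// E ltr_norml; lra.
Qed.

Lemma asymV c f : c != 0 -> asym 0 c f -> asym 0 c^-1 (fun e => (f e)^-1).
Proof.
move=> c0 H; have nc : 0 < `|c| / 2 by rewrite divr_gt0// normr_gt0.
have [e0 e00 He] := Oe_small nc H.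
have f0 e : 0 < e < e0 -> `|c| / 2 < `|f e|.
  move=> /He; rewrite expr0 !mulr1 => h.
  by have := ler_distD (f e) c 0; rewrite !subr0 distrC; lra.
have : Oe 1 (fun e => c^-1 * (f e)^-1 * (f e - c * e ^+ 0)).
  rewrite -[1%N]add0n; apply: OeM H; exists (`|c|^-1 * (`|c| / 2)^-1), e0; split=> //.
  move=> e /f0 h; rewrite expr0 mulr1 normrM !normfV ler_wpM2l ?invr_ge0//.
  by rewrite lef_pV2 ?posrE ?(lt_trans nc h)// ltW.
move=> /OeN; apply: (Oe_ext e00) => e /f0 h.
have fe : f e != 0 by rewrite -normr_gt0 (lt_trans nc h).
by rewrite expr0 !mulr1; field; rewrite c0 fe.
Qed.

Lemma ln_near1 (u : R) : `|u| <= 1 / 2 -> `|ln (1 + u) - u| <= 2 * u ^+ 2.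
Proof.
move=> /ler_normlP[u1 u2]; have p : 0 < 1 + u by lra.
have h1 : ln (1 + u) <= u by rewrite -ler_expR lnK ?posrE// expR_ge1Dx.
have h2 : - ln (1 + u) <= - u / (1 + u).
  rewrite -lnV ?posrE// -ler_expR lnK ?posrE ?invr_gt0//.
  apply: le_trans (expR_ge1Dx _); rewrite le_eqVlt; apply/orP; left; apply/eqP.
  by field; exact: lt0r_neq0.
have h3 : - u / (1 + u) = - u + u ^+ 2 / (1 + u) by field; exact: lt0r_neq0.
have h4 : u ^+ 2 / (1 + u) <= 2 * u ^+ 2.
  by rewrite ler_pdivrMr//; have := sqr_ge0 u; nra.
by rewrite ler_norml; have := sqr_ge0 u; lra.
Qed.

Lemma asym_ln n c f : (0 < n)%N -> asym n c f -> asym n c (fun e => ln (1 + f e)).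
Proof.
move=> n0 H; have Of := asym_Oe H; have h2 : 0 < 1 / 2 :> R by [].
have := Of; rewrite -{1}(prednK n0) => /(Oe_small h2)[e0 e00 He].
have : Oe n.+1 (fun e => ln (1 + f e) - f e).
  apply: (@Oe_le _ _ (fun e => 2 * (f e * f e)) (Num.min e0 1)); first by rewrite lt_min e00 ltr01.
    move=> e /andP[p0]; rewrite lt_min => /andP[h0 h1].
    rewrite [leRHS]ger0_norm; last by rewrite mulr_ge0// -expr2 sqr_ge0.
    apply: ln_near1; apply: le_trans (ltW (He e _)) _; first by rewrite p0.
    by rewrite ler_piMr// exprn_ile1 ?ltW.
  by apply: (@OeW _ (n + n)); [rewrite -addn1 leq_add2l|exact: OeZ (OeM Of Of)].
by move=> h; apply: (Oe_ext ltr01) (OeD h H) => e _; ring.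
Qed.

Lemma asym_expR c f : asym 0 c f -> asym 0 (expR c) (fun e => expR (f e)).
Proof.
move=> H; have h2 : 0 < 1 / 2 :> R by [].
have [e0 e00 He] := Oe_small h2 H.
apply: (@Oe_le _ _ (fun e => expR c * 2 * (f e - c * e ^+ 0)) e0) => //; last exact: OeZ H.
move=> e /He; rewrite expr0 !mulr1; set u := f e - c => hu.
have -> : expR (f e) - expR c = expR c * (expR u - 1) by rewrite /u expRD expRN; field; rewrite expR_eq0.
rewrite -mulrA !normrM ler_wpM2l//; rewrite (ger0_norm (ler0n _ 2)).
move: hu => /ltr_normlP[u1 u2].
have h1 := expR_ge1Dx u; have h3 := expR_ge1Dx (- u); rewrite expRN in h3.
have e0' := expR_gt0 u.
have h4 : expR u * (1 - u) <= 1.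
  by rewrite -[leRHS](mulfV (lt0r_neq0 e0')) ler_pM2l.
have [u0|u0] := leP 0 u.
  rewrite (ger0_norm u0) ger0_norm; nra.
rewrite (ltr0_norm u0) ler_norml; nra.
Qed.

End SmallParameter.

(** * Taylor expansion of the logarithmic primitive *)

Section LogExpansion.
Variable R : realType.
Local Notation C := R[i].
Implicit Types (a b z : C).

(* [- (a + b z) / (1 + a z + b z^2) = \sum_(j >= 1) log_coef a b j * z ^+ (j - 1)]. *)
Definition log_coef a b (j : nat) : C :=
  match j with
  | 1 => - a
  | 2 => a ^+ 2 - b
  | 3 => - a ^+ 3 + 2 * a * b
  | 4 => a ^+ 4 - 3 * a ^+ 2 * b + b ^+ 2
  | _ => 0
  end.

(** The integrand minus its cubic truncation is exactly [- (a e4 + b e3 + b e4 z) z^4 / D], where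
    [D = 1 + a z + b z^2]. This is at most [12 M^5 |z|^4], and integration adds one power. *)
Lemma log_primitive_expand a b P (M A x : R) : 1 <= M -> 0 <= A -> normc a <= M -> normc b <= M ->
  log_primitive a b P -> `|x| <= arc_radius M A ->
  normc (P x%:C - (log_coef a b 1 * x%:C + log_coef a b 2 * (x ^+ 2 / 2)%:C +
    log_coef a b 3 * (x ^+ 3 / 3)%:C + log_coef a b 4 * (x ^+ 4 / 4)%:C)) <= 12 * M ^+ 5 * `|x| ^+ 5.
Proof.
move=> M1 A0 aM bM HP xr.
have [na nb] : 0 <= normc a /\ 0 <= normc b by rewrite !normc_ge0.
pose e1 := log_coef a b 1; pose e2 := log_coef a b 2; pose e3 := log_coef a b 3; pose e4 := log_coef a b 4.
pose T z := (e1 + (e2 / 2 + (e3 / 3 + e4 / 4 * z) * z) * z) * z.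
have dT z : cderiv T z (e1 + e2 * z + e3 * z ^+ 2 + e4 * z ^+ 3).
  have d4 := cderivD (cderiv_cst (e3 / 3) z) (cderivM (cderiv_cst (e4 / 4) z) (cderiv_id z)).
  have d3 := cderivD (cderiv_cst (e2 / 2) z) (cderivM d4 (cderiv_id z)).
  have d2 := cderivM (cderivD (cderiv_cst e1 z) (cderivM d3 (cderiv_id z))) (cderiv_id z).
  have E : e1 + e2 * z + e3 * z ^+ 2 + e4 * z ^+ 3 =
    (0 + ((0 + ((0 + (0 * z + e4 / 4 * 1)) * z + (e3 / 3 + e4 / 4 * z) * 1)) * z +
       (e2 / 2 + (e3 / 3 + e4 / 4 * z) * z) * 1)) * z +
    (e1 + (e2 / 2 + (e3 / 3 + e4 / 4 * z) * z) * z) * 1 by field; rewrite ?pnatr_eq0.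
  by rewrite E.
pose df z := - (a + b * z) / (1 + a * z + b * z ^+ 2) - (e1 + e2 * z + e3 * z ^+ 2 + e4 * z ^+ 3).
have TE : T x%:C = e1 * x%:C + e2 * (x ^+ 2 / 2)%:C + e3 * (x ^+ 3 / 3)%:C + e4 * (x ^+ 4 / 4)%:C.
  by rewrite /T !rmorphM /= !fmorphV /= !rmorph_nat; field; rewrite ?pnatr_eq0.
rewrite -/e1 -/e2 -/e3 -/e4 -TE.
have T0 : T 0 = 0 by rewrite /T mulr0.
have hz (u : R) : 0 <= u <= 1 -> 0 + u%:C * x%:C = (u * x)%:C.
  by move=> _; rewrite add0r rmorphM.
have nz (u : R) : 0 <= u <= 1 -> normc (u * x)%:C <= `|x|.
  by move=> /andP[u0 u1]; rewrite normc_real normrM ger0_norm// ler_piMl.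
have := @cderiv_lipschitz R (fun z => P z - T z) df 0 x%:C (12 * M ^+ 5 * `|x| ^+ 4).
rewrite T0 HP.1 !subr0 normc_real; have -> : 12 * M ^+ 5 * `|x| ^+ 5 = 12 * M ^+ 5 * `|x| ^+ 4 * `|x| by ring.
apply.
  move=> u /[dup] u01 /nz ux; rewrite hz//.
  have dN := cderivM (cderiv_cst (-1) (u * x)%:C) (dT (u * x)%:C); rewrite mul0r add0r mulN1r in dN.
  have := cderivD (dP M1 A0 aM bM HP (le_trans ux xr)) dN.
  by apply: (cderiv_local ltr01) => w _; rewrite mulN1r.
move=> u /[dup] u01 /nz ux; rewrite hz//; set z := (u * x)%:C in ux *.
have zr := le_trans ux xr; have Dn := arc_den_neq0 M1 A0 aM bM zr.
have z0 := normc_ge0 z.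
set D := 1 + a * z + b * z ^+ 2 in Dn.
have -> : df z = - (a * e4 + b * e3 + b * e4 * z) * z ^+ 4 / D.
  rewrite /df -/D; set T' := (X in _ - X); rewrite -[T' in LHS](mulfK Dn) -mulrBl; congr (_ / _).
  by rewrite /T' /D /e1 /e2 /e3 /e4 /log_coef; ring.
have rho16 : normc z <= 1 / 16.
  apply: le_trans zr _; rewrite /arc_radius -[X in X <= _]div1r ler_pdivrMr ?mulr_gt0//; nra.
have D78 : 7 / 8 <= normc D.
  have := arc_small M1 A0 aM bM zr; have := normc_le_dist 1 D.
  have -> : 1 - D = - (a * z + b * z ^+ 2) by rewrite /D; ring.
  rewrite normcN normc1; have := ler_normcD (a * z) (b * z ^+ 2).
  have : (8 * (1 + A))^-1 <= 1 / 8 by rewrite div1r lef_pV2 ?posrE ?mulr_gt0//; lra.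
  lra.
have n3 : normc 3 = 3 :> R.
  by rewrite -[3]/(3%:R) -(rmorph_nat (real_complex R)) normc_real ger0_norm.
have n2 : normc 2 = 2 :> R.
  by rewrite -[2]/(2%:R) -(rmorph_nat (real_complex R)) normc_real ger0_norm.
have M0 : 0 <= M by lra.
have pw (c : C) (n : nat) : normc c <= M -> normc (c ^+ n) <= M ^+ n.
  by move=> h; rewrite normcX lerXn2r// nnegrE normc_ge0.
have MS (n m : nat) : (n <= m)%N -> M ^+ n <= M ^+ m by move=> nm; exact: ler_weXn2l.
have mul2 (c c' : C) (k l : R) : normc c <= k -> normc c' <= l -> normc (c * c') <= k * l.
  by move=> h1 h2; rewrite normcM ler_pM ?normc_ge0.
have b3 : normc e3 <= 3 * M ^+ 3.
  have h1 : normc (- a ^+ 3) <= M ^+ 3 by rewrite normcN pw.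
  have h2 : normc (2 * a * b) <= 2 * M * M by apply: (mul2 _ _ _ _) => //; apply: (mul2 _ _ _ _); rewrite ?n2.
  have := ler_normcD (- a ^+ 3) (2 * a * b); have := MS 2 3 isT; rewrite /e3 /=; lra.
have b4 : normc e4 <= 5 * M ^+ 4.
  have h2 : normc (3 * a ^+ 2 * b) <= 3 * M ^+ 2 * M.
    by apply: (mul2 _ _ _ _) => //; apply: (mul2 _ _ _ _); rewrite ?n3// pw.
  have := ler_normcD (a ^+ 4 - 3 * a ^+ 2 * b) (b ^+ 2).
  have := ler_normcB (a ^+ 4) (3 * a ^+ 2 * b); have := pw a 4 aM; have := pw b 2 bM.
  have := MS 3 4 isT; have := MS 2 4 isT.
  have E3 : 3 * M ^+ 2 * M = 3 * M ^+ 3 by ring.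
  by rewrite E3 in h2; rewrite /e4 /=; lra.
have nr : normc (a * e4 + b * e3 + b * e4 * z) <= 10 * M ^+ 5.
  have h1 := mul2 _ _ _ _ aM b4; have h2 := mul2 _ _ _ _ bM b3.
  have h3 := mul2 _ _ _ _ (mul2 _ _ _ _ bM b4) rho16.
  have := ler_normcD (a * e4 + b * e3) (b * e4 * z); have := ler_normcD (a * e4) (b * e3).
  have e5 : M ^+ 5 = M * M ^+ 4 by rewrite exprS.
  have e4' : M ^+ 4 = M * M ^+ 3 by rewrite exprS.
  have := MS 4 5 isT; have := exprn_ge0 5 M0; lra.
rewrite normcM normcV ler_pdivrMr; last by lra.
rewrite (normcM (- _) (z ^+ 4)) normcN.
have zx : normc (z ^+ 4) <= `|x| ^+ 4 by rewrite normcX lerXn2r// nnegrE.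
apply: le_trans (ler_pM (normc_ge0 _) (normc_ge0 _) nr zx) _.
have : 0 <= M ^+ 5 * `|x| ^+ 4 by rewrite mulr_ge0 ?exprn_ge0.
nra.
Qed.

End LogExpansion.

(** * Leading term of the closing defect at the scale [e] *)

Section DefectExpansion.
Variable R : realType.
Local Notation C := R[i].
Implicit Types (z w : C) (s : R).

(** This is [Im ((s - i) z)]. *)
Definition phase_form s z : R := s * Im z - Re z.

Lemma phase_formD s z w : phase_form s (z + w) = phase_form s z + phase_form s w.
Proof. by rewrite /phase_form Re_add Im_add; ring. Qed.

Lemma phase_formB s z w : phase_form s (z - w) = phase_form s z - phase_form s w.
Proof. by rewrite phase_formD /phase_form Re_opp Im_opp; ring. Qed.

Lemma phase_formM s z (x : R) : phase_form s (z * x%:C) = phase_form s z * x.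
Proof. by rewrite /phase_form Re_mulRr Im_mulRr; ring. Qed.

Lemma phase_form_le s z (A : R) : `|s| <= A -> `|phase_form s z| <= (A + 1) * normc z.
Proof.
move=> sA; rewrite (le_trans (ler_normB _ _))// normrM mulrDl mul1r lerD ?Re_le_normc//.
by rewrite ler_pM// Im_le_normc.
Qed.

Variables (a' b' : C) (P' : C -> C) (M A : R) (y' : R -> R).
Hypothesis bd' : arc_bounds a' b' (-1) M A.
Hypothesis HP' : log_primitive a' b' P'.
Hypothesis Hy' : forall x, 0 < x <= arc_range M A -> half_map_at a' b' P' (-1) M A y' x.
(** Contraction of the lower half turn with [s' = -1]: the arc through [- p] ends near [k p]. *)
Let k : R := expR (- pi).

Lemma half_map_log p : 0 < p <= arc_range M A ->
  ln (- y' p) - ln p + pi = phase_form (-1) (P' (y' p)%:C) - phase_form (-1) (P' p%:C).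
Proof.
move=> pr; have /andP[p0 _] := pr; have [/andP[_ y0] _ h _] := Hy' pr.
by move: h; rewrite /arc_phase ltr0_norm// gtr0_norm// /phase_form; lra.
Qed.

(** The terms in [P'] change [ln (- y' p / p) = - pi] by at most 1/2, so the end of the arc remains
    comparable with [p]. *)
Lemma half_map_ge p : 0 < p <= arc_range M A -> p * expR (- pi - 1) <= - y' p.
Proof.
move=> pr; have /andP[p0 pr'] := pr; have [/andP[y1 y0] _ _ _] := Hy' pr.
have [M1 A0 aM bM _] := bd'; have rho0 := arc_radius_gt0 M1 A0; have rle := arc_range_le bd'.
have s1 : `|(-1 : R)| <= 1 by rewrite normrN normr1.
have h1 : normc (P' p%:C) <= 1 / 8 by apply: (P_small M1 A0 aM bM HP'); rewrite normc_real gtr0_norm//; lra.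
have h2 : normc (P' (y' p)%:C) <= 1 / 8 by apply: (P_small M1 A0 aM bM HP'); rewrite normc_real ltr0_norm//; lra.
have := half_map_log pr; have := phase_form_le (P' p%:C) s1; have := phase_form_le (P' (y' p)%:C) s1.
rewrite !ler_norml => /andP[g1 g2] /andP[g3 g4] E.
have yp : 0 < - y' p by rewrite oppr_gt0.
by rewrite -{1}(lnK (x := p)) ?posrE// -expRD -[leRHS](lnK (x := - y' p)) ?posrE// ler_expR; lra.
Qed.

Lemma admissible_cone (t : R -> R) (l u : R) : 0 < l -> Oe 2 t ->
  exists2 e0, 0 < e0 & forall e p, 0 < e < e0 -> l * e <= p <= u * e ->
    admissible (t e) M A y' p.
Proof.
move=> l0 Ht; have g0 : 0 < expR (- pi - 1) :> R by exact: expR_gt0.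
have gl : 0 < l * expR (- pi - 1) :> R by rewrite mulr_gt0.
have g1 : expR (- pi - 1) <= 1 :> R by rewrite -[leRHS]expR0 ler_expR; have := pi_ge0 R; lra.
have [e1 e10 H] := Oe_small gl Ht.
have r0 := arc_range_gt0 bd'.
have u1 : 0 < `|u| + 1 by rewrite ltr_wpDl.
exists (Num.min e1 (arc_range M A / (`|u| + 1))); first by rewrite lt_min e10 divr_gt0.
move=> e p /andP[e0]; rewrite lt_min => /andP[ee1]; rewrite ltr_pdivlMr// => er /andP[p1 p2].
have p0 : 0 < p by apply: lt_le_trans p1; rewrite mulr_gt0.
have uu : u * e <= `|u| * e by rewrite ler_pM2r// ler_norm.
have pr : 0 < p < arc_range M A by apply/andP; split=> //; lra.
have := H e; rewrite e0 ee1 expr1 => /(_ isT) h.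
have h1 : l * expR (- pi - 1) * e <= p * expR (- pi - 1).
  by rewrite mulrAC ler_pM2r.
have h2 : p * expR (- pi - 1) <= p by rewrite ler_piMr// ltW.
split=> //; first by lra.
have := half_map_ge (p := p); rewrite p0 ltW; last by case/andP: pr.
by move=> /(_ isT); lra.
Qed.

Variables (a b : R -> C) (P : R -> C -> C) (m : nat) (A0 B0 e1 : R).
Hypothesis m0 : (0 < m <= 4)%N.
Hypothesis e10 : 0 < e1.
Hypothesis bds : forall e, 0 < e < e1 -> arc_bounds (a e) (b e) (1 + A0 * e ^+ m) M A.
Hypothesis A1 : 1 <= A.
Hypothesis HP : forall e, 0 < e < e1 -> log_primitive (a e) (b e) (P e).
Let t e := B0 * e ^+ m.+1.

(* Up to [(p ^+ j +- X ^+ j) / j], the term of degree [j] of the closing defect, [X] being the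
   other end of the lower arc through [- p]. *)
Definition defect_coef (j : nat) (e : R) : R :=
  phase_form 1 (log_coef (a e) (b e) j) - (-1) ^+ j * phase_form (-1) (log_coef a' b' j).

Variable c : nat -> R.
Hypothesis Hc : forall j, (1 <= j <= 4)%N -> asym m (c j) (fun e => defect_coef j e * e ^+ j).

(** In order: the change of [s], the two logarithms shifted by [t], and the Taylor terms at
    [p = e xi] and [X], close to [k p]. In degree [j] the two ends of an arc enter with the signs of
    [x^j] and [(- x)^j], hence the factors [1 + k^j] for odd and [1 - k^j] for even [j]. *)
Definition defect_limit (xi : R) : R :=
  A0 * pi - B0 * (1 + k^-1) / xi - c 1 * (xi + xi * k) + c 2 * (xi ^+ 2 - (xi * k) ^+ 2) / 2
  - c 3 * (xi ^+ 3 + (xi * k) ^+ 3) / 3 + c 4 * (xi ^+ 4 - (xi * k) ^+ 4) / 4.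

Variable xi : R.
Hypothesis xi0 : 0 < xi.
Let X e := - y' (e * xi).
Let chi e := X e / e.

Let Ot : Oe 2 t.
Proof.
apply: (OeW (m := m.+1)); last exact: OeZ (Oe_exp R m.+1).
by case/andP: m0.
Qed.

Let adm : exists2 e0, 0 < e0 & forall e, 0 < e < e0 ->
  [/\ 0 < e < e1, admissible (t e) M A y' (e * xi), 0 < X e,
      `|X e| <= arc_radius M A & `|e * xi| <= arc_radius M A].
Proof.
have [e0 e00 H] := @admissible_cone t xi xi xi0 Ot.
exists (Num.min e0 e1) => [|e /andP[p0]]; first by rewrite lt_min e00.
rewrite lt_min => /andP[h0 h1].
have ad : admissible (t e) M A y' (e * xi) by apply: H; rewrite ?p0// mulrC lexx.
have [/andP[g1 g2] _ g3] := ad; have X0 : 0 < X e by exact: le_lt_trans (normr_ge0 _) g3.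
have [|/andP[y1 y2] _ _ _] := Hy' (x := e * xi); first by rewrite g1 ltW.
have [M1 A00 _ _ _] := bd'; have rho0 := arc_radius_gt0 M1 A00; have rle := arc_range_le bd'.
split=> //; first by rewrite p0.
- by rewrite (gtr0_norm X0) /X; lra.
- by rewrite (gtr0_norm g1); lra.
Qed.

Let OX : Oe 1 X.
Proof.
have [e0 e00 H] := adm.
apply: (@Oe_le _ _ _ (fun e => (4 * arc_growth A * xi) * e ^+ 1) e0) => //; last exact: OeZ (Oe_exp R 1).
move=> e /H[_ [/andP[g1 g2] _ _] X0 _ _].
have [|_ h _ _] := Hy' (x := e * xi); first by rewrite g1 ltW.
rewrite expr1 normrN (le_trans h)//; apply: le_trans (ler_norm _); lra.
Qed.

Let Op : Oe 1 (fun e => e * xi).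
Proof. by apply: (Oe_ext ltr01) (OeZ xi (Oe_exp R 1)) => e _; rewrite expr1 mulrC. Qed.

Let half_log : asym 0 (- pi) (fun e => ln (X e) - ln (e * xi)).
Proof.
have [e0 e00 H] := adm; have [M1 A00 aM bM sA] := bd'.
have s1 : `|(-1 : R)| <= 1 by rewrite normrN normr1.
apply: (@Oe_le _ _ _ (fun e => 4 * M * (X e + e * xi)) e0) => //.
  move=> e /H[_ [/andP[g1 g2] _ _] X0 Xr pr].
  have pr' : 0 < e * xi <= arc_range M A by rewrite g1 ltW.
  rewrite expr0 mulr1 opprK /X half_map_log// -phase_formB.
  apply: le_trans (phase_form_le _ s1) _.
  have h1 : normc (y' (e * xi))%:C <= arc_radius M A by rewrite normc_real -normrN.
  have h2 : normc (e * xi)%:C <= arc_radius M A by rewrite normc_real.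
  have := P_lipschitz M1 A00 aM bM HP' h2 h1; rewrite -rmorphB normc_real.
  have : `|y' (e * xi) - e * xi| = X e + e * xi.
    by rewrite ltr0_norm /X ?opprB; [ring|move: X0; rewrite /X; lra].
  move=> -> h; have S0 : 0 <= X e + e * xi by rewrite addr_ge0 ?ltW.
  have M40 : 0 <= 4 * M * (X e + e * xi) by rewrite mulr_ge0//; lra.
  by rewrite (ger0_norm M40); lra.
exact: OeZ (OeD OX Op).
Qed.

Let asym_chi : asym 0 (xi * k) chi.
Proof.
have [e0 e00 H] := adm.
apply: (asym_ext e00) (asymZ xi (asym_expR half_log)) => e /H[/andP[ep _] [/andP[g1 g2] _ _] X0 _ _].
by rewrite expRB !lnK ?posrE// /chi; field; rewrite !lt0r_neq0.
Qed.

Let k0 : 0 < k. Proof. exact: expR_gt0. Qed.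

Let log_shift_X : asym m (- (B0 / (xi * k))) (fun e => ln (X e - t e) - ln (X e)).
Proof.
have [e0 e00 H] := adm; have xk : xi * k != 0 by rewrite mulf_neq0// lt0r_neq0.
have h := asymN (asymM (asym_exp B0 m) (asymV xk asym_chi)); rewrite addn0 in h.
have [m1 _] := andP m0; apply: (asym_ext e00) (asym_ln m1 h).
move=> e /H[/andP[ep _] [_ _ tX] X0 _ _].
have X0' := lt0r_neq0 X0; have ep' := lt0r_neq0 ep.
have p1 : 0 < X e - t e by move: tX; rewrite ltr_norml -/(X e); lra.
rewrite -ln_div ?posrE//; congr ln; rewrite /chi /t exprS; field; by rewrite X0' ep'.
Qed.

Let log_shift_p : asym m (B0 / xi) (fun e => ln (e * xi + t e) - ln (e * xi)).
Proof.
have [e0 e00 H] := adm; have [m1 _] := andP m0.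
apply: (asym_ext e00) (asym_ln m1 (asym_exp (B0 / xi) m)).
move=> e /H[/andP[ep _] [/andP[g1 _] tp _] X0 _ _].
have p1 : 0 < e * xi + t e by move: tp; rewrite ltr_norml; lra.
rewrite -ln_div ?posrE//; congr ln; rewrite /t exprS; field.
by rewrite !lt0r_neq0.
Qed.

(** In the terms of [P], dropping [t] costs [O(t) = O(e^(m+1))], and replacing [s] by 1 costs
    [A0 e^m] times [P (sg e) = O(e)]. *)
Let primitive_shift (sg : R -> R) e0 : 0 < e0 -> Oe 1 sg ->
  (forall e, 0 < e < e0 -> [/\ 0 < e < e1, `|sg e| <= arc_radius M A & `|sg e - t e| <= arc_radius M A]) ->
  Oe m.+1 (fun e => phase_form (1 + A0 * e ^+ m) (P e (sg e - t e)%:C) - phase_form 1 (P e (sg e)%:C)).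
Proof.
move=> e00 Osg H.
have O1 : Oe m.+1 (fun e => phase_form (1 + A0 * e ^+ m) (P e (sg e - t e)%:C - P e (sg e)%:C)).
  apply: (@Oe_le _ _ _ (fun e => (A + 1) * (2 * M) * t e) e0) => //; last first.
    by apply: OeZ; exact: OeZ (Oe_exp R m.+1).
  move=> e /H[ee1 s1 s2]; have [M1 A00 aM bM sA] := bds ee1.
  apply: le_trans (phase_form_le _ sA) _.
  have n1 : normc (sg e)%:C <= arc_radius M A by rewrite normc_real.
  have n2 : normc (sg e - t e)%:C <= arc_radius M A by rewrite normc_real.
  have := P_lipschitz M1 A00 aM bM (HP ee1) n1 n2.
  have tE : sg e - t e - sg e = - t e by ring.
  rewrite -rmorphB normc_real tE normrN => h.
  have AM0 : 0 <= (A + 1) * (2 * M) by rewrite mulr_ge0//; lra.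
  by rewrite normrM (ger0_norm AM0) -mulrA ler_wpM2l//; lra.
have O2 : Oe m.+1 (fun e => A0 * e ^+ m * Im (P e (sg e)%:C)).
  rewrite -addn1; apply: OeM; first exact: OeZ (Oe_exp R m).
  apply: (@Oe_le _ _ _ (fun e => 2 * M * sg e) e0) => //; last exact: OeZ.
  move=> e /H[ee1 s1 _]; have [M1 A00 aM bM sA] := bds ee1.
  apply: le_trans (Im_le_normc _) _.
  have n0 : normc 0 <= arc_radius M A by rewrite normc0 ltW// arc_radius_gt0.
  have n1 : normc (sg e)%:C <= arc_radius M A by rewrite normc_real.
  have := P_lipschitz M1 A00 aM bM (HP ee1) n0 n1; rewrite (HP ee1).1 !subr0 normc_real.
  by rewrite normrM (ger0_norm (_ : 0 <= 2 * M))//; lra.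
by apply: (Oe_ext ltr01) (OeD O1 O2) => e _; rewrite phase_formB /phase_form; ring.
Qed.

(** The remainder of order 5 is acceptable because [m <= 4]. *)
Let expand (a1 b1 : R -> C) (P1 : R -> C -> C) (s1 : R) (sg : R -> R) e0 : 0 < e0 -> Oe 1 sg ->
  `|s1| <= 1 ->
  (forall e, 0 < e < e0 -> [/\ normc (a1 e) <= M, normc (b1 e) <= M, log_primitive (a1 e) (b1 e) (P1 e) &
     `|sg e| <= arc_radius M A]) ->
  Oe m.+1 (fun e => phase_form s1 (P1 e (sg e)%:C) -
    (phase_form s1 (log_coef (a1 e) (b1 e) 1) * sg e +
     phase_form s1 (log_coef (a1 e) (b1 e) 2) * (sg e ^+ 2 / 2) +
     phase_form s1 (log_coef (a1 e) (b1 e) 3) * (sg e ^+ 3 / 3) +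
     phase_form s1 (log_coef (a1 e) (b1 e) 4) * (sg e ^+ 4 / 4))).
Proof.
move=> e00 Osg s1n H; have [M1 A00 _ _ _] := bd'.
have O5 : Oe 5 (fun e => sg e ^+ 5).
  have h := OeM Osg (OeM Osg (OeM Osg (OeM Osg Osg))).
  by apply: (Oe_ext ltr01) h => e _; ring.
apply: (@OeW _ _ 5); first by case/andP: m0.
apply: (@Oe_le _ _ _ (fun e => 24 * M ^+ 5 * sg e ^+ 5) e0) => //; last exact: OeZ.
move=> e /H[aM bM hP sr].
have := log_primitive_expand M1 A00 aM bM hP sr.
rewrite -!phase_formM -!phase_formD -phase_formB => h.
apply: le_trans (phase_form_le _ s1n) _.
rewrite normrM normrX ger0_norm; last by rewrite mulr_ge0// exprn_ge0//; lra.
lra.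
Qed.

(** The lower arc gives [ln X - ln p = - pi] plus terms in [P'], and [s pi = pi + A0 pi e^m]: the
    two [pi] cancel, and what remains is of order [e^m]. *)
Lemma closing_defect_asym :
  asym m (defect_limit xi) (fun e => closing_defect (P e) (t e) y' (1 + A0 * e ^+ m) (e * xi)).
Proof.
have [e0 e00 H] := adm.
have s1 : `|(1 : R)| <= 1 by rewrite normr1.
have s2 : `|(-1 : R)| <= 1 by rewrite normrN normr1.
have [M1 A00 aM' bM' _] := bd'.
have ON : Oe 1 (fun e => - (e * xi)) := OeN Op.
have OXN : Oe 1 (fun e => - X e) := OeN OX.
have bd0 e : 0 < e < e0 -> arc_bounds (a e) (b e) 0 M A.
  by move=> /H[/bds[h1 h2 h3 h4 _] _ _ _ _]; split; rewrite ?normr0.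
have shX : Oe m.+1 (fun e => phase_form (1 + A0 * e ^+ m) (P e (X e - t e)%:C) - phase_form 1 (P e (X e)%:C)).
  apply: (primitive_shift e00 OX) => e /[dup] /bd0 b0 /H[ee1 ad X0 Xr _]; split=> //.
  by have [/andP[g1 g2] _ _] := admissible_bounds b0 Hy' ad; rewrite gtr0_norm.
have shp : Oe m.+1 (fun e => phase_form (1 + A0 * e ^+ m) (P e (- (e * xi) - t e)%:C) -
    phase_form 1 (P e (- (e * xi))%:C)).
  apply: (primitive_shift e00 ON) => e /[dup] /bd0 b0 /H[ee1 ad X0 _ pr]; split=> //.
    by rewrite normrN.
  by have [_ /andP[g1 g2] _] := admissible_bounds b0 Hy' ad; rewrite ltr0_norm// lerNl.
have exX := @expand a b P 1 X e0 e00 OX s1 _.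
have {}exX := exX (fun e h => let: And5 hh _ _ hX _ := H e h in
   let: And5 _ _ h3 h4 _ := bds hh in And4 h3 h4 (HP hh) hX).
have exp := @expand a b P 1 (fun e => - (e * xi)) e0 e00 ON s1 _.
have {}exp : _ := exp (fun e h => let: And5 hh _ _ _ hp := H e h in
   let: And5 _ _ h3 h4 _ := bds hh in And4 h3 h4 (HP hh) (eq_ind_r (fun u => is_true (u <= _)) hp (normrN _))).
have exX' := @expand (fun=> a') (fun=> b') (fun=> P') (-1) (fun e => - X e) e0 e00 OXN s2 _.
have {}exX' := exX' (fun e h => let: And5 hh _ _ hX _ := H e h in
   And4 aM' bM' HP' (eq_ind_r (fun u => is_true (u <= _)) hX (normrN _))).
have exp' := @expand (fun=> a') (fun=> b') (fun=> P') (-1) (fun e => e * xi) e0 e00 Op s2 _.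
have {}exp' := exp' (fun e h => let: And5 hh _ _ _ hp := H e h in And4 aM' bM' HP' hp).
have small := asym0 (OeD (OeD (OeN shX) shp) (OeD (OeD exp (OeN exX)) (OeD exX' (OeN exp')))).
have ax := asym_cst xi.
have t1 := asymM (Hc (j := 1) isT) (asymD ax asym_chi).
have t2 := asymM (Hc (j := 2) isT) (asymB (asymX 2 ax) (asymX 2 asym_chi)).
have t3 := asymM (Hc (j := 3) isT) (asymD (asymX 3 ax) (asymX 3 asym_chi)).
have t4 := asymM (Hc (j := 4) isT) (asymB (asymX 4 ax) (asymX 4 asym_chi)).
rewrite !addn0 in t1 t2 t3 t4.
have logs := asymB log_shift_X log_shift_p.
have main := asymD (asymD (asymB (asymZ 2^-1 t2) t1) (asymB (asymZ 4^-1 t4) (asymZ 3^-1 t3)))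
  (asymD (asymD (asym_exp (A0 * pi) m) logs) small).
have -> : defect_limit xi = 2^-1 * (c 2 * (xi ^+ 2 - (xi * k) ^+ 2)) - c 1 * (xi + xi * k)
    + (4^-1 * (c 4 * (xi ^+ 4 - (xi * k) ^+ 4)) - 3^-1 * (c 3 * (xi ^+ 3 + (xi * k) ^+ 3)))
    + (A0 * pi + (- (B0 / (xi * k)) - B0 / xi) + 0).
  by rewrite /defect_limit; field; rewrite !lt0r_neq0.
apply: (asym_ext e00) main => e /H[/andP[ep _] ad X0 _ _].
cbv beta; have [/andP[g1 g2] tp tX] := ad.
have pr' : 0 < e * xi <= arc_range M A by rewrite g1 ltW.
have lg := half_map_log pr'; rewrite -/(X e) in lg.
have XtE : X e - t e = - y' (e * xi) - t e by [].
rewrite /closing_defect /arc_phase -XtE -/(phase_form _ _) -/(phase_form _ (P e (- (e * xi) - t e)%:C)).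
have XE : X e = e * chi e by rewrite /chi mulrC divfK// lt0r_neq0.
have p1 : 0 < X e - t e by move: tX; rewrite ltr_norml -/(X e); lra.
have p2 : - (e * xi) - t e < 0 by move: tp; rewrite ltr_norml; lra.
have qE : - (- (e * xi) - t e) = e * xi + t e by ring.
rewrite (gtr0_norm p1) (ltr0_norm p2) qE.
have yE : y' (e * xi) = - X e by rewrite /X opprK.
rewrite yE in lg.
have -> : ln (X e) = ln (e * xi) - pi + (phase_form (-1) (P' (- X e)%:C) - phase_form (-1) (P' (e * xi)%:C)) by lra.
rewrite /defect_coef.
move: (phase_form _ (P e (X e - t e)%:C)) (phase_form _ (P e (- (e * xi) - t e)%:C)) => u1 u2.
move: (phase_form _ (P e (X e)%:C)) (phase_form _ (P e (- (e * xi))%:C)) => u3 u4.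
move: (phase_form _ (P' (- X e)%:C)) (phase_form _ (P' (e * xi)%:C)) => u5 u6.
rewrite XE.
do 4 (move: (phase_form _ (log_coef (a e) (b e) _)) => ?).
do 4 (move: (phase_form _ (log_coef a' b' _)) => ?).
by field.
Qed.

End DefectExpansion.

Section WeightedBifurcation.
Variable R : realType.
Local Notation C := R[i].

Lemma eventually_all (n : nat) (Q : nat -> R -> Prop) :
  (forall i, (i < n)%N -> exists2 e0, 0 < e0 & forall e, 0 < e < e0 -> Q i e) ->
  exists2 e0, 0 < e0 & forall e, 0 < e < e0 -> forall i, (i < n)%N -> Q i e.
Proof.
elim: n => [|n IH] H; first by exists 1.
have [e0 e00 H0] := IH (fun i h => H i (ltnW h)); have [e1 e10 H1] := H n (ltnSn n).
exists (Num.min e0 e1) => [|e /andP[p0]]; first by rewrite lt_min e00.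
rewrite lt_min => /andP[h0 h1] i; rewrite ltnS leq_eqVlt => /predU1P[->|ln].
  by apply: H1; rewrite p0.
by apply: H0; rewrite ?p0.
Qed.

(** The hypothesis on [c] gives the coefficient of degree [j] the order [e^(m - j)], so that at
    [p = e xi] all the terms have the order [e^m]. The samples are half-integers because the roots
    will be [1, ..., k]. *)
Lemma bifurcating_of_weights (a' b' a0 b0 : C) (a b : R -> C) (m k np nm : nat) (A0 B0 e2 : R)
    (c : nat -> R) :
  (0 < m <= 4)%N -> (0 < k)%N -> 0 < e2 ->
  Oe 1 (fun e => normc (a e - a0)) -> Oe 1 (fun e => normc (b e - b0)) ->
  (forall e s t, 0 < e < e2 -> has_degrees np nm (two_halves (a e) (b e) s t a' b' (-1))) ->
  (forall j, (1 <= j <= 4)%N -> asym m (c j) (fun e => defect_coef a' b' a b j e * e ^+ j)) ->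
  (forall i, (i < k)%N ->
     defect_limit A0 B0 c (i%:R + 1 / 2) * defect_limit A0 B0 c (i.+1%:R + 1 / 2) < 0) ->
  bifurcating np nm k (two_halves a0 b0 1 0 a' b' (-1)).
Proof.
move=> m04 k0 e20 aO bO deg Hc alt; have /andP[m0 m4] := m04.
have [P' HP'] := exists_log_primitive a' b'.
have /choice[P HP] : forall e, exists P, log_primitive (a e) (b e) P.
  by move=> e; exact: exists_log_primitive.
have [na0 nb0 na' nb'] : [/\ 0 <= normc a0, 0 <= normc b0, 0 <= normc a' & 0 <= normc b'].
  by split; exact: normc_ge0.
pose M := 2 + normc a0 + normc b0 + normc a' + normc b'.
have s1n : `|(-1 : R)| = 1 by rewrite normrN normr1.
have bd' : arc_bounds a' b' (-1) M 2 by rewrite /M; split; rewrite ?s1n//; lra.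
have [y' Hy'] := half_map_exists bd' HP'.
pose t e := B0 * e ^+ m.+1.
have Ot : Oe 1 t by apply: (@OeW _ _ m.+1) => //; exact: OeZ (Oe_exp R m.+1).
have Ot2 : Oe 2 t by apply: (@OeW _ _ m.+1) => //; exact: OeZ (Oe_exp R m.+1).
have Os : Oe 1 (fun e => A0 * e ^+ m) by apply: (@OeW _ _ m) => //; exact: OeZ (Oe_exp R m).
have closeall d : 0 < d -> exists2 e0, 0 < e0 & forall e, 0 < e < e0 ->
    [/\ normc (a e - a0) < d, normc (b e - b0) < d, `|A0 * e ^+ m| < d & `|t e| < d].
  move=> d0; have [h1 h10 H1] := Oe_small d0 aO; have [h2 h20 H2] := Oe_small d0 bO.
  have [h3 h30 H3] := Oe_small d0 Os; have [h4 h40 H4] := Oe_small d0 Ot.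
  exists (Num.min (Num.min h1 h2) (Num.min h3 h4)); first by rewrite !lt_min h10 h20 h30.
  move=> e /andP[p0]; rewrite !lt_min => /andP[/andP[l1 l2] /andP[l3 l4]].
  have := H1 e; have := H2 e; have := H3 e; have := H4 e.
  rewrite p0 l1 l2 l3 l4 !expr0 !mulr1 !(ger0_norm (normc_ge0 _)).
  by move=> /(_ isT) ? /(_ isT) ? /(_ isT) ? /(_ isT) ?.
have [e1 e10 H1] := closeall 1 ltr01.
have bds e : 0 < e < e1 -> arc_bounds (a e) (b e) (1 + A0 * e ^+ m) M 2.
  move=> /H1[h1 h2 h3 _]; have := normc_le_dist (a e) a0; have := normc_le_dist (b e) b0.
  have := ler_normD 1 (A0 * e ^+ m); rewrite normr1 /M => g1 g2 g3.
  by split=> //; lra.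
have key i : (i < k.+1)%N -> exists2 e0, 0 < e0 & forall e, 0 < e < e0 ->
    0 < closing_defect (P e) (t e) y' (1 + A0 * e ^+ m) (e * (i%:R + 1 / 2)) *
      defect_limit A0 B0 c (i%:R + 1 / 2).
  move=> im; have x0 : 0 < i%:R + 1 / 2 :> R by have : 0 <= i%:R :> R by []; lra.
  apply: asym_sign (closing_defect_asym bd' HP' Hy' B0 m04 e10 bds (fun e _ => HP e) Hc x0).
  have [im'|im'] := ltnP i k; first by have := alt i im'; apply: contraTneq => ->; rewrite mul0r ltxx.
  have -> : i = k by apply/eqP; rewrite eqn_leq im' -ltnS im.
  have := alt k.-1; rewrite prednK// leqnn => /(_ isT).
  by apply: contraTneq => ->; rewrite mulr0 ltxx.
have [e3 e30 H3] := eventually_all key.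
have h2 : 0 < 1 / 2 :> R by [].
have [e4 e40 H4] := admissible_cone bd' HP' Hy' (k%:R + 1 / 2) h2 Ot2.
apply: (bifurcating_of_alternation bd' HP' Hy'); rewrite ?normr1; try by rewrite /M; lra.
move=> d d0; have [e5 e50 H5] := closeall d d0.
have mm0 : 0 < k%:R + 1 / 2 :> R by have : 0 <= k%:R :> R by []; lra.
pose e := Num.min (Num.min e2 e3) (Num.min (Num.min e4 e5) (d / (k%:R + 1 / 2))) / 2.
have emin0 : 0 < Num.min (Num.min e2 e3) (Num.min (Num.min e4 e5) (d / (k%:R + 1 / 2))).
  by rewrite !lt_min e20 e30 e40 e50 divr_gt0.
have : e < Num.min (Num.min e2 e3) (Num.min (Num.min e4 e5) (d / (k%:R + 1 / 2))).
  by rewrite /e; lra.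
have e0 : 0 < e by rewrite divr_gt0.
clearbody e; rewrite !lt_min => /andP[/andP[l2 l3] /andP[/andP[l4 l5] l6]].
rewrite ltr_pdivlMr// in l6.
have [c1 c2 c3 c4] : [/\ normc (a e - a0) < d, normc (b e - b0) < d, `|A0 * e ^+ m| < d & `|t e| < d].
  by apply: H5; rewrite e0.
exists (a e), (b e), (1 + A0 * e ^+ m), (t e), (P e), (fun i => e * (i%:R + 1 / 2)); split.
- by split=> //; rewrite addrC addKr.
- exact: HP.
- by move=> s; apply: deg; rewrite e0.
- split=> [i _|p /andP[p1 p2]]; first by rewrite ltr_pM2l// ltrD2r ltr_nat.
  have [||_ ? ?] := H4 e p; first by rewrite e0.
    by move: p1 p2; rewrite mulr0n add0r ![e * _]mulrC => -> ->.
  by split=> //; apply: le_lt_trans p2 _.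
- move=> i im; have g1 := H3 e _ i (ltnW im); have g2 := H3 e _ i.+1 im.
  rewrite e0 l3 in g1 g2; have := mulr_gt0 (g1 isT) (g2 isT); have := alt i im.
  set u1 := closing_defect _ _ _ _ _; set u2 := closing_defect _ _ _ _ _.
  set v1 := defect_limit _ _ _ _; set v2 := defect_limit _ _ _ _ => v0.
  by rewrite mulrACA nmulr_lgt0.
Qed.

End WeightedBifurcation.

(** * Choice of the parameters *)

Section Cases.
Variable R : realType.
Local Notation C := R[i].

Lemma cL0_ge_two_halves (np nm k : nat) (a b a' b' : C) (s s' : R) :
  has_degrees np nm (two_halves a b s 0 a' b' s') ->
  bifurcating np nm k (two_halves a b s 0 a' b' s') ->
  ((k%:R)%:E <= cL0 R np nm)%E /\ ((k%:R)%:E <= cL0 R nm np)%E.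
Proof.
move=> deg bif; split; apply: ereal_sup_ubound; exists k => //.
  by exists (two_halves a b s 0 a' b' s'); split=> //; exact: monodromic_origin_two_halves.
exists (two_halves a' b' s' 0 a b s); split; first by rewrite -rot_two_halves; exact: has_degrees_rot.
  exact: monodromic_origin_two_halves.
by rewrite -rot_two_halves; exact: bifurcating_rot.
Qed.

Lemma asym_horner (p : {poly R}) : asym 0 p.[0] (fun e => p.[e]).
Proof.
elim/poly_ind: p => [|p c IH].
  by rewrite horner0; apply: (asym_ext ltr01) (asym_cst 0) => e _; rewrite horner0.
rewrite hornerMXaddC; have id0 : asym 0 (0 : R) id.
  by apply: asym0; apply: (Oe_ext ltr01) (Oe_exp R 1) => e _; rewrite expr1.
by apply: (asym_ext ltr01) (asymD (asymM IH id0) (asym_cst c)) => e _; rewrite hornerMXaddC.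
Qed.

Lemma asym_of_poly m c (f : R -> R) (p : {poly R}) :
  (forall e, f e = e ^+ m * p.[e]) -> p.[0] = c -> asym m c f.
Proof.
move=> fE <-; have h := asymM (asym_exp 1 m) (asym_horner p).
rewrite addn0 mul1r in h; apply: (asym_ext ltr01) h => e _; by rewrite fE mul1r.
Qed.

Lemma Oe_normc (f1 f2 : R -> R) (x1 x2 : R) : asym 0 x1 f1 -> asym 0 x2 f2 ->
  Oe 1 (fun e => normc ((f1 e +i* f2 e) - (x1 +i* x2))).
Proof.
have Oabs (g : R -> R) : Oe 1 g -> Oe 1 (fun e => `|g e|).
  by apply: (Oe_le ltr01) => e _; rewrite normr_id.
move=> /Oabs h1 /Oabs h2; apply: (Oe_le ltr01) (OeD h1 h2) => e _.
rewrite expr0 !mulr1 (ger0_norm (normc_ge0 _)) (le_trans (normc_le_ReIm _))//=.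
exact: ler_norm.
Qed.

(** Multiplication by [xi > 0] turns [defect_limit] into a polynomial and keeps its sign. *)
Lemma alternation_of_poly (L q : R -> R) (g x y : R) : g != 0 -> 0 < x -> 0 < y ->
  (forall xi, 0 < xi -> xi * L xi = g * q xi) -> q x * q y < 0 -> L x * L y < 0.
Proof.
move=> g0 x0 y0 H qq.
have : (x * L x) * (y * L y) < 0 by rewrite !H// mulrACA -expr2 pmulr_rlt0// exprn_even_gt0.
by rewrite mulrACA pmulr_rlt0// mulr_gt0.
Qed.

Lemma phase_form_log_coef (s a1 a2 b1 b2 : R) :
  let q j := phase_form s (log_coef (a1 +i* a2) (b1 +i* b2) j) in
  [/\ q 1 = - s * a2 + a1,
      q 2 = s * (2 * a1 * a2 - b2) - (a1 ^+ 2 - a2 ^+ 2 - b1),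
      q 3 = s * (2 * (a1 * b2 + a2 * b1) - (3 * a1 ^+ 2 * a2 - a2 ^+ 3)) -
            (2 * (a1 * b1 - a2 * b2) - (a1 ^+ 3 - 3 * a1 * a2 ^+ 2)) &
      q 4 = s * ((4 * a1 ^+ 3 * a2 - 4 * a1 * a2 ^+ 3)
                 - 3 * ((a1 ^+ 2 - a2 ^+ 2) * b2 + 2 * a1 * a2 * b1) + 2 * b1 * b2) -
            ((a1 ^+ 4 - 6 * a1 ^+ 2 * a2 ^+ 2 + a2 ^+ 4)
                 - 3 * ((a1 ^+ 2 - a2 ^+ 2) * b1 - 2 * a1 * a2 * b2) + (b1 ^+ 2 - b2 ^+ 2))].
Proof.
move=> q; have n2 : (2 : C) = 2%:C by rewrite rmorph_nat.
have n3 : (3 : C) = 3%:C by rewrite rmorph_nat.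
rewrite /q /phase_form /log_coef n2 n3; split; rewrite !exprS !expr0 /=; ring.
Qed.

Lemma phase_form_log_coef_b0 (s a1 a2 : R) :
  let q j := phase_form s (log_coef (a1 +i* a2) 0 j) in
  [/\ q 1 = - s * a2 + a1,
      q 2 = s * (2 * a1 * a2) - (a1 ^+ 2 - a2 ^+ 2),
      q 3 = (a1 ^+ 3 - 3 * a1 * a2 ^+ 2) - s * (3 * a1 ^+ 2 * a2 - a2 ^+ 3) &
      q 4 = s * (4 * a1 ^+ 3 * a2 - 4 * a1 * a2 ^+ 3) -
            (a1 ^+ 4 - 6 * a1 ^+ 2 * a2 ^+ 2 + a2 ^+ 4)].
Proof. by have [h1 h2 h3 h4] := phase_form_log_coef s a1 a2 0 0; split; rewrite ?h1 ?h2 ?h3 ?h4; ring. Qed.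

Lemma phase_form_log_coef0 (s : R) j : phase_form s (log_coef 0 0 j) = 0.
Proof.
by case: j => [|[|[|[|[|j]]]]] /=;
   rewrite ?oppr0 ?expr0n /= ?subr0 ?mulr0 ?oppr0 ?addr0 /phase_form /= ?mulr0 ?oppr0 ?addr0 ?subr0.
Qed.

Let k : R := expR (- pi).

Lemma expR_Npi_bounds : 0 < k < 1.
Proof. by rewrite expR_gt0 /k -[ltRHS]expR0 ltr_expR oppr_lt0 pi_gt0. Qed.

(** Both halves are linear, so [t] and [s] are the only parameters; they produce the polynomial
    [xi - 1]. *)
Lemma cL0_11 : ((1%:R)%:E <= cL0 R 1 1)%E /\ ((1%:R)%:E <= cL0 R 1 1)%E.
Proof.
have /andP[k0 k1] := expR_Npi_bounds.
have k10 : 0 < 1 + k^-1 by rewrite addr_gt0// invr_gt0.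
have p0 : 0 < pi :> R := pi_gt0 R.
have deg s t : has_degrees 1 1 (two_halves (0 : C) 0 s t 0 0 (-1)).
  by split; rewrite /= ?oppr0 size_half_poly1.
apply: (@cL0_ge_two_halves 1 1 1 0 0 0 0 1 (-1)); last first.
apply: (@bifurcating_of_weights R 0 0 0 0 (fun=> 0) (fun=> 0) 1 1 1 1 (pi^-1) ((1 + k^-1)^-1) 1 (fun=> 0)).
- by [].
- by [].
- exact: ltr01.
- by apply: (Oe_ext ltr01) (OeZ 0 (Oe_exp R 1)) => e _; rewrite subr0 normc0 mul0r.
- by apply: (Oe_ext ltr01) (OeZ 0 (Oe_exp R 1)) => e _; rewrite subr0 normc0 mul0r.
- by move=> e s t _; exact: deg.
- move=> j _; apply: (@asym_of_poly _ _ _ 0); rewrite ?horner0// => e.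
  by rewrite horner0 /defect_coef !phase_form_log_coef0 mulr0 subr0 mul0r mulr0.
- have H xi : 0 < xi -> xi * defect_limit (pi^-1) ((1 + k^-1)^-1) (fun=> 0) xi = 1 * (xi - 1).
    move=> x0; rewrite /defect_limit -/k; move: (pi : R) p0 => q q0; field.
    by rewrite !lt0r_neq0//; lra.
  by case=> [|i] // _; apply: (alternation_of_poly (oner_neq0 _) _ _ H); lra.
by exact: deg.
Qed.

Let hE := (hornerD, hornerN, hornerM, hornerC, hornerX, hornerXn, horner_exp).

Lemma cL0_21 : ((3%:R)%:E <= cL0 R 2 1)%E /\ ((3%:R)%:E <= cL0 R 1 2)%E.
Proof.
(* [a = - eta (2 + i c1 e)] with [eta = (1 + i) / 2]; the constants are chosen to make
   [xi * defect_limit xi] a multiple of [(xi - 1) (xi - 2) (xi - 3)]. *)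
have /andP[k0 k1] := expR_Npi_bounds.
have k10 : 0 < 1 + k^-1 by rewrite addr_gt0// invr_gt0.
have p0 : 0 < pi :> R := pi_gt0 R.
(* [g] is the coefficient of [xi^3] when [c 2 = 2]. The numbers 6, 11, 6 are the coefficients of
   [(xi - 1) (xi - 2) (xi - 3)] up to sign, and the denominators undo the factors of
   [defect_limit]. *)
pose g := 1 - k ^+ 2; have g0 : 0 < g by rewrite subr_gt0 expr_lt1// ltW.
pose A0 := 11 * g / pi; pose B0 := 6 * g / (1 + k^-1); pose c1 := 6 * g / (1 + k).
have c10 : 0 < c1 by rewrite /c1 divr_gt0// ?mulr_gt0//; lra.
have c1E : c1 = 6 * g / (1 + k) by []; clearbody c1.
(* The point of [eta] is that [phase_form 1 (eta h) = Im h]: the coefficient of degree 1 is [c1 e],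
   by inspection. *)
pose a e : C := (- 1 + c1 * e / 2) +i* (- 1 - c1 * e / 2).
have deg e s t : 0 <= e -> has_degrees 2 1 (two_halves (a e) 0 s t 0 0 (-1)).
  move=> e0; split; rewrite /= ?oppr0 ?size_half_poly1// size_half_poly2//.
  have : 0 <= c1 * e by rewrite mulr_ge0// ltW.
  by move=> h; rewrite eq_complex /= negb_and; apply/orP; right; apply: ltr0_neq0; lra.
pose c j := if j is 1 then c1 else if j is 2 then 2 else 0 : R.
apply: (@cL0_ge_two_halves 2 1 3 (-1 -i* 1) 0 0 0 1 (-1)); last first.
apply: (@bifurcating_of_weights R 0 0 (-1 -i* 1) 0 a (fun=> 0) 2 3 2 1 A0 B0 1 c).
- by [].
- by [].
- exact: ltr01.
- apply: Oe_normc.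
    by apply: (@asym_of_poly _ _ _ (- 1 + (c1 / 2)%:P * 'X)) => [e|]; rewrite !hE; field.
  by apply: (@asym_of_poly _ _ _ (- 1 - (c1 / 2)%:P * 'X)) => [e|]; rewrite !hE; field.
- by apply: (Oe_ext ltr01) (OeZ 0 (Oe_exp R 1)) => e _; rewrite subr0 normc0 mul0r.
- by move=> e s t /andP[e0 _]; apply: deg; exact: ltW.
- pose al : {poly R} := - 1 + (c1 / 2)%:P * 'X; pose be : {poly R} := - 1 - (c1 / 2)%:P * 'X.
  have q e := phase_form_log_coef_b0 1 (- 1 + c1 * e / 2) (- 1 - c1 * e / 2).
  case=> [|[|[|[|[|j]]]]] // _; rewrite /c /defect_coef.
  + apply: (@asym_of_poly _ _ _ c1%:P) => [e|]; rewrite ?hE//.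
    by rewrite phase_form_log_coef0; have [-> _ _ _] := q e; field.
  + apply: (@asym_of_poly _ _ _ (2%:P + (2 * c1)%:P * 'X - (c1 ^+ 2 / 2)%:P * 'X^2)) => [e|]; rewrite !hE; last by field.
    by rewrite phase_form_log_coef0; have [_ -> _ _] := q e; field.
  + apply: (@asym_of_poly _ _ _ ('X * (al ^+ 3 - 3%:P * al * be ^+ 2 - (3%:P * al ^+ 2 * be - be ^+ 3)))) => [e|];
      rewrite !hE; last by field.
    by rewrite phase_form_log_coef0; have [_ _ -> _] := q e; field.
  + apply: (@asym_of_poly _ _ _ ('X ^+ 2 * ((4%:P * al ^+ 3 * be - 4%:P * al * be ^+ 3) -
      (al ^+ 4 - 6%:P * al ^+ 2 * be ^+ 2 + be ^+ 4)))) => [e|]; rewrite !hE; last by field.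
    by rewrite phase_form_log_coef0; have [_ _ _ ->] := q e; field.
- have H xi : 0 < xi -> xi * defect_limit A0 B0 c xi = g * ((xi - 1) * (xi - 2) * (xi - 3)).
    move=> x0; rewrite /defect_limit -/k /A0 /B0 /c c1E /g; move: (pi : R) p0 => q q0; field.
    by rewrite !lt0r_neq0//; lra.
  by case=> [|[|[|i]]] // _; apply: (alternation_of_poly (lt0r_neq0 g0) _ _ H); lra.
have := deg 0 1 0 (lexx _).
by rewrite /a mulr0 mul0r addr0 subr0.
Qed.
End Cases.

Section MoreCases.
Variable R : realType.
Local Notation C := R[i].
Let k : R := expR (- pi).
Let hE := (hornerD, hornerN, hornerM, hornerC, hornerX, hornerXn, horner_exp).

Lemma cL0_22 : ((4%:R)%:E <= cL0 R 2 2)%E /\ ((4%:R)%:E <= cL0 R 2 2)%E.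
Proof.
(* [a = - (1 + i) / 2 * (c2 e + i (1 + c1 e^2))] and [a' = - (3 - i) / 2]: the coefficients
   of degrees 1 and 2 vanish at [e = 0] and that of degree 3 is 1. *)
have /andP[k0 k1] : 0 < k < 1 := expR_Npi_bounds R.
have k10 : 0 < 1 + k^-1 by rewrite addr_gt0// invr_gt0.
have p0 : 0 < pi :> R := pi_gt0 R.
have k30 : 0 < k ^+ 3 by rewrite exprn_gt0.
have k21 : 0 < 1 - k ^+ 2 by rewrite subr_gt0 expr_lt1// ltW.
(* [g] is the coefficient of [xi^4] when [c 3 = 1]; 24, 50, 35 and 10 come from expanding
   [(xi - 1) (xi - 2) (xi - 3) (xi - 4)]. *)
pose g := - ((1 + k ^+ 3) / 3); have g0 : g < 0 by rewrite /g; lra.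
pose A0 : R := - 50 * g / pi; pose B0 : R := - 24 * g / (1 + k^-1).
pose c1 : R := - 35 * g / (1 + k); pose c2 : R := - 20 * g / (1 - k ^+ 2).
have c10 : 0 < c1 by rewrite /c1 divr_gt0//; lra.
have c1E : c1 = - 35 * g / (1 + k) by []; have c2E : c2 = - 20 * g / (1 - k ^+ 2) by [].
clearbody c1 c2.
pose al : {poly R} := (1 / 2)%:P - (c2 / 2)%:P * 'X + (c1 / 2)%:P * 'X^2.
pose be : {poly R} := (- 1 / 2)%:P - (c2 / 2)%:P * 'X - (c1 / 2)%:P * 'X^2.
pose a e : C := al.[e] +i* be.[e].
(* For [a'] the forms of degrees 1 and 2 are [- 1] and [- 1 / 2], which cancel the values [1] and
   [- 1 / 2] of [a 0] in [defect_coef]. *)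
pose a' : C := (- 3 / 2) +i* (1 / 2).
have a0 e : a e != 0.
  rewrite eq_complex /=; apply/negP => /andP[/eqP h1 /eqP h2].
  have : al.[e] - be.[e] = 1 + c1 * e ^+ 2 by rewrite /al /be !hE; field.
  by rewrite h1 h2; have := mulr_ge0 (ltW c10) (sqr_ge0 e); lra.
have deg e s t : has_degrees 2 2 (two_halves (a e) 0 s t a' 0 (-1)).
  split; rewrite /= size_half_poly2// /a' eq_complex /= negb_and; apply/orP; right.
  by apply: ltr0_neq0; lra.
pose c j := if j is 1 then c1 else if j is 2 then c2 else if j is 3 then 1 else 0 : R.
apply: (@cL0_ge_two_halves R 2 2 4 ((1 / 2) +i* (- 1 / 2)) 0 a' 0 1 (-1)); last first.
apply: (@bifurcating_of_weights R a' 0 ((1 / 2) +i* (- 1 / 2)) 0 a (fun=> 0) 3 4 2 2 A0 B0 1 c).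
- by [].
- by [].
- exact: ltr01.
- apply: Oe_normc; [apply: (@asym_of_poly _ _ _ _ al) => [e|]|apply: (@asym_of_poly _ _ _ _ be) => [e|]];
    by rewrite ?expr0 ?mul1r// /al /be !hE; field.
- by apply: (Oe_ext ltr01) (OeZ 0 (Oe_exp R 1)) => e _; rewrite subr0 normc0 mul0r.
- by move=> e s t _; exact: deg.
- have q e := phase_form_log_coef_b0 1 al.[e] be.[e].
  have [q1 q2 q3 q4] := phase_form_log_coef_b0 (-1 : R) (- 3 / 2) (1 / 2).
  case=> [|[|[|[|[|j]]]]] // _; rewrite /c /defect_coef.
  + apply: (@asym_of_poly _ _ _ _ c1%:P) => [e|]; rewrite hE//.
    by rewrite q1; have [-> _ _ _] := q e; rewrite /al /be !hE; field.
  + apply: (@asym_of_poly _ _ _ _ (c2%:P + (c2 ^+ 2 / 2 - c1)%:P * 'X + (c1 * c2)%:P * 'X^2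
      - (c1 ^+ 2 / 2)%:P * 'X^3)) => [e|]; rewrite !hE; last by field.
    by rewrite q2; have [_ -> _ _] := q e; rewrite /al /be !hE; field.
  + apply: (@asym_of_poly _ _ _ _ (al ^+ 3 - 3%:P * al * be ^+ 2 - (3%:P * al ^+ 2 * be - be ^+ 3) + 1%:P)) => [e|].
      by rewrite q3; have [_ _ -> _] := q e; rewrite !hE; field.
    by rewrite /al /be !hE; field.
  + apply: (@asym_of_poly _ _ _ _ ('X * ((4%:P * al ^+ 3 * be - 4%:P * al * be ^+ 3) -
      (al ^+ 4 - 6%:P * al ^+ 2 * be ^+ 2 + be ^+ 4) - (17 / 4)%:P))) => [e|].
      by rewrite q4; have [_ _ _ ->] := q e; rewrite !hE; field.
    by rewrite /al /be !hE; field.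
- have H xi : 0 < xi -> xi * defect_limit A0 B0 c xi = g * ((xi - 1) * (xi - 2) * (xi - 3) * (xi - 4)).
    move=> x0; rewrite /defect_limit -/k /A0 /B0 /c c1E c2E /g; move: (pi : R) p0 => q q0; field.
    rewrite !lt0r_neq0//; lra.
  by case=> [|[|[|[|i]]]] // _; apply: (alternation_of_poly (ltr0_neq0 g0) _ _ H); clear -k hE; lra.
have := deg 0 1 0.
by rewrite /a /al /be !hE !mulr0 !addr0 !subr0.
Qed.

Lemma cL0_31 : ((5%:R)%:E <= cL0 R 3 1)%E /\ ((5%:R)%:E <= cL0 R 1 3)%E.
Proof.
(* [a = - eta h1] and [b = eta^2 h1^2 - eta h2], where [eta = (1 + i) / 2],
   [h1 = 2 + i c1 e^3] and [h2 = 2 + c3 e / 2 + i c2 e^2]: the coefficients of degrees 1, 2, 3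
   vanish at [e = 0] and that of degree 4 is 2. *)
have /andP[k0 k1] : 0 < k < 1 := expR_Npi_bounds R.
have k10 : 0 < 1 + k^-1 by rewrite addr_gt0// invr_gt0.
have p0 : 0 < pi :> R := pi_gt0 R.
have k30 : 0 < k ^+ 3 by rewrite exprn_gt0.
have k21 : 0 < 1 - k ^+ 2 by rewrite subr_gt0 expr_lt1// ltW.
(* [g] is the coefficient of [xi^5] when [c 4 = 2]. The polynomial with roots 1 to 5 has the
   coefficients 15, 85, 225, 274, 120 up to sign; [defect_limit] divides degrees 2 and 3 by 2 and 3,
   hence 170 and 45. *)
pose g := (1 - k ^+ 4) / 2; have g0 : 0 < g by rewrite divr_gt0// subr_gt0 expr_lt1// ltW.
pose A0 : R := 274 * g / pi; pose B0 : R := 120 * g / (1 + k^-1).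
pose c1 : R := 225 * g / (1 + k); pose c2 : R := 170 * g / (1 - k ^+ 2); pose c3 : R := 45 * g / (1 + k ^+ 3).
have c1E : c1 = 225 * g / (1 + k) by []; have c2E : c2 = 170 * g / (1 - k ^+ 2) by [].
have c3E : c3 = 45 * g / (1 + k ^+ 3) by []; clearbody c1 c2 c3.
pose y1 : {poly R} := c1%:P * 'X^3; pose y2 : {poly R} := c2%:P * 'X^2.
(* [a^2 - b = eta h2] makes the coefficient of degree 2 equal to [Im h2]. For [h1 = 2] and [h2 = x]
   real, that of degree 3 is [2 (x - 2)]: this forces the value 2 at [e = 0] and the slope
   [c3 / 2]. *)
pose x : {poly R} := 2%:P + (c3 / 2)%:P * 'X.
pose a1 : {poly R} := (- 1)%:P + (1 / 2)%:P * y1; pose a2 : {poly R} := (- 1)%:P - (1 / 2)%:P * y1.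
pose b1 : {poly R} := - 2%:P * y1 - (1 / 2)%:P * (x - y2).
pose b2 : {poly R} := 2%:P - (1 / 2)%:P * y1 ^+ 2 - (1 / 2)%:P * (x + y2).
pose a e : C := a1.[e] +i* a2.[e]; pose b e : C := b1.[e] +i* b2.[e].
have b10 : b1.[0] = - 1 by rewrite /b1 /x /y1 /y2 !hE; field.
have b20 : b2.[0] = 1 by rewrite /b2 /x /y1 /y2 !hE; field.
have a10 : a1.[0] = - 1 by rewrite /a1 /y1 !hE; field.
have a20 : a2.[0] = - 1 by rewrite /a2 /y1 !hE; field.
have deg e s t : b1.[e] * b1.[0] > 0 -> has_degrees 3 1 (two_halves (a e) (b e) s t 0 0 (-1)).
  move=> h; split; rewrite /= ?oppr0 ?size_half_poly1// size_half_poly3//.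
  by rewrite eq_complex /= negb_and; apply/orP; left; apply: contraTneq h => ->; rewrite mul0r ltxx.
(* The real part of [b e] stays close to [-1] for small [e], so the upper polynomial has degree
   exactly 3. *)
have [e2 e20 H2] := asym_sign (ltr0_neq0 (ltrN10 R)) (@asym_of_poly _ 0 _ _ b1 (fun e => esym (mul1r _)) b10).
pose c j := if j is 1 then c1 else if j is 2 then c2 else if j is 3 then c3 else 2 : R.
apply: (@cL0_ge_two_halves R 3 1 5 (-1 +i* -1) (-1 +i* 1) 0 0 1 (-1)); last first.
apply: (@bifurcating_of_weights R 0 0 (-1 +i* -1) (-1 +i* 1) a b 4 5 3 1 A0 B0 e2 c).
- by [].
- by [].
- by [].
- apply: Oe_normc; [apply: (@asym_of_poly _ _ _ _ a1) => [e|//]|apply: (@asym_of_poly _ _ _ _ a2) => [e|//]];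
    by rewrite expr0 mul1r.
- apply: Oe_normc; [apply: (@asym_of_poly _ _ _ _ b1) => [e|//]|apply: (@asym_of_poly _ _ _ _ b2) => [e|//]];
    by rewrite expr0 mul1r.
- by move=> e s t /H2 h; apply: deg; rewrite b10.
- have q e := phase_form_log_coef 1 a1.[e] a2.[e] b1.[e] b2.[e].
  case=> [|[|[|[|[|j]]]]] // _; rewrite /c /defect_coef phase_form_log_coef0.
  + apply: (@asym_of_poly _ _ _ _ c1%:P) => [e|]; rewrite hE//.
    by have [-> _ _ _] := q e; rewrite /a1 /a2 /y1 !hE; field.
  + apply: (@asym_of_poly _ _ _ _ c2%:P) => [e|]; rewrite hE//.
    by have [_ -> _ _] := q e; rewrite /a1 /a2 /b1 /b2 /x /y1 /y2 !hE; field.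
  + apply: (@asym_of_poly _ _ _ _ (c3%:P + (2 * c2)%:P * 'X + (2 * c1)%:P * 'X^2 + (c1 * c3 / 2)%:P * 'X^3
      - (c1 * c2)%:P * 'X^4 + (3 * c1 ^+ 2)%:P * 'X^5)) => [e|]; rewrite !hE; last by field.
    by have [_ _ -> _] := q e; rewrite /a1 /a2 /b1 /b2 /x /y1 /y2 !hE; field.
  + apply: (@asym_of_poly _ _ _ _ (
      (4%:P * a1 ^+ 3 * a2 - 4%:P * a1 * a2 ^+ 3)
        - 3%:P * ((a1 ^+ 2 - a2 ^+ 2) * b2 + 2%:P * a1 * a2 * b1) + 2%:P * b1 * b2
      - ((a1 ^+ 4 - 6%:P * a1 ^+ 2 * a2 ^+ 2 + a2 ^+ 4)
        - 3%:P * ((a1 ^+ 2 - a2 ^+ 2) * b1 - 2%:P * a1 * a2 * b2) + (b1 ^+ 2 - b2 ^+ 2)))) => [e|].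
      by have [_ _ _ ->] := q e; rewrite !hE; field.
    by rewrite /a1 /a2 /b1 /b2 /x /y1 /y2 !hE; field.
- have H xi : 0 < xi ->
      xi * defect_limit A0 B0 c xi = g * ((xi - 1) * (xi - 2) * (xi - 3) * (xi - 4) * (xi - 5)).
    move=> x0; rewrite /defect_limit -/k /A0 /B0 /c c1E c2E c3E /g; move: (pi : R) p0 => q q0; field.
    by rewrite !lt0r_neq0//; lra.
  by case=> [|[|[|[|[|i]]]]] // _; apply: (alternation_of_poly (lt0r_neq0 g0) _ _ H); clear -k hE; lra.
have := deg 0 1 0.
by rewrite /a /b a10 a20 b10 b20; apply; lra.
Qed.

End MoreCases.

Local Open Scope ereal_scope.

Theorem theoremB (R : realType) :
  (forall np nm : nat, (1 <= np)%N -> (1 <= nm)%N -> cL0 R np nm <= cL R np nm) /\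
  [/\ (1%:R)%:E <= cL0 R 1 1,
      (3%:R)%:E <= cL0 R 1 2 /\ (3%:R)%:E <= cL0 R 2 1,
      (5%:R)%:E <= cL0 R 1 3 /\ (5%:R)%:E <= cL0 R 3 1 &
      (4%:R)%:E <= cL0 R 2 2].
Proof.
split=> [np nm _ _|]; first exact: cL0_le_cL.
by have [? _] := cL0_11 R; have [? ?] := cL0_21 R; have [? ?] := cL0_31 R; have [? _] := cL0_22 R.
Qed.
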